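(* Let $B=(B_t:t\ge 0)$ be a one-dimensional Brownian motion with $B_0=0$, with completed natural filtration $(\mathcal{F}_t)$ and local time at $0$ denoted $(L_t:t\ge 0)$. Let $m$ be a probability measure on $\mathbb{R}_+=[0,\infty)$ with $\int_0^\infty x\,dm(x)<\infty$, and let $T$ be an $(\mathcal{F}_t)$-stopping time such that $|B_T|$ has law $m$ and $(B_{t\wedge T}:t\ge 0)$ is a uniformly integrable martingale. Let $T^m$ be the stopping time $T^m=\inf\{t>0:|B_t|=\varphi_m(L_t)\}$, with $\varphi_m$ as defined in the context. Denote by $\rho_T$ the law of $L_T$ and by $\rho_{T^m}$ the law of $L_{T^m}$. Then $$\mathbb{E}\Big[\Big(L_T-\overline{\rho}_T^{-1}(p)\Big)^+\Big]\le \mathbb{E}\Big[\Big(L_{T^m}-\overline{\rho}_{T^m}^{-1}(p^* )\Big)^+\Big],\qquad p\in[0,1],$$ where $p^*=\overline{m}\big(\overline{m}^{-1}(p)\big)\ge p$.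
   Context: For a probability measure $\mu$ on $\mathbb{R}_+$, $\overline{\mu}(x)=\mu([x,\infty))$ is its tail function, and $\overline{\mu}^{-1}$ is the left-continuous inverse of $\overline{\mu}$: $\overline{\mu}^{-1}(p)=\sup\{x\ge 0:\overline{\mu}(x)\ge p\}\in[0,\infty]$ for $p\in[0,1]$, with the conventions $\overline{\mu}(\infty)=0$ and $(x-\infty)^+=0$. Also $x^+=\max\{x,0\}$. The local time $L$ is normalized so that $|B_t|-L_t$ is a martingale (Tanaka's formula). The dual Hardy-Littlewood function $\psi_m:[0,\infty)\to[0,\infty]$ of $m$ is $$\psi_m(x)=\int_{[0,x]}\frac{y}{\overline{m}(y)}\,dm(y)\quad\text{for } x \text{ such that } \overline{m}(x)\in(0,1),$$ with $\psi_m(x)=0$ for $x$ such that $\overline{m}(x-)=1$ and $\psi_m(x)=\infty$ for $x$ such that $\overline{m}(x+)=0$ (here $\overline{m}(x\pm)$ are one-sided limits, $\overline{m}(0-)=1$; where two of these prescriptions overlap, take $\psi_m(x)=\infty$, a choice which does not affect $\varphi_m$). Its right inverse is $\varphi_m(y)=\inf\{x\ge 0:\psi_m(x)>y\}$, $y\ge 0$. *)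

(* Defs.v *)
From HB Require Import structures.
From mathcomp Require Import all_boot all_order all_algebra.
From mathcomp Require Import all_classical all_reals all_analysis.

Set Implicit Arguments.
Unset Strict Implicit.
Unset Printing Implicit Defensive.

Import Order.TTheory GRing.Theory Num.Theory.
Import numFieldNormedType.Exports.

Local Open Scope classical_set_scope.
Local Open Scope ring_scope.

(* Everything is on the real line: a measure on R_+ is a measure on R carried
   by [0, +oo[.  A process is a map X : R -> T -> R (time first), and only its
   values at times t >= 0 are ever constrained or used. *)

Section tails.
Context {R : realType}.
Implicit Types (mu : set (measurableTypeR R) -> \bar R).
Implicit Types (m : probability (measurableTypeR R) R) (x y p : R).

Definition tail mu x : R := fine (mu `[x, +oo[%classic).

Definition tail_ext mu (x : \bar R) : R :=
  if x is r%:E then tail mu r else 0.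

Definition tail_inv mu p : \bar R :=
  ereal_sup [set x%:E | x in [set x | 0 <= x /\ p <= tail mu x]].

Definition tail_left mu x : R := lim (tail mu y @[y --> x^'-]).
Definition tail_right mu x : R := lim (tail mu y @[y --> x^'+]).

(* For m carried by [0, +oo[, tail_left m 0 = 1, which is the convention for
   the left limit at 0, and for x >= 0 the last branch is exactly the case
   0 < tail m x < 1 with tail_right m x <> 0. *)
Definition dual_HL m x : \bar R :=
  if tail_right m x == 0 then +oo%E
  else if tail_left m x == 1 then 0%E
  else (\int[m]_(y in `[0%R, x]) (y / tail m y)%:E)%E.

Definition dual_HL_inv m y : \bar R :=
  ereal_inf [set x%:E | x in [set x | 0 <= x /\ (y%:E < dual_HL m x)%E]].

Definition pstar mu p : R := tail_ext mu (tail_inv mu p).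

End tails.

Section processes.
Context {d : measure_display} {T : measurableType d} {R : realType}.
Variable P : probability T R.
Implicit Types (F : R -> set (set T)) (X B L : R -> T -> R) (tau : T -> \bar R)
  (s t : R).

(* No completion here: the sigma-algebra generated by (B_s : 0 <= s <= t). *)
Definition natural_filtration B (t : R) : set (set T) :=
  <<s \bigcup_(s in `[0, t]) preimage_set_system setT (B s) measurable >>.

Definition completed_filtration B (t : R) : set (set T) :=
  <<s natural_filtration B t `|` P.-negligible >>.

Definition adapted F X : Prop :=
  forall (t : R) (Y : set R), 0 <= t -> measurable Y -> F t (X t @^-1` Y).

Definition stopping_time F tau : Prop :=
  (forall w, (0 <= tau w)%E) /\
  (forall t : R, 0 <= t -> F t [set w | (tau w <= t%:E)%E]).

(* Where tau = +oo this is the value at time 0; it is only meaningful for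
   random times which are almost surely finite. *)
Definition at_time X tau (w : T) : R := X (fine (tau w)) w.

Definition stopped X tau (t : R) (w : T) : R := X (fine (mine t%:E (tau w))) w.

Definition martingale F X : Prop :=
  [/\ adapted F X,
      forall t : R, 0 <= t -> P.-integrable setT (EFin \o X t) &
      forall (s t : R) (A : set T), 0 <= s -> s <= t -> F s A ->
        (\int[P]_(w in A) (X t w)%:E = \int[P]_(w in A) (X s w)%:E)%E].

Definition uniformly_integrable X : Prop :=
  forall e : R, 0 < e -> exists K : R, forall t : R, 0 <= t ->
    (\int[P]_(w in [set w | (K <= `|X t w|)%R]) (`|X t w|%R)%:E <= e%:E)%E.

Record brownian_motion B : Prop := {
  bm_measurable : forall t : R, 0 <= t -> measurable_fun setT (B t) ;
  bm_start : {ae P, forall w, B 0 w = 0} ;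
  bm_continuous :
    {ae P, forall w, {within `[0, +oo[, continuous (fun t : R => B t w)}} ;
  bm_gaussian : forall (s t : R) (Y : set R), 0 <= s -> s < t -> measurable Y ->
    P [set w | Y (B t w - B s w)] = normal_prob 0 (Num.sqrt (t - s)) Y ;
  bm_independent : forall (s t : R) (A : set T) (Y : set R), 0 <= s -> s < t ->
    natural_filtration B s A -> measurable Y ->
    P (A `&` [set w | Y (B t w - B s w)]) =
    (P A * P [set w | Y (B t w - B s w)%R])%E }.

(* L is the occupation density of B at 0; it is normalized so that |B| - L is
   a martingale, which is the normalization of Tanaka's formula and gives the
   factor 1 / (2 e) in the occupation density. *)
Record local_time_at_0 B L : Prop := {
  lt_adapted : adapted (completed_filtration B) L ;
  lt_continuous :
    {ae P, forall w, {within `[0, +oo[, continuous (fun t : R => L t w)}} ;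
  lt_occupation : {ae P, forall w, forall t : R, 0 <= t ->
    fine (lebesgue_measure [set s : R | 0 <= s <= t /\ `|B s w| < e]) / (2 * e)
      @[e --> (0 : R)^'+] --> L t w} ;
  lt_normalized :
    martingale (completed_filtration B) (fun t w => `|B t w| - L t w) }.

Definition hitting_time B L (m : probability (measurableTypeR R) R) (w : T) :
    \bar R :=
  ereal_inf [set t%:E | t in
    [set t : R | 0 < t /\ `|B t w|%:E = dual_HL_inv m (L t w)]].

(* E[(X - c)^+]; for c = +oo the integrand is maxe -oo 0 = 0. *)
Definition expected_excess (X : T -> R) (c : \bar R) : \bar R :=
  (\int[P]_w maxe ((X w)%:E - c) 0)%E.

End processes.

(* Main.v *)
(* With [X = |B|], the process [X - L] is a martingale and [L] grows only while
   [X = 0], so optional stopping gives E[X_S; L_S >= v] = E[(L_S - v)^+] for a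
   bounded stopping time S, and E[(L_T - v)^+] <= E[X_T; L_T >= v] by uniform
   integrability.  When P(L_T >= v) <= q, the right-hand side is at most
   int_0^oo min(q, mbar(x)) dx, where mbar is the tail of m.

   Let s(l) = P(L_{T^m} >= l).  Since X <= phi_m(L) before T^m, the same identity
   bounds the hazard rate of s at l by 1 / phi_m(l); comparing with the
   equation dpsi_m = y dm / mbar gives s(psi_m(x)) >= mbar(x), and summation by
   parts then gives E[(L_{T^m} - c)^+] >= int_0^oo min(q, mbar(x)) dx whenever
   s(c) >= q.  The theorem follows by taking v and c at the quantiles.  The law
   of |B_{T^m}| is never needed: when m has atoms it may differ from m.

   As phi_m may vanish at 0, T^m is obtained as a limit of the first hitting
   times of the barrier after L has reached a level eta > 0. *)

Require Import Defs.
From HB Require Import structures.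
From mathcomp Require Import all_boot all_order all_algebra.
From mathcomp Require Import all_classical all_reals all_analysis.
From mathcomp Require Import measurable_realfun ring lra.
Set Implicit Arguments.
Unset Strict Implicit.
Unset Printing Implicit Defensive.
Import Order.TTheory GRing.Theory Num.Theory.
Import numFieldNormedType.Exports.
Local Open Scope classical_set_scope.
Local Open Scope ring_scope.

(** * Reflected paths and their hitting of a barrier *)

Section paths.
Context {R : realType}.
Implicit Types (x l f : R -> R) (s t u v eta : R).

(** [|B|] and its local time enter only as a pair of continuous paths, the second nondecreasing and
    flat off the zeros of the first, whose difference is a martingale. For Brownian motion the path
    properties hold almost surely; they are made to hold everywhere by setting both processes to 0
    on the exceptional null set and freezing them at time 0 for negative times, so that path
    arguments are deterministic and take place on the whole line. The completed filtration contains
    that null set, which keeps the modification adapted. The integral of min(q, mbar) is handled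
    through its lower Riemann sums delta * sum_(j < J) min(q, mbar((j + 1) delta)): the excess at
    T^m dominates each of them, and the excess at T is at most delta plus any common bound of them.
    Integrability of m acts on the T^m side through Markov's bound x mbar(x) <= M. It forces phi_m
    to be finite, and at most linear along a sequence of levels going to infinity; each doubling of
    such a level shrinks the chance of escaping the barrier by a fixed factor, so the barrier is
    almost surely hit. *)

Record reflected_path x l : Prop := ReflectedPath {
  path_cont : continuous x ;
  path_lcont : continuous l ;
  path_ge0 : forall t, 0 <= x t ;
  path_x0 : x 0 = 0 ;
  path_l0 : forall t, t <= 0 -> l t = 0 ;
  path_homo : {homo l : s t / s <= t} ;
  path_flat : forall s t, s <= t -> (forall u, s <= u <= t -> 0 < x u) ->
    l s = l t }.

Lemma continuous_near (g : R -> R) u e : continuous g -> 0 < e ->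
  exists2 r, 0 < r & forall t, `|t - u| < r -> `|g t - g u| < e.
Proof.
move=> cg e0; have /cvgrPdist_lt/(_ e e0)/nbhs_ballP[r /= r0 rP] := cg u.
exists r => // t tr; rewrite distrC; apply: rP.
by rewrite /ball /= distrC.
Qed.

(** At the first time [l] reaches [v] the path [x] must vanish: were it positive there, [l] would be
    constant just before, and the level would have been reached earlier. *)
Lemma first_passage x l v s : reflected_path x l -> 0 < v -> v <= l s ->
  exists u, [/\ 0 < u <= s, l u = v, x u = 0 & forall t, t < u -> l t < v].
Proof.
move=> xl v0 vs; set A := [set t | v <= l t].
have Age t : A t -> 0 <= t.
  rewrite /A /= => vt; rewrite leNgt; apply/negP => t0.
  by move: vt; rewrite (path_l0 xl (ltW t0)) leNgt v0.
have hA : has_inf A by split; [exists s | exists 0 => t /Age].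
set u := inf A.
have us : u <= s by apply: (ge_inf hA.2).
have below t : t < u -> l t < v.
  move=> tu; rewrite ltNge; apply/negP => vt.
  by move: tu; rewrite ltNge => /negP; apply; apply: (ge_inf hA.2).
have luv : l u = v.
  apply/eqP; rewrite eq_le; apply/andP; split; rewrite leNgt; apply/negP => h.
    have h0 : 0 < l u - v by rewrite subr_gt0.
    have [r r0 /(_ (u - r / 2))] := continuous_near u (path_lcont xl) h0.
    have -> : `|u - r / 2 - u| < r by rewrite ltr_norml; lra.
    have := below (u - r / 2); have -> : u - r / 2 < u by lra.
    by move=> /(_ isT) h1 /(_ isT); rewrite ltr_norml; lra.
  have h0 : 0 < v - l u by rewrite subr_gt0.
  have [r r0 rP] := continuous_near u (path_lcont xl) h0.
  have [t At tu] : exists2 t, A t & t < u + r.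
    by apply: (inf_adherent r0 hA).
  have ut : u <= t by apply: (ge_inf hA.2).
  have : `|t - u| < r by rewrite ger0_norm; lra.
  by move=> /rP; rewrite ltr_norml; move: At; rewrite /A /=; lra.
have u0 : 0 < u.
  by rewrite ltNge; apply/negP => /(path_l0 xl); rewrite luv; lra.
exists u; split => //; first by rewrite u0.
apply/eqP; rewrite eq_le (path_ge0 xl) andbT.
rewrite leNgt; apply/negP => xu.
have [r r0 rP] := continuous_near u (path_cont xl) xu.
have : l (u - r / 2) = l u.
  apply: (path_flat xl); first by lra.
  move=> t /andP[t1 t2]; have : `|t - u| < r by rewrite ltr_norml; lra.
  by move=> /rP; rewrite ltr_norml; lra.
by have := below (u - r / 2); rewrite luv => + h; rewrite h; lra.
Qed.

Lemma positive_flat x l s : reflected_path x l -> 0 < x s ->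
  exists2 r, 0 < r & forall t, `|t - s| < r -> l t = l s.
Proof.
move=> xl xs.
have [r r0 rP] := continuous_near s (path_cont xl) xs.
exists r => // t; rewrite ltr_norml => tr.
have [st|ts] := leP s t.
  apply/esym; apply: (path_flat xl) => // u /andP[u1 u2].
  have /rP : `|u - s| < r by rewrite ltr_norml; lra.
  by rewrite ltr_norml; lra.
apply: (path_flat xl); first exact: ltW.
move=> u /andP[u1 u2].
have /rP : `|u - s| < r by rewrite ltr_norml; lra.
by rewrite ltr_norml; lra.
Qed.

(** Asking for [eta <= l t] discards the contacts near time 0, where [x], [l] and possibly [f]
    vanish together. *)
Definition hitting f x l eta : set R :=
  [set t | 0 < t /\ eta <= l t /\ x t = f (l t)].

Section barrier.
Variables (x l f : R -> R) (eta : R).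
Hypothesis xl : reflected_path x l.
Hypothesis eta0 : 0 < eta.
Hypothesis feta : forall v, eta <= v -> 0 < f v.

(** From the first passage at level [l s] up to [s] the path [l] is constant, so the barrier,
    possibly discontinuous in the level, stays at one height; [x] climbs there from 0 to at least
    that height and crosses it by the intermediate value theorem. *)
Lemma hitting_before s : eta <= l s -> f (l s) <= x s ->
  exists2 u, hitting f x l eta u & u <= s.
Proof.
move=> ls fs.
have [v [/andP[v0 vs] lv xv _]] := first_passage xl (lt_le_trans eta0 ls) (lexx _).
have [u] : exists2 u, u \in `[v, s] & x u = f (l s).
  apply: IVT => //.
    by apply: continuous_subspaceT => ?; apply: path_cont xl _.
  rewrite xv min_l; last exact: path_ge0 xl _.
  by rewrite max_r ?fs ?andbT ?(ltW (feta _)) //; apply: path_ge0 xl _.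
rewrite in_itv /= => /andP[vu us] xu.
have lu : l u = l s.
  by apply/eqP; rewrite eq_le (path_homo xl) //= -{1}lv (path_homo xl).
exists u => //; split; first exact: lt_le_trans vu.
by rewrite lu.
Qed.

(** As [f] may jump, the set of hits is not closed for free. Monotonicity gives [x >= f eta > 0] at
    the infimum, hence [l] is constant around it, and nearby hits are contacts with one and the same
    height. *)
Lemma inf_hitting : hitting f x l eta !=set0 ->
  (forall v w, eta <= v -> v <= w -> f v <= f w) ->
  hitting f x l eta (inf (hitting f x l eta)).
Proof.
set H := hitting _ _ _ _ => H0 fhomo; set t0 := inf H.
have hH : has_inf H by split => //; exists 0 => t [/ltW].
have near_t0 r : 0 < r -> exists2 t, H t & `|t - t0| < r.
  move=> r0; have [t Ht tr] := inf_adherent r0 hH; exists t => //.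
  by rewrite ger0_norm ?subr_ge0 ?(ge_inf hH.2) // ltrBlDl.
have xpos : f eta <= x t0.
  rewrite leNgt; apply/negP => h.
  have h0 : 0 < f eta - x t0 by rewrite subr_gt0.
  have [r r0 rP] := continuous_near t0 (path_cont xl) h0.
  have [t [_ [lt xt]] /rP] := near_t0 r r0.
  have fl := fhomo _ _ (lexx eta) lt; rewrite xt ltr_norml => /andP[h1 h2]; lra.
have x0 : 0 < x t0 by apply: lt_le_trans (feta (lexx _)) xpos.
have [r r0 rP] := positive_flat xl x0.
have lt0 : eta <= l t0.
  by have [t [_ [lt _]] /rP <-] := near_t0 r r0.
split; last split => //.
  by rewrite ltNge; apply/negP => /(path_l0 xl) h; move: lt0; rewrite h leNgt eta0.
apply/eqP/negPn/negP => ne.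
have h0 : 0 < `|x t0 - f (l t0)| by rewrite normr_gt0 subr_eq0.
have [r' r'0 r'P] := continuous_near t0 (path_cont xl) h0.
have m0 : 0 < Num.min r r' by rewrite lt_min r0.
have [t [_ [_ xt]] tr] := near_t0 _ m0.
have /rP lt : `|t - t0| < r by rewrite (lt_le_trans tr) ?ge_min ?lexx.
have : `|t - t0| < r' by rewrite (lt_le_trans tr) ?ge_min ?lexx ?orbT.
by move=> /r'P; rewrite xt lt distrC ltxx.
Qed.

Lemma below_barrier t : eta <= l t -> (forall u, hitting f x l eta u -> t <= u) ->
  x t <= f (l t).
Proof.
move=> lt tH; rewrite leNgt; apply/negP => h.
have [u Hu ut] := hitting_before lt (ltW h).
have ut' : u = t by apply/eqP; rewrite eq_le ut tH.
by case: Hu => _ [_]; rewrite ut' => h'; rewrite h' ltxx in h.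
Qed.

(** Projection of a rational on [[0, t]]: a countable dense family of times at which the paths are
    known at time [t]. *)
Definition clip t (q : rat) : R := Num.max 0 (Num.min t (ratr q)).

Lemma clip_itv t q : 0 <= t -> 0 <= clip t q <= t.
Proof. by move=> t0; rewrite /clip le_max lexx /= ge_max t0 ge_min lexx. Qed.

Lemma clip_dense t s r : 0 <= s <= t -> 0 < r -> exists q, `|clip t q - s| < r.
Proof.
move=> /andP[s0 st] r0.
have [q] : exists q, ratr q \in `]s, (s + r)[.
  by apply: rat_in_itvoo; rewrite ltrDl.
rewrite in_itv /= => /andP[q1 q2]; exists q.
rewrite /clip; have [h|h] := leP t (ratr q).
  by rewrite max_r ?(le_trans s0) // ger0_norm; lra.
by rewrite max_r ?ger0_norm; lra.
Qed.

(** A description of the event by countably many times, from which its measurability follows. At a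
    hit [x] is positive, so [l] is locally constant and rational times see the same level;
    conversely, [x] attains its maximum on the compact set of times in [[0, t]] at that level, and
    approximate contacts give a true one. *)
Lemma hitting_le_rat t : 0 <= t ->
  (exists2 u, hitting f x l eta u & u <= t) <->
  exists q : rat, eta <= l (clip t q) /\ forall k : nat, exists s : rat,
    l (clip t s) = l (clip t q) /\ f (l (clip t q)) - k.+1%:R^-1 < x (clip t s).
Proof.
move=> t0; split=> [[u [u0 [lu xu]] ut]|[q [lq qP]]].
  have x0 : 0 < x u by rewrite xu feta.
  have [r r0 rP] := positive_flat xl x0.
  have u0t : 0 <= u <= t by rewrite ltW.
  have [q /rP lq] := clip_dense u0t r0.
  exists q; rewrite lq; split => // k.
  have k0 : 0 < k.+1%:R^-1 :> R by rewrite invr_gt0.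
  have [r' r'0 r'P] := continuous_near u (path_cont xl) k0.
  have m0 : 0 < Num.min r r' by rewrite lt_min r0.
  have [s sm] := clip_dense u0t m0.
  exists s; split.
    by apply: rP; rewrite (lt_le_trans sm) ?ge_min ?lexx.
  have : `|clip t s - u| < r' by rewrite (lt_le_trans sm) ?ge_min ?lexx ?orbT.
  by move=> /r'P; rewrite -xu ltr_norml ltrBrDl => /andP[].
set v := l (clip t q) in lq qP.
pose K := `[0, t] `&` l @^-1` [set v].
have cK : compact K.
  apply: (@subclosed_compact _ _ `[0, t]).
  - apply: closedI; first exact: itv_closed.
    by apply: closed_comp; [move=> ? _; apply: path_lcont xl _|exact: closed_eq].
  - exact: segment_compact.
  - exact: subIsetl.
have K0 : K !=set0 by exists (clip t q); split => //=; rewrite in_itv /= clip_itv.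
have [c + cmax] : exists2 c, c \in K & forall s, s \in K -> x s <= x c.
  apply: compact_EVT_max => //.
  by apply: continuous_subspaceT => ?; apply: path_cont xl _.
rewrite inE => -[+ lcv]; rewrite /= in_itv /= => /andP[c0 ct].
have fc : f v <= x c.
  apply/ler_addgt0Pr => e e0.
  have [k ke] : exists k : nat, k.+1%:R^-1 < e.
    by have [k /=] := ltr_add_invr e0; rewrite add0r => ke; exists k.
  have [s [ls xs]] := qP k.
  have : x (clip t s) <= x c.
    by apply: cmax; rewrite inE; split => //; rewrite /= in_itv /= clip_itv.
  by move: (k.+1%:R^-1) xs ke; rewrite -/v => k' xs ke; lra.
have lcv' : l c = v by [].
have [u Hu uc] : exists2 u, hitting f x l eta u & u <= c.
  by apply: hitting_before; rewrite lcv'.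
by exists u => //; apply: le_trans ct.
Qed.

End barrier.
End paths.

(** * Means of random variables *)

Lemma continuous_maxc (R : realType) (c : R) : continuous (fun x : R => Num.max x c).
Proof.
move=> x; rewrite /continuous_at.
rewrite (_ : (fun _ => _) = fun y : R => (y + c + `|y - c|) / 2); last first.
  by apply/funext => y; rewrite maxr_absE.
rewrite maxr_absE; apply: cvgMl; apply: cvgD.
  by apply: cvgD; [exact: cvg_id|exact: cvg_cst].
by apply: cvg_norm; apply: cvgB; [exact: cvg_id|exact: cvg_cst].
Qed.

Lemma continuous_minc (R : realType) (c : R) : continuous (fun x : R => Num.min x c).
Proof.
move=> x; rewrite /continuous_at.
rewrite (_ : (fun _ => _) = fun y : R => (y + c - `|y - c|) / 2); last first.
  by apply/funext => y; rewrite minr_absE.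
rewrite minr_absE; apply: cvgMl; apply: cvgB.
  by apply: cvgD; [exact: cvg_id|exact: cvg_cst].
by apply: cvg_norm; apply: cvgB; [exact: cvg_id|exact: cvg_cst].
Qed.

Lemma cvg_maxc (R : realType) (u : nat -> R) (x c : R) :
  u @ \oo --> x -> (fun n => Num.max (u n) c) @ \oo --> Num.max x c.
Proof.
move=> ux.
exact: (@cvg_comp _ _ _ u (fun y => Num.max y c) _ _ _ ux (@continuous_maxc _ c x)).
Qed.

Lemma cvg_minc (R : realType) (u : nat -> R) (x c : R) :
  u @ \oo --> x -> (fun n => Num.min (u n) c) @ \oo --> Num.min x c.
Proof.
move=> ux.
exact: (@cvg_comp _ _ _ u (fun y => Num.min y c) _ _ _ ux (@continuous_minc _ c x)).
Qed.

Lemma EFin_cvg (R : realType) (u : nat -> R) (x : R) :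
  u @ \oo --> x -> (EFin \o u) @ \oo --> x%:E.
Proof. by move=> ux; apply: cvg_EFin; [exact: nearW|exact: ux]. Qed.

Section expectation.
Context {d : measure_display} {T : measurableType d} {R : realType}.
Variable P : probability T R.
Implicit Types (X Y : T -> R) (A : set T) (a b c e : R).

Local Notation mean X := (Rintegral P setT X).
Local Notation intg X := (P.-integrable setT (EFin \o X)).

Lemma intg_measurable X : intg X -> measurable_fun setT X.
Proof. by move=> /integrableP[/measurable_EFinP]. Qed.

Lemma EFin_mean X : intg X -> (\int[P]_w (X w)%:E)%E = (mean X)%:E.
Proof. by move=> iX; rewrite /Rintegral fineK// integrable_fin_num. Qed.

Lemma intg_dom X Y : measurable_fun setT X -> intg Y ->
  (forall w, `|X w| <= Y w) -> intg X.
Proof.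
move=> mX iY XY; apply: le_integrable iY => //; first exact/measurable_EFinP.
by move=> w _ /=; rewrite lee_fin (le_trans (XY w)) // ler_norm.
Qed.

Lemma intg_bounded X c : measurable_fun setT X -> (forall w, `|X w| <= c) ->
  intg X.
Proof.
move=> mX Xc; apply: (@intg_dom _ (cst c)) => //.
exact: finite_measure_integrable_cst.
Qed.

Lemma intg_cst c : intg (fun=> c).
Proof. exact: finite_measure_integrable_cst. Qed.

Lemma intgD X Y : intg X -> intg Y -> intg (fun w => X w + Y w).
Proof. by move=> iX iY; apply: (integrableD measurableT iX iY). Qed.

Lemma intgB X Y : intg X -> intg Y -> intg (fun w => X w - Y w).
Proof. by move=> iX iY; apply: (integrableB measurableT iX iY). Qed.

Lemma intgZ c X : intg X -> intg (fun w => c * X w).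
Proof. by move=> iX; apply: (integrableZl measurableT c iX). Qed.

Lemma intg_norm X : intg X -> intg (fun w => `|X w|).
Proof. by move=> iX; apply: (integrable_norm iX). Qed.

Lemma indic_ge0 A w : 0 <= \1_A w :> R.
Proof. by rewrite indicE ler0n. Qed.

Lemma indic_le1 A w : \1_A w <= 1 :> R.
Proof. by rewrite indicE; case: (_ \in _). Qed.

Lemma intgM_indic X A : measurable A -> intg X -> intg (fun w => X w * \1_A w).
Proof.
move=> mA iX; apply: intg_dom (intg_norm iX) _.
  by apply: measurable_funM; [exact: intg_measurable|exact: measurable_indic].
move=> w; rewrite normrM ler_piMr // ger0_norm ?indic_ge0 //; exact: indic_le1.
Qed.

Lemma intg_indic A : measurable A -> intg (\1_A : T -> R).
Proof.
move=> mA; apply: (@intg_bounded _ 1); first exact: measurable_indic.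
by move=> w; rewrite ger0_norm ?indic_ge0 // indic_le1.
Qed.

Lemma mean_indic A : measurable A -> mean (\1_A : T -> R) = fine (P A).
Proof. by move=> mA; rewrite /Rintegral integral_indic // setIT. Qed.

Lemma mean_cst c : mean (fun=> c) = c.
Proof. rewrite Rintegral_cst //= -[RHS]mulr1; congr (_ * _).
by have -> : P setT = 1%E by exact: probability_setT. Qed.

Lemma meanD X Y : intg X -> intg Y -> mean (fun w => X w + Y w) = mean X + mean Y.
Proof. exact: RintegralD. Qed.

Lemma meanB X Y : intg X -> intg Y -> mean (fun w => X w - Y w) = mean X - mean Y.
Proof. exact: RintegralB. Qed.

Lemma meanZ c X : intg X -> mean (fun w => c * X w) = c * mean X.
Proof. exact: RintegralZl. Qed.

Lemma le_mean X Y : intg X -> intg Y -> (forall w, X w <= Y w) -> mean X <= mean Y.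
Proof. by move=> iX iY XY; apply: le_Rintegral => // w _; exact: XY. Qed.

Lemma mean_ge0 X : (forall w, 0 <= X w) -> 0 <= mean X.
Proof. by move=> X0; apply: Rintegral_ge0. Qed.

Lemma intg_sum n (X : nat -> T -> R) : (forall i, (i < n)%N -> intg (X i)) ->
  intg (fun w => \sum_(i < n) X i w).
Proof.
elim: n => [|n IH] iX.
  by under eq_fun do rewrite big_ord0; exact: intg_cst.
under eq_fun do rewrite big_ord_recr /=.
by apply: intgD; [apply: IH => i ni; apply: iX; apply: ltnW|exact: iX].
Qed.

Lemma mean_sum n (X : nat -> T -> R) : (forall i, (i < n)%N -> intg (X i)) ->
  mean (fun w => \sum_(i < n) X i w) = \sum_(i < n) mean (X i).
Proof.
elim: n => [|n IH] iX.
  by under eq_Rintegral do rewrite big_ord0; rewrite mean_cst big_ord0.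
under eq_Rintegral do rewrite big_ord_recr /=.
rewrite meanD ?big_ord_recr /= ?IH //.
- by move=> i ni; apply: iX; apply: ltnW.
- by apply: intg_sum => i ni; apply: iX; apply: ltnW.
- exact: iX.
Qed.

Lemma mean_set X A : (\int[P]_(w in A) (X w)%:E)%E = (\int[P]_w (X w * \1_A w)%:E)%E.
Proof.
rewrite integral_mkcond; apply: eq_integral => w _.
by rewrite patchE indicE; case: (w \in A); rewrite ?mulr1 ?mulr0.
Qed.

Lemma bool_indic (Q : T -> bool) :
  (fun w => (Q w)%:R) = (\1_[set w | Q w] : T -> R).
Proof. by apply/funext => w; rewrite indicE mem_setE. Qed.

Lemma intg_bool (Q : T -> bool) : measurable [set w | Q w] ->
  intg (fun w => (Q w)%:R).
Proof. by rewrite bool_indic; exact: intg_indic. Qed.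

Lemma mean_bool (Q : T -> bool) : measurable [set w | Q w] ->
  mean (fun w => (Q w)%:R) = fine (P [set w | Q w]).
Proof. by rewrite bool_indic; exact: mean_indic. Qed.

Lemma measurable_level X a : measurable_fun setT X -> measurable [set w | a <= X w].
Proof.
move=> mX; rewrite (_ : [set _ | _] = setT `&` X @^-1` `[a, +oo[); first exact: mX.
by rewrite setTI; apply/seteqP; split => w /=; rewrite in_itv /= andbT.
Qed.

Lemma ae_mean X Y : intg X -> measurable_fun setT Y ->
  P.-negligible [set w | X w != Y w] -> intg Y /\ mean X = mean Y.
Proof.
move=> iX mY nXY; have mX := intg_measurable iX.
have XY : ae_eq P setT (EFin \o X) (EFin \o Y).
  apply: negligibleS nXY => w /= h; apply/eqP => XYw; apply: h => _.
  by rewrite XYw.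
have E : (\int[P]_w (X w)%:E = \int[P]_w (Y w)%:E)%E.
  by apply: ae_eq_integral => //; exact/measurable_EFinP.
split; last by rewrite /Rintegral E.
apply/integrableP; split; first exact/measurable_EFinP.
have /integrableP[_] := iX; congr (_ < _)%E.
apply: ae_eq_integral => //.
- by apply/measurableT_comp => //; exact/measurable_EFinP.
- by apply/measurableT_comp => //; exact/measurable_EFinP.
- by apply: negligibleS nXY => w /= h; apply/eqP => XYw; apply: h => _ /=; rewrite XYw.
Qed.

Lemma dominated_mean_ae (Xn : nat -> T -> R) X Y :
  (forall n, measurable_fun setT (Xn n)) -> measurable_fun setT X ->
  P.-negligible [set w | ~ (Xn^~ w @ \oo --> X w)] ->
  intg Y -> (forall n w, `|Xn n w| <= Y w) ->
  intg X /\ (fun n => mean (Xn n)) @ \oo --> mean X.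
Proof.
move=> mXn mX XnX iY XnY.
have [iX _ cX] : [/\ intg X, _ & _] :=
  @dominated_convergence _ _ _ P setT measurableT
  (fun n => EFin \o Xn n) (EFin \o X) (EFin \o Y)
  (fun n => proj2 (measurable_EFinP _ _) (mXn n))
  (proj2 (measurable_EFinP _ _) mX)
  (negligibleS (fun w h => fun h' => h (fun _ => EFin_cvg h')) XnX)
  iY (aeW _ (fun w n _ => XnY n w)).
split=> //; apply: fine_cvg; rewrite fineK; first exact: cX.
exact: integrable_fin_num.
Qed.

Lemma dominated_mean (Xn : nat -> T -> R) X Y :
  (forall n, measurable_fun setT (Xn n)) ->
  (forall w, Xn^~ w @ \oo --> X w) -> intg Y -> (forall n w, `|Xn n w| <= Y w) ->
  intg X /\ (fun n => mean (Xn n)) @ \oo --> mean X.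
Proof.
move=> mXn XnX; apply: dominated_mean_ae => //.
  by apply: (@measurable_fun_cvg _ _ _ setT Xn) => // w _; exact: XnX.
apply: negligibleS (negligible_set0 P) => w /=; apply; exact: XnX.
Qed.

Lemma fatou_mean (Xn : nat -> T -> R) X c :
  (forall n, intg (Xn n)) -> (forall n w, 0 <= Xn n w) ->
  (forall w, Xn^~ w @ \oo --> X w) -> (forall n, mean (Xn n) <= c) ->
  intg X /\ mean X <= c.
Proof.
move=> iXn Xn0 XnX mc.
have mX : measurable_fun setT X.
  apply: (@measurable_fun_cvg _ _ _ setT Xn) => [n|w _]; last exact: XnX.
  exact: intg_measurable.
have X0 w : 0 <= X w.
  rewrite -(cvg_lim _ (XnX w)) //; apply: limr_ge; last exact: nearW.
  by apply/cvg_ex; exists (X w); exact: XnX.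
have Xc : (\int[P]_w (X w)%:E <= c%:E)%E.
  have := @fatou _ _ _ P setT measurableT (fun n => EFin \o Xn n)
    (fun n => proj2 (measurable_EFinP _ _) (intg_measurable (iXn n)))
    (fun n w _ => Xn0 n w).
  under eq_integral.
    move=> w _; rewrite is_cvg_limn_einfE; last first.
      by apply/cvg_ex; exists (X w)%:E; exact: (EFin_cvg (XnX w)).
    rewrite (cvg_lim _ (EFin_cvg (XnX w))) //.
  over.
  move=> /le_trans; apply.
  rewrite limn_einf_lim; apply: lime_le; first exact: is_cvg_einfs.
  apply: nearW => n; apply: ereal_inf_le; exists (\int[P]_w (Xn n w)%:E)%E.
    by exists n => /=.
  by rewrite EFin_mean // lee_fin.
have iX : intg X.
  apply/integrableP; split; first exact/measurable_EFinP.
  under eq_integral do rewrite /= ger0_norm //.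
  by apply: le_lt_trans Xc _; rewrite ltry.
by split=> //; move: Xc; rewrite EFin_mean // lee_fin.
Qed.

Lemma intg_max X c : intg X -> intg (fun w => Num.max (X w - c) 0).
Proof.
move=> iX; apply: (@intg_dom _ (fun w => `|X w - c|)).
- apply: measurable_maxr; last exact: measurable_cst.
  exact/measurable_funB/measurable_cst/intg_measurable.
- exact/intg_norm/intgB/intg_cst.
- move=> w; rewrite ger0_norm ?le_max ?lexx ?orbT //.
  by rewrite ge_max ler_norm normr_ge0.
Qed.

Lemma intg_min X c : intg X -> intg (fun w => Num.min (X w) c).
Proof.
move=> iX; apply: (@intg_dom _ (fun w => `|X w| + `|c|)).
- by apply: measurable_minr; [exact: intg_measurable|exact: measurable_cst].
- by apply: intgD; [exact: intg_norm|exact: intg_cst].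
- by move=> w; rewrite /Num.min; case: ifP => _; rewrite ?lerDl ?lerDr.
Qed.

(** Each variable is [min x K] plus the excess over [K]: the bounded part converges by domination,
    and the excess is uniformly small, also in the limit by Fatou. *)
Lemma vitali_mean (Xn : nat -> T -> R) X :
  (forall n, intg (Xn n)) -> (forall n w, 0 <= Xn n w) ->
  (forall w, Xn^~ w @ \oo --> X w) ->
  (forall e, 0 < e -> exists K, forall n,
     mean (fun w => Num.max (Xn n w - K) 0) <= e) ->
  intg X /\ (fun n => mean (Xn n)) @ \oo --> mean X.
Proof.
move=> iXn Xn0 XnX ui.
have excess e K : (forall n, mean (fun w => Num.max (Xn n w - K) 0) <= e) ->
    intg (fun w => Num.max (X w - K) 0) /\ mean (fun w => Num.max (X w - K) 0) <= e.
  move=> eK; apply: (@fatou_mean (fun n w => Num.max (Xn n w - K) 0)) => //.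
  - by move=> n; exact: intg_max.
  - by move=> n w; rewrite le_max lexx orbT.
  - move=> w; apply: cvg_maxc.
    by apply: cvgB; [exact: XnX|exact: cvg_cst].
have mX : measurable_fun setT X.
  apply: (@measurable_fun_cvg _ _ _ setT Xn) => [n|w _]; last exact: XnX.
  exact: intg_measurable.
have split_max (x K : R) : x = Num.min x K + Num.max (x - K) 0.
  by rewrite /Num.min /Num.max; do 2 case: ifPn; rewrite -?leNgt; lra.
have X0 w : 0 <= X w.
  rewrite -(cvg_lim _ (XnX w)) //; apply: limr_ge; last exact: nearW.
  by apply/cvg_ex; exists (X w); exact: XnX.
have iX : intg X.
  have [K /excess[iK _]] := ui 1 ltr01.
  apply: (intg_dom mX (intgD (intg_cst `|K|) iK)) => w.
  rewrite ger0_norm // {1}(split_max (X w) K) lerD2r.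
  by rewrite ge_min ler_norm orbT.
split=> //; apply/cvgrPdist_le => e e0.
have e3 : 0 < e / 3 by lra.
have [K ui_K] := ui _ e3; have [_ XK] := excess _ _ ui_K.
have [_ cK] : intg (fun w => Num.min (X w) K) /\
    (fun n => mean (fun w => Num.min (Xn n w) K)) @ \oo --> mean (fun w => Num.min (X w) K).
  apply: (@dominated_mean _ _ (fun=> `|K|)).
  - by move=> n; exact/intg_measurable/intg_min.
  - by move=> w; apply: cvg_minc; exact: XnX.
  - exact: intg_cst.
  - move=> n w; rewrite /Num.min; case: ifPn => // XK'.
    by rewrite ger0_norm // (le_trans (ltW XK')) // ler_norm.
have /cvgrPdist_le/(_ _ e3) := cK.
apply: filterS => n nK.
have mE Y : intg Y -> mean Y =
    mean (fun w => Num.min (Y w) K) + mean (fun w => Num.max (Y w - K) 0).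
  move=> iY; rewrite -meanD; [|exact: intg_min|exact: intg_max].
  by apply: eq_Rintegral => w _; exact: split_max.
rewrite (mE _ iX) (mE _ (iXn n)).
have p0 Y : 0 <= mean (fun w => Num.max (Y w - K) 0).
  by apply: mean_ge0 => w; rewrite le_max lexx orbT.
move: nK (ui_K n) XK (p0 X) (p0 (Xn n)); rewrite !ler_norml; lra.
Qed.

End expectation.

(** * Optional stopping *)

Section threshold_index.
Implicit Types (b : nat -> bool) (K i : nat).

(** For a decreasing [b] this is the first index at which [b] fails, capped at [K]. *)
Definition threshold b K : nat := (\sum_(i < K) b i)%N.

Lemma threshold_le b K : (threshold b K <= K)%N.
Proof.
rewrite /threshold -[leqRHS]card_ord -sum1_card; apply: leq_sum => i _.
by case: (b i).
Qed.

Lemma lt_threshold b K i : (forall i, b i.+1 -> b i) -> (i < K)%N ->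
  (i < threshold b K)%N = b i.
Proof.
move=> bS; have bhomo k n : (k <= n)%N -> b n -> b k.
  move=> /subnK <-; elim: (n - k)%N => // m IH; rewrite addSn => /bS; exact: IH.
elim: K => // K IH; rewrite ltnS /threshold big_ord_recr /= => iK.
have [iK'|Ki] := ltnP i K.
  rewrite -IH //; have [bK|_] := boolP (b K); last by rewrite addn0.
  by rewrite addn1 ltnS IH // (bhomo _ K) // ltnW // IH // (bhomo _ K).
have <- : i = K by apply/eqP; rewrite eqn_leq iK.
have [bi|bi] := boolP (b i).
  rewrite addn1 ltnS -[leqLHS]card_ord -sum1_card; apply: leq_sum => k _.
  by rewrite (bhomo k i) // ltnW.
apply/negbTE; rewrite addn0 -leqNgt; exact: threshold_le.
Qed.

End threshold_index.

Section telescope.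
Context {V : pzRingType}.
Implicit Types (a : nat -> V) (i j k K : nat).

(** For random [k] and [j], the increment of a process between two grid times becomes a sum in which
    the increment over cell [i] carries the indicator of [k <= i < j], an event known at the left
    end of the cell. *)
Lemma telescope_between a j k K : (j <= K)%N ->
  \sum_(i < K) (a i.+1 - a i) * (k <= i < j)%N%:R = (a j - a k) * (k < j)%N%:R.
Proof.
move=> jK; have [kj|jk] := ltnP k j; last first.
  rewrite mulr0 big1 // => i _; case: andP => [[ki ij]|]; last by rewrite mulr0.
  by move: (leq_trans (leq_ltn_trans ki ij) jk); rewrite ltnn.
rewrite mulr1 -(telescope_sumr _ (ltnW kj)) (@big_nat_widenl _ _ _ k 0%N) // (big_nat_widen _ _ _ _ _ jK).
rewrite big_mkcond big_mkord; apply: eq_bigr => i _.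
by rewrite mulr_natr mulrb.
Qed.

Lemma telescope_from a k K : (k <= K)%N ->
  a k = a K - \sum_(i < K) (a i.+1 - a i) * (k <= i)%N%:R.
Proof.
move=> kK; rewrite (eq_bigr (fun i : 'I_K => (a i.+1 - a i) * (k <= i < K)%N%:R)).
  rewrite telescope_between //; case: ltnP => [|Kk]; first by rewrite mulr1 subKr.
  by rewrite mulr0 subr0; congr a; apply/eqP; rewrite eqn_leq kK.
by move=> i _; rewrite ltn_ord andbT.
Qed.

End telescope.

Section optional_stopping.
Context {d : measure_display} {T : measurableType d} {R : realType}.
Variable P : probability T R.
Variables (F : R -> set (set T)) (X L : R -> T -> R).
Implicit Types (S : T -> \bar R) (A : set T) (J : T -> nat).

Local Notation mean X := (Rintegral P setT X).
Local Notation intg X := (P.-integrable setT (EFin \o X)).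

Record reflected_pair : Prop := ReflectedPair {
  pair_sigma : forall t, 0 <= t -> sigma_algebra setT (F t) ;
  pair_homo : forall s t, 0 <= s -> s <= t -> F s `<=` F t ;
  pair_measurable : forall t, 0 <= t -> F t `<=` measurable ;
  pair_adapted : adapted F X ;
  pair_ladapted : adapted F L ;
  pair_path : forall w, reflected_path (X^~ w) (L^~ w) ;
  pair_intg : forall t, 0 <= t -> intg (X t) ;
  pair_lintg : forall t, 0 <= t -> intg (L t) ;
  pair_mart : forall s t A, 0 <= s -> s <= t -> F s A ->
    mean (fun w => (X t w - L t w) * \1_A w) =
    mean (fun w => (X s w - L s w) * \1_A w) }.

Hypothesis XL : reflected_pair.

Lemma F_setC t A : 0 <= t -> F t A -> F t (~` A).
Proof.
move=> t0 FA; have [_ FC _] := pair_sigma XL t0.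
by rewrite -setTD; exact: FC.
Qed.

Lemma F_bigcup t (A : nat -> set T) : 0 <= t -> (forall i, F t (A i)) ->
  F t (\bigcup_i A i).
Proof. by move=> t0 FA; have [_ _] := pair_sigma XL t0; apply. Qed.

Lemma F_setI t A A' : 0 <= t -> F t A -> F t A' -> F t (A `&` A').
Proof.
move=> t0 FA FA'; rewrite -[A]setCK -[A']setCK -setCU; apply: F_setC => //.
rewrite -bigcup2E; apply: F_bigcup => // -[|[|i]] /=; try exact: F_setC.
by have [] := pair_sigma XL t0.
Qed.

Lemma L_ge0 t w : 0 <= L t w.
Proof.
have [t0|/ltW t0] := leP t 0; first by rewrite (path_l0 (pair_path XL w) t0).
by rewrite -(path_l0 (pair_path XL w) (lexx 0)); apply: path_homo (pair_path XL w) _ _ t0.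
Qed.

Lemma X_ge0 t w : 0 <= X t w. Proof. exact: path_ge0 (pair_path XL w) t. Qed.

Lemma submartingale s t A : 0 <= s -> s <= t -> F s A ->
  mean (fun w => X s w * \1_A w) <= mean (fun w => X t w * \1_A w).
Proof.
move=> s0 st FA; have t0 := le_trans s0 st.
have mA := pair_measurable XL s0 FA.
have iXA u : 0 <= u -> intg (fun w => X u w * \1_A w).
  by move=> u0; apply: intgM_indic => //; exact: pair_intg.
have iLA u : 0 <= u -> intg (fun w => L u w * \1_A w).
  by move=> u0; apply: intgM_indic => //; exact: pair_lintg.
have := pair_mart XL s0 st FA.
under eq_Rintegral do rewrite mulrBl.
under [in RHS]eq_Rintegral do rewrite mulrBl.
rewrite !meanB; [|exact: iXA|exact: iLA|exact: iXA|exact: iLA].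
have : mean (fun w => L s w * \1_A w) <= mean (fun w => L t w * \1_A w).
  apply: le_mean; [exact: iLA|exact: iLA|] => w.
  by rewrite ler_wpM2r ?indic_ge0 //; apply: path_homo (pair_path XL w) _ _ st.
lra.
Qed.

Lemma indic_nat (Q : T -> bool) w : \1_[set w | Q w] w = (Q w)%:R :> R.
Proof. by rewrite indicE mem_setE. Qed.

(** Jensen's inequality for [max (x - c) 0], tested on the event [X s > c], which is known at time
    [s]: there the map is linear at time [s], and at time [t] it dominates the same linear
    function. *)
Lemma submartingale_excess c s t A : 0 <= s -> s <= t -> F s A ->
  mean (fun w => Num.max (X s w - c) 0 * \1_A w) <=
  mean (fun w => Num.max (X t w - c) 0 * \1_A w).
Proof.
move=> s0 st FA; have t0 := le_trans s0 st.
set A' := A `&` X s @^-1` `]c, +oo[.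
have FA' : F s A' by apply: F_setI => //; apply: (pair_adapted XL).
have A'E w : \1_A' w = \1_A w * (c < X s w)%R%:R :> R.
  rewrite indicI /= -(indic_nat (fun z => c < X s z)%R); congr (_ * \1_ _ _).
  by apply/seteqP; split => z /=; rewrite in_itv /= andbT.
have mA := pair_measurable XL s0 FA; have mA' := pair_measurable XL s0 FA'.
have iX u : 0 <= u -> intg (fun w => (X u w - c) * \1_A' w).
  move=> u0; apply: intgM_indic => //; apply: intgB (pair_intg XL u0) _.
  exact: intg_cst.
have iXA u : 0 <= u -> intg (fun w => Num.max (X u w - c) 0 * \1_A w).
  by move=> u0; apply: intgM_indic => //; apply: intg_max; exact: pair_intg.
apply: (@le_trans _ _ (mean (fun w => (X s w - c) * \1_A' w))).
  apply: le_mean; [exact: iXA|exact: iX|] => w.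
  rewrite A'E mulrCA [leLHS]mulrC ler_wpM2l ?indic_ge0 //.
  have [h|h] := ltP c (X s w); last by rewrite mulr0 ge_max lexx subr_le0 h.
  by rewrite mulr1 ge_max lexx subr_ge0 ltW.
apply: (@le_trans _ _ (mean (fun w => (X t w - c) * \1_A' w))).
  under eq_Rintegral do rewrite mulrBl.
  under [leRHS]eq_Rintegral do rewrite mulrBl.
  have ic : intg (fun w => c * \1_A' w) by apply: intgM_indic => //; exact: intg_cst.
  have iXA' u : 0 <= u -> intg (fun w => X u w * \1_A' w).
    by move=> u0; apply: intgM_indic => //; exact: pair_intg.
  rewrite !meanB //; [|exact: iXA'|exact: iXA'].
  by rewrite lerB // submartingale.
apply: le_mean; [exact: iX|exact: iXA|] => w.
rewrite A'E mulrCA [leRHS]mulrC ler_wpM2l ?indic_ge0 //.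
by case: (c < X s w); rewrite ?mulr1 ?mulr0 le_max lexx ?orbT.
Qed.

(** * Discrete optional stopping on a regular grid of [[0, N]] *)

Section grid.
Variable N : R.
Hypothesis N0 : 0 < N.

Definition grid n i : R := N * i%:R / n.+1%:R.

Lemma grid_ge0 n i : 0 <= grid n i.
Proof. by rewrite /grid divr_ge0 // mulr_ge0 // ltW. Qed.

Lemma grid_homo n : {homo grid n : i k / (i <= k)%N >-> i <= k}.
Proof. by move=> i k ik; rewrite /grid ler_pM2r ?invr_gt0 // ler_pM2l // ler_nat. Qed.

Lemma grid_last n : grid n n.+1 = N.
Proof. by rewrite /grid mulfK. Qed.

Lemma gridS n i : grid n i.+1 = grid n i + N / n.+1%:R.
Proof. by rewrite /grid -natr1 mulrDr mulr1 mulrDl. Qed.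

Definition grid_time n (J : T -> nat) : Prop :=
  (forall w, (J w <= n.+1)%N) /\
  (forall i, (i < n.+1)%N -> F (grid n i) [set w | (J w <= i)%N]).

Lemma grid_time_measurable n J : grid_time n J -> forall i, measurable [set w | (J w <= i)%N].
Proof.
move=> [Jn JF] i; have [ni|ni] := ltnP i n.+1.
  exact: (pair_measurable XL (grid_ge0 n i) (JF _ ni)).
rewrite (_ : [set _ | _] = setT) //; apply/seteqP; split => // w _ /=.
exact: leq_trans ni.
Qed.

Lemma grid_time_lt_measurable n J J' : grid_time n J -> grid_time n J' ->
  measurable [set w | (J w < J' w)%N].
Proof.
move=> /grid_time_measurable mJ /grid_time_measurable mJ'.
rewrite (_ : [set _ | _] =
  \bigcup_i ([set w | (J w <= i)%N] `&` ~` [set w | (J' w <= i)%N])).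
  by apply: bigcup_measurable => i _; apply: measurableI => //; exact: measurableC.
apply/seteqP; split => [w /= JJ'|w [i _ /= [Ji /negP]]].
  by exists (J w) => //=; split => //; apply/negP; rewrite -ltnNge.
by rewrite -ltnNge; exact: leq_ltn_trans.
Qed.

Lemma intg_at_grid (Y : R -> T -> R) n J : (forall t, 0 <= t -> intg (Y t)) ->
  grid_time n J -> intg (fun w => Y (grid n (J w)) w).
Proof.
move=> iY gJ; have mJ := grid_time_measurable gJ.
rewrite (_ : (_ \o _) = EFin \o (fun w => Y (grid n n.+1) w - \sum_(i < n.+1)
    (Y (grid n i.+1) w - Y (grid n i) w) * \1_[set w | (J w <= i)%N] w)); last first.
  apply/funext => w /=; congr EFin.
  rewrite (telescope_from (fun i => Y (grid n i) w) (gJ.1 w)).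
  by congr (_ - _); apply: eq_bigr => i _; rewrite indic_nat.
apply: intgB; first by apply: iY; exact: grid_ge0.
apply: (@intg_sum _ _ _ _ n.+1 (fun i w => (Y (grid n i.+1) w - Y (grid n i) w) *
  \1_[set w | (J w <= i)%N] w)) => i _.
by apply: intgM_indic => //; apply: intgB; apply: iY; exact: grid_ge0.
Qed.

(** The increments of the submartingale after the index [J] have nonnegative mean. The bound does
    not depend on [J] or [n], so it gives uniform integrability of all the values at grid times. *)
Lemma mean_excess_grid c n J : grid_time n J ->
  mean (fun w => Num.max (X (grid n (J w)) w - c) 0) <=
  mean (fun w => Num.max (X N w - c) 0).
Proof.
move=> gJ; have mJ := grid_time_measurable gJ.
pose Y t w := Num.max (X t w - c) 0.
have iY t : 0 <= t -> intg (Y t) by move=> t0; exact/intg_max/(pair_intg XL).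
pose D i w := (Y (grid n i.+1) w - Y (grid n i) w) * \1_[set w | (J w <= i)%N] w.
have iD i : intg (D i).
  by apply: intgM_indic => //; apply: intgB; apply: iY; exact: grid_ge0.
have -> : mean (fun w => Y (grid n (J w)) w) =
    mean (fun w => Y N w - \sum_(i < n.+1) D i w).
  apply: eq_Rintegral => w _.
  rewrite (telescope_from (fun i => Y (grid n i) w) (gJ.1 w)) grid_last.
  by congr (_ - _); apply: eq_bigr => i _; rewrite /D indic_nat.
rewrite meanB; [|exact/iY/ltW|exact: intg_sum].
rewrite gerBl mean_sum // sumr_ge0 // => -[i /= ni] _.
have gi := grid_ge0 n i.
rewrite /D (_ : mean _ = mean (fun w => Y (grid n i.+1) w * \1_[set w | (J w <= i)%N] w -
   Y (grid n i) w * \1_[set w | (J w <= i)%N] w)).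
  rewrite meanB; [|by apply: intgM_indic => //; apply: iY; exact: grid_ge0..].
  rewrite subr_ge0; apply: submartingale_excess => //; first exact: grid_homo.
  exact: gJ.2.
by apply: eq_Rintegral => w _; rewrite mulrBl.
Qed.

(** On [J < J'] the martingale [X - L] has the same mean at both grid times: its increment over cell
    [i] is weighted by [J <= i < J'], an event of the sigma-algebra at the left end. *)
Lemma mart_grid n J J' : grid_time n J -> grid_time n J' ->
  mean (fun w => X (grid n (J' w)) w * (J w < J' w)%N%:R) =
  mean (fun w => X (grid n (J w)) w * (J w < J' w)%N%:R) +
  mean (fun w => (L (grid n (J' w)) w - L (grid n (J w)) w) * (J w < J' w)%N%:R).
Proof.
move=> gJ gJ'; have mJJ := grid_time_lt_measurable gJ gJ'.
pose M t w := X t w - L t w.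
have iM t : 0 <= t -> intg (M t).
  by move=> t0; apply: intgB; [exact: pair_intg|exact: pair_lintg].
pose A i := [set w | (J w <= i)%N] `\` [set w | (J' w <= i)%N].
pose D i w := (M (grid n i.+1) w - M (grid n i) w) * \1_(A i) w.
have FA i : (i < n.+1)%N -> F (grid n i) (A i).
  move=> ni; apply: F_setI; [exact: grid_ge0|exact: gJ.2|].
  by apply: F_setC; [exact: grid_ge0|exact: gJ'.2].
have mA i : (i < n.+1)%N -> measurable (A i).
  by move=> /FA; apply: pair_measurable => //; exact: grid_ge0.
have iMA u i : (i < n.+1)%N -> intg (fun w => M (grid n u) w * \1_(A i) w).
  by move=> ni; apply: intgM_indic; [exact: mA|apply: iM; exact: grid_ge0].
have iD i : (i < n.+1)%N -> intg (D i).
  move=> ni; apply: intgM_indic; first exact: mA.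
  by apply: intgB; apply: iM; exact: grid_ge0.
have ZD : mean (fun w => \sum_(i < n.+1) D i w) = 0.
  rewrite mean_sum // big1 // => -[i ni] _ /=.
  rewrite /D (_ : mean _ = mean (fun w => M (grid n i.+1) w * \1_(A i) w -
     M (grid n i) w * \1_(A i) w)); last first.
    by apply: eq_Rintegral => w _; rewrite mulrBl.
  rewrite meanB; [|exact: iMA|exact: iMA].
  apply/eqP; rewrite subr_eq0; apply/eqP; apply: pair_mart => //.
  - exact: grid_ge0.
  - exact: grid_homo.
  - exact: FA.
have iat (Y : R -> T -> R) J0 : grid_time n J0 -> (forall t, 0 <= t -> intg (Y t)) ->
    intg (fun w => Y (grid n (J0 w)) w * (J w < J' w)%N%:R).
  move=> gJ0 iY; have := intgM_indic mJJ (intg_at_grid iY gJ0).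
  by under eq_fun do rewrite indic_nat.
have iX := pair_intg XL; have iL := pair_lintg XL.
pose XJ J0 w := X (grid n (J0 w)) w * (J w < J' w)%N%:R.
pose LJ J0 w := L (grid n (J0 w)) w * (J w < J' w)%N%:R.
have iXJ J0 : grid_time n J0 -> intg (XJ J0) by move=> gJ0; exact: iat.
have iLJ J0 : grid_time n J0 -> intg (LJ J0) by move=> gJ0; exact: iat.
have -> : mean (fun w => (L (grid n (J' w)) w - L (grid n (J w)) w) * (J w < J' w)%N%:R) =
    mean (LJ J') - mean (LJ J).
  rewrite -meanB; [|exact: iLJ|exact: iLJ].
  by apply: eq_Rintegral => w _; rewrite /LJ mulrBl.
have : mean (fun w => (XJ J' w - LJ J' w) - (XJ J w - LJ J w)) = 0.
  rewrite -ZD; apply: eq_Rintegral => w _.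
  transitivity (\sum_(i < n.+1) (M (grid n i.+1) w - M (grid n i) w) *
      (J w <= i < J' w)%N%:R).
    rewrite (telescope_between (fun i => M (grid n i) w)) ?gJ'.1 //.
    by rewrite /XJ /LJ /M; ring.
  apply: eq_bigr => i _; rewrite /D /A indicE in_setD !mem_setE /=.
  by rewrite -ltnNge andbC.
rewrite !meanB; [|exact: iXJ|exact: iLJ|exact: iXJ|exact: iLJ|..]; last 2 first.
- by apply: intgB; [exact: iXJ|exact: iLJ].
- by apply: intgB; [exact: iXJ|exact: iLJ].
rewrite -/(XJ J') -/(XJ J); lra.
Qed.

Lemma threshold_grid (b : nat -> bool) n s : (forall i, b i.+1 -> b i) ->
  0 <= s <= N -> (forall i, (i < n.+1)%N -> b i -> grid n i <= s) ->
  (forall i, (i < n.+1)%N -> ~~ b i -> s <= grid n i) ->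
  s <= grid n (threshold b n.+1) <= s + N / n.+1%:R.
Proof.
move=> bS /andP[s0 sN] bs nbs; apply/andP; split.
  have := threshold_le b n.+1; rewrite leq_eqVlt => /predU1P[->|tn].
    by rewrite grid_last.
  by apply: nbs => //; rewrite -(lt_threshold bS tn) ltnn.
have h0 : 0 <= N / n.+1%:R by rewrite divr_ge0 // ltW.
case E : (threshold b n.+1) => [|i].
  by rewrite /grid mulr0 mul0r addr_ge0.
have iN : (i < n.+1)%N by have := threshold_le b n.+1; rewrite E.
by rewrite gridS lerD2r bs // -(lt_threshold bS iN) E.
Qed.

Lemma cvg_grid (u : nat -> R) s (g : R -> R) :
  (forall n, s <= u n <= s + N / n.+1%:R) -> continuous g ->
  (fun n => g (u n)) @ \oo --> g s.
Proof.
move=> us cg; have us' : u @ \oo --> s.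
  apply: (@squeeze_cvgr _ _ _ _ (fun=> s) (fun n => s + N * n.+1%:R^-1)).
  - exact: nearW.
  - exact: cvg_cst.
  - rewrite -[X in _ --> X]addr0 -(mulr0 N); apply: cvgD; first exact: cvg_cst.
    by apply: cvgMr; exact: cvg_harmonic.
exact: (@cvg_comp _ _ _ u g _ _ _ us' (cg s)).
Qed.

(** * From grid times to a general stopping time *)

Section stopping.
Variable S : T -> \bar R.
Hypothesis FS : stopping_time F S.

(** The index of [min S N] rounded up to the grid; rounding up is what keeps it a stopping time. *)
Definition stop_index n w := threshold (fun i => (grid n i)%:E < S w)%E n.+1.

Definition stop_clock w : R := fine (mine N%:E (S w)).

Lemma stop_clockE w : (stop_clock w)%:E = mine N%:E (S w).
Proof.
rewrite /stop_clock fineK //; have := FS.1 w.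
by case: (S w) => [r| |] //; rewrite ?mineyr -?EFin_min // /mine ltey.
Qed.

Lemma stop_clock_itv w : 0 <= stop_clock w <= N.
Proof.
rewrite -!lee_fin stop_clockE le_min FS.1 lee_fin (ltW N0) /=.
by rewrite ge_min lexx.
Qed.

Lemma stop_index_decr n w i :
  ((grid n i.+1)%:E < S w -> (grid n i)%:E < S w)%E.
Proof. by apply: le_lt_trans; rewrite lee_fin grid_homo. Qed.

Lemma stop_index_grid n w :
  stop_clock w <= grid n (stop_index n w) <= stop_clock w + N / n.+1%:R.
Proof.
apply: threshold_grid; [exact: stop_index_decr|exact: stop_clock_itv| |].
  move=> i ni /ltW iS; rewrite -lee_fin stop_clockE le_min iS andbT lee_fin.
  by rewrite -[leRHS](grid_last n) grid_homo // ltnW.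
move=> i ni; rewrite -leNgt => iS.
by rewrite -lee_fin stop_clockE ge_min iS orbT.
Qed.

Lemma stop_index_time n : grid_time n (stop_index n).
Proof.
split=> [w|i ni]; first exact: threshold_le.
rewrite (_ : [set _ | _] = [set w | (S w <= (grid n i)%:E)%E]).
  exact: FS.2 (grid_ge0 n i).
apply/seteqP; split => w /=; rewrite /stop_index leqNgt lt_threshold //;
  by [exact: stop_index_decr|rewrite -leNgt].
Qed.

Definition level_index v n w := threshold (fun i => L (grid n i) w < v) n.+1.

Lemma level_index_decr v n w i : L (grid n i.+1) w < v -> L (grid n i) w < v.
Proof. by apply: le_lt_trans; apply: (path_homo (pair_path XL w)); exact: grid_homo. Qed.

Lemma level_index_time v n : grid_time n (level_index v n).
Proof.
split=> [w|i ni]; first exact: threshold_le.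
rewrite (_ : [set _ | _] = L (grid n i) @^-1` `[v, +oo[).
  by apply: (pair_ladapted XL) => //; exact: grid_ge0.
apply/seteqP; split => w /=;
  rewrite in_itv /= andbT /level_index leqNgt lt_threshold //;
  by [exact: level_index_decr|rewrite -leNgt].
Qed.

Lemma stoppedE (Y : R -> T -> R) w : stopped Y S N w = Y (stop_clock w) w.
Proof. by []. Qed.

Lemma cvg_stop_index (Y : R -> T -> R) w : continuous (Y^~ w) ->
  (fun n => Y (grid n (stop_index n w)) w) @ \oo --> stopped Y S N w.
Proof. by move=> cY; apply: (cvg_grid (fun n => stop_index_grid n w) cY). Qed.

Lemma excess_ui e : 0 < e -> exists K,
  mean (fun w => Num.max (X N w - K) 0) <= e.
Proof.
move=> e0; have iX := pair_intg XL (ltW N0).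
have [_] : intg (fun=> 0 : R) /\
    (fun n : nat => mean (fun w => Num.max (X N w - n%:R) 0)) @ \oo --> mean (fun=> 0).
  apply: (@dominated_mean _ _ _ _ _ _ (X N)) => //.
  - by move=> n; exact: (intg_measurable (intg_max _ iX)).
  - move=> w; apply: cvg_near_cst; near=> n; apply/max_r; rewrite subr_le0.
    by near: n; exact: nbhs_infty_ger.
  - move=> n w; rewrite ger0_norm ?le_max ?lexx ?orbT //.
    by rewrite ge_max X_ge0 // lerBlDr lerDl ler0n.
rewrite mean_cst => /cvgrPdist_le/(_ _ e0)[n _ /(_ n (leqnn n))].
rewrite sub0r normrN => h; exists n%:R; exact: le_trans (ler_norm _) h.
Unshelve. all: by end_near.
Qed.

Lemma intg_stopped : intg (stopped X S N).
Proof.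
have [] // := @vitali_mean _ _ _ P (fun n w => X (grid n (stop_index n w)) w) (stopped X S N).
- by move=> n; apply: intg_at_grid (stop_index_time n); exact: pair_intg.
- by move=> n w; exact: X_ge0.
- by move=> w; apply: cvg_stop_index; exact: path_cont (pair_path XL w).
- move=> e /excess_ui[K KE]; exists K => n.
  exact: le_trans (mean_excess_grid K (stop_index_time n)) KE.
Qed.

Lemma L_bound t w : t <= N -> `|L t w| <= L N w.
Proof.
by move=> tN; rewrite ger0_norm ?L_ge0 //; apply: path_homo (pair_path XL w) _ _ tN.
Qed.

Lemma grid_index_le n J w : grid_time n J -> grid n (J w) <= N.
Proof. by move=> [Jn _]; rewrite -[leRHS](grid_last n) grid_homo. Qed.

Lemma intg_lstopped : intg (stopped L S N).
Proof.
have [] // := @dominated_mean _ _ _ P (fun n w => L (grid n (stop_index n w)) w)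
  (stopped L S N) (L N).
- move=> n; apply: intg_measurable.
  by apply: intg_at_grid (stop_index_time n); exact: pair_lintg.
- by move=> w; apply: cvg_stop_index; exact: path_lcont (pair_path XL w).
- exact/(pair_lintg XL)/ltW.
- by move=> n w; apply/L_bound/grid_index_le/stop_index_time.
Qed.

(* [L] does not move while [X] is away from 0, and [X - L] is a martingale: the
   two sides are the limits of the grid identity [mart_grid] between the
   passage of [L] at level [v], where [X] vanishes, and the time [S]. *)
Lemma optional_stopping (v : R) : 0 < v ->
  mean (fun w => stopped X S N w * (v <= stopped L S N w)%R%:R) =
  mean (fun w => Num.max (stopped L S N w - v) 0).
Proof.
move=> v0.
pose J := level_index v; pose J' := stop_index.
pose c n w : R := (J n w < J' n w)%N%:R.
have c01 n w : 0 <= c n w <= 1 by rewrite ler0n lern1 leq_b1.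
have gJ n := level_index_time v n; have gJ' n := stop_index_time n.
have mc n : measurable_fun setT (c n).
  rewrite (_ : c n = \1_[set w | (J n w < J' n w)%N]).
    exact/measurable_indic/(grid_time_lt_measurable (gJ n) (gJ' n)).
  by apply/funext => w; rewrite indic_nat.
(* The weight [c n] is eventually 0 when [L] has not reached [v] at the stopping time, and
   eventually 1 when the passage occurs strictly before it. When the passage coincides with the
   stopping time, [c n] may oscillate, but then [X] and [L - v] both vanish in the limit. *)
have lim w : stopped L S N w < v /\ (\forall n \near \oo, c n w = 0) \/
    [/\ v <= stopped L S N w,
      (fun n => X (grid n (J n w)) w) @ \oo --> 0,
      (fun n => L (grid n (J n w)) w) @ \oo --> v &
      (\forall n \near \oo, c n w = 1) \/
      (stopped X S N w = 0 /\ stopped L S N w = v)].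
  have xl := pair_path XL w.
  have cL := cvg_stop_index (Y := L) (path_lcont xl).
  have [vL|Lv] := leP v (stopped L S N w); [right|left; split => //]; last first.
    have Lv' : \forall n \near \oo, L (grid n (stop_index n w)) w < v.
      exact: (cvgr_lt _ cL).
    apply: filterS Lv' => n h.
    rewrite /c; case: ltnP => // JJ'; exfalso; move: h; apply/negP; rewrite -leNgt.
    apply: (@le_trans _ _ (L (grid n (J n w)) w)); last first.
      exact/(path_homo xl)/grid_homo/ltnW.
    have Jn : (J n w < n.+1)%N by exact: leq_trans JJ' ((gJ' n).1 w).
    rewrite leNgt -(lt_threshold (b := fun i => L (grid n i) w < v) _ Jn) ?ltnn //.
    by move=> i; exact: level_index_decr.
  have [u [/andP[u0 us] lu xu below]] := first_passage xl v0 vL.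
  have Ju n : u <= grid n (J n w) <= u + N / n.+1%:R.
    apply: threshold_grid.
    - by move=> i; exact: level_index_decr.
    - by rewrite ltW //= (le_trans us) //; case/andP: (stop_clock_itv w).
    - move=> i ni h; rewrite leNgt; apply/negP => ui; move: h; rewrite ltNge.
      by rewrite -lu (path_homo xl) // ltW.
    - by move=> i ni h; rewrite leNgt; apply/negP => /below; apply/negP.
  split=> //.
  - by rewrite -xu; apply: cvg_grid Ju (path_cont xl).
  - by rewrite -lu; apply: cvg_grid Ju (path_lcont xl).
  have := us; rewrite -[X in _ <= X]/(stop_clock w) le_eqVlt => /predU1P[usE|us'].
    by right; rewrite !stoppedE -usE.
  left; have cJ : (fun n => grid n (J n w)) @ \oo --> u.
    by apply: (cvg_grid (g := id) Ju) => ?; exact: cvg_id.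
  have us'' : \forall n \near \oo, grid n (J n w) < stop_clock w.
    exact: (cvgr_lt _ cJ).
  apply: filterS us'' => n h.
  rewrite /c; case: ltnP => // J'J; exfalso; move: h; apply/negP; rewrite -leNgt.
  apply: le_trans (grid_homo _ J'J).
  by case/andP: (stop_index_grid n w).
have imul (Y : T -> R) n : intg Y -> intg (fun w => Y w * c n w).
  move=> iY; apply: intg_dom (intg_norm iY) _.
    by apply: measurable_funM => //; exact: intg_measurable iY.
  move=> w; have /andP[c0 c1] := c01 n w.
  by rewrite normrM ler_piMr // ger0_norm.
have iX n J0 : grid_time n J0 -> intg (fun w => X (grid n (J0 w)) w * c n w).
  by move=> gJ0; apply: imul; apply: intg_at_grid gJ0; exact: pair_intg.
have uiX (J0 : nat -> T -> nat) : (forall n, grid_time n (J0 n)) -> forall e, 0 < e ->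
    exists K, forall n, mean (fun w => Num.max (X (grid n (J0 n w)) w * c n w - K) 0) <= e.
  move=> gJ0 e /excess_ui[K KE]; exists K => n.
  apply: le_trans _ (le_trans (mean_excess_grid K (gJ0 n)) KE).
  apply: le_mean; [exact/intg_max/iX| |].
    by apply/intg_max/intg_at_grid; [exact: pair_intg|].
  move=> w; have /andP[c0 c1] := c01 n w.
  by rewrite ge_max !le_max lexx orbT andbT lerB // ler_piMr // X_ge0.
have X0 (J0 : nat -> T -> nat) n w : 0 <= X (grid n (J0 n w)) w * c n w.
  by have /andP[c0 _] := c01 n w; rewrite mulr_ge0 // X_ge0.
have small (u : nat -> R) w : u @ \oo --> 0 -> (fun n => u n * c n w) @ \oo --> 0.
  move=> /cvgr0Pnorm_lt u0; apply/cvgr0Pnorm_lt => e /u0; apply: filterS => n.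
  apply: le_lt_trans; have /andP[c0 c1] := c01 n w.
  by rewrite normrM ler_piMr // ger0_norm.
have near1 (u : nat -> R) (a : R) w : u @ \oo --> a -> (\forall n \near \oo, c n w = 1) ->
    (fun n => u n * c n w) @ \oo --> a.
  move=> ua c1; apply: cvg_trans ua; apply: near_eq_cvg.
  by apply: filterS c1 => n ->; rewrite mulr1.
have near0 (u : nat -> R) w : (\forall n \near \oo, c n w = 0) ->
    (fun n => u n * c n w) @ \oo --> 0.
  by move=> c0; apply: cvg_near_cst; apply: filterS c0 => n ->; rewrite mulr0.
have limX w : (fun n => X (grid n (J' n w)) w * c n w) @ \oo -->
    stopped X S N w * (v <= stopped L S N w)%R%:R.
  have cX := cvg_stop_index (Y := X) (path_cont (pair_path XL w)).
  have [[Lv c0]|[vL _ _ [c1|[X0' _]]]] := lim w.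
  - by rewrite leNgt Lv mulr0; exact: near0.
  - by rewrite vL mulr1; exact: near1.
  - by rewrite X0' mul0r; apply: small; rewrite -X0'.
have limY w : (fun n => X (grid n (J n w)) w * c n w) @ \oo --> 0.
  by have [[_ c0]|[_ cJ _ _]] := lim w; [exact: near0|exact: small].
have limZ w : (fun n => (L (grid n (J' n w)) w - L (grid n (J n w)) w) * c n w) @ \oo -->
    Num.max (stopped L S N w - v) 0.
  have cL := cvg_stop_index (Y := L) (path_lcont (pair_path XL w)).
  have [[Lv c0]|[vL _ cJ cases]] := lim w.
    rewrite max_r; last by rewrite subr_le0 ltW.
    exact: near0.
  rewrite max_l; last by rewrite subr_ge0.
  pose u n := L (grid n (J' n w)) w - L (grid n (J n w)) w.
  have cu : u @ \oo --> stopped L S N w - v by exact: cvgB.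
  have [c1|[_ Lv]] := cases; first exact: (near1 u).
  by rewrite Lv subrr; apply: (small u); rewrite Lv subrr in cu.
have [_ cvgX] := vitali_mean (fun n => iX n _ (gJ' n)) (X0 J') limX (uiX _ gJ').
have [_ cvgY] := vitali_mean (fun n => iX n _ (gJ n)) (X0 J) limY (uiX _ gJ).
have [|_ cvgZ] := dominated_mean (P := P) (Y := L N) (fun n => intg_measurable (imul _ n
   (intgB (intg_at_grid (pair_lintg XL) (gJ' n)) (intg_at_grid (pair_lintg XL) (gJ n)))))
  limZ (pair_lintg XL (ltW N0)) _.
  move=> n w; have /andP[c0 c1] := c01 n w.
  rewrite normrM; apply: (@le_trans _ _ `|L (grid n (J' n w)) w - L (grid n (J n w)) w|).
    by rewrite ler_piMr // ger0_norm.
  have Lle J0 : grid_time n J0 -> 0 <= L (grid n (J0 w)) w <= L N w.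
    move=> /grid_index_le-/(_ w) /(path_homo (pair_path XL w)) ->.
    by rewrite L_ge0.
  have := Lle _ (gJ n); have := Lle _ (gJ' n); rewrite ler_norml; lra.
have cvgYZ : (fun n => mean (fun w => X (grid n (J n w)) w * c n w) +
     mean (fun w => (L (grid n (J' n w)) w - L (grid n (J n w)) w) * c n w)) @ \oo -->
    mean (fun w => Num.max (stopped L S N w - v) 0).
  by rewrite -[X in _ --> X]add0r -{1}(mean_cst P 0); exact: cvgD.
apply: (cvg_unique _ cvgX) => //=.
apply: cvg_trans cvgYZ; apply: near_eq_cvg; apply: nearW => n.
by apply/esym; exact: mart_grid.
Qed.

End stopping.
End grid.
End optional_stopping.

(** * Hitting times of an increasing barrier *)

Section barrier_time.
Context {d : measure_display} {T : measurableType d} {R : realType}.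
Variable P : probability T R.
Variables (F : R -> set (set T)) (X L : R -> T -> R).

Local Notation mean X := (Rintegral P setT X).
Local Notation intg X := (P.-integrable setT (EFin \o X)).

Hypothesis XL : reflected_pair P F X L.
Hypothesis X_null : forall t, 0 < t -> P [set w | X t w <= 0] = 0%E.
Hypothesis X_large : forall K e : R, 0 < e -> exists2 t, 0 < t &
  fine (P [set w | X t w <= K]) <= e.

Lemma measurable_X t : 0 <= t -> measurable_fun setT (X t).
Proof. by move=> t0; exact: intg_measurable (pair_intg XL t0). Qed.

Lemma measurable_L t : 0 <= t -> measurable_fun setT (L t).
Proof. by move=> t0; exact: intg_measurable (pair_lintg XL t0). Qed.

Lemma stopping_time_infty : stopping_time F (fun=> +oo%E).
Proof.
split=> // t t0; rewrite (_ : [set _ | _] = set0).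
  by have [] := pair_sigma XL t0.
by apply/seteqP; split => w.
Qed.

Lemma stopped_infty (Y : R -> T -> R) t : stopped Y (fun=> +oo%E) t = Y t.
Proof. by apply/funext => w; rewrite /stopped miney. Qed.

Lemma measurable_lt_level (Y : T -> R) (a : R) : measurable_fun setT Y ->
  measurable [set w | Y w < a].
Proof.
move=> mY; rewrite (_ : [set _ | _] = setT `&` Y @^-1` `]-oo, a[); first exact: mY.
by rewrite setTI; apply/seteqP; split => w /=; rewrite in_itv /=.
Qed.

Lemma measurable_le_level (Y : T -> R) (a : R) : measurable_fun setT Y ->
  measurable [set w | Y w <= a].
Proof.
move=> mY; rewrite (_ : [set _ | _] = setT `&` Y @^-1` `]-oo, a]); first exact: mY.
by rewrite setTI; apply/seteqP; split => w /=; rewrite in_itv /=.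
Qed.

(** Since [X t] and [L t] have the same mean, subtracting the optional stopping identity at level
    [v] leaves the mean of [min (L t) v]. *)
Lemma mean_X_low t (v : R) : 0 < t -> 0 < v ->
  mean (fun w => X t w * (L t w < v)%R%:R) <= v.
Proof.
move=> t0 v0; have t0' := ltW t0.
have iX := pair_intg XL t0'; have iL := pair_lintg XL t0'.
have mlt := measurable_lt_level v (measurable_L t0').
have mge := measurable_level v (measurable_L t0').
have ilt : intg (fun w => X t w * (L t w < v)%R%:R).
  have -> : (fun w => X t w * (L t w < v)%R%:R) =
    (fun w => X t w * \1_[set w | (L t w < v)%R] w).
    by apply/funext => w; rewrite -bool_indic.
  exact: intgM_indic.
have ige : intg (fun w => X t w * (v <= L t w)%R%:R).
  have -> : (fun w => X t w * (v <= L t w)%R%:R) =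
    (fun w => X t w * \1_[set w | (v <= L t w)%R] w).
    by apply/funext => w; rewrite -bool_indic.
  exact: intgM_indic.
have := optional_stopping XL t0 stopping_time_infty v0.
rewrite !stopped_infty => os.
have EX : mean (X t) = mean (L t).
  have FT : F 0 setT.
    by have [F0 FC _] := pair_sigma XL (lexx 0); rewrite -(setD0 setT); exact: FC.
  have := pair_mart XL (lexx 0) t0' FT.
  under eq_Rintegral do rewrite indicE in_setT mulr1.
  under [in RHS]eq_Rintegral => w _ do
    rewrite (path_x0 (pair_path XL w)) (path_l0 (pair_path XL w) (lexx 0)) subrr mul0r.
  by rewrite meanB // mean_cst => /eqP; rewrite subr_eq0 => /eqP.
have : mean (fun w => X t w * (L t w < v)%R%:R) + mean (fun w => X t w * (v <= L t w)%R%:R) =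
    mean (fun w => Num.min (L t w) v) + mean (fun w => Num.max (L t w - v) 0).
  rewrite -!meanD //; [|exact: intg_min|exact: intg_max].
  transitivity (mean (X t)).
    apply: eq_Rintegral => w _; rewrite -mulrDr; case: ltP => _;
    by rewrite ?addr0 ?add0r mulr1.
  rewrite EX; apply: eq_Rintegral => w _.
  by rewrite /Num.min /Num.max; do 2 case: ifPn; rewrite -?leNgt; lra.
have : mean (fun w => Num.min (L t w) v) <= v.
  rewrite -[leRHS](mean_cst P); apply: le_mean; [exact: intg_min|exact: intg_cst|].
  by move=> w; rewrite ge_min lexx orbT.
rewrite os; lra.
Qed.

(** Either [X t <= K], or Markov's inequality applies to [X t] on the event [L t < v]. *)
Lemma prob_L_low t (v K : R) : 0 < t -> 0 < v -> 0 < K ->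
  mean (fun w => (L t w < v)%R%:R) <= mean (fun w => (X t w <= K)%R%:R) + v / K.
Proof.
move=> t0 v0 K0; have t0' := ltW t0.
have iX := pair_intg XL t0'.
have mlt := measurable_lt_level v (measurable_L t0').
have mle := measurable_le_level K (measurable_X t0').
have ilt : intg (fun w => X t w * (L t w < v)%R%:R).
  have -> : (fun w => X t w * (L t w < v)%R%:R) =
    (fun w => X t w * \1_[set w | (L t w < v)%R] w).
    by apply/funext => w; rewrite -bool_indic.
  exact: intgM_indic.
apply: (@le_trans _ _ (mean (fun w => (X t w <= K)%R%:R +
    K^-1 * (X t w * (L t w < v)%R%:R)))); last first.
  rewrite meanD; [|exact: intg_bool|exact: intgZ].
  rewrite meanZ // lerD2l mulrC ler_pM2r ?invr_gt0 //; exact: mean_X_low.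
apply: le_mean; [exact: intg_bool|by apply: intgD; [exact: intg_bool|exact: intgZ]|].
move=> w; case: (ltP (L t w) v) => _; last first.
  by rewrite mulr0 mulr0 addr0.
rewrite mulr1; have [_|KX] := leP (X t w) K.
  by rewrite lerDl mulr_ge0 ?(X_ge0 XL) // invr_ge0 ltW.
by rewrite add0r ler_pdivlMl // mulr1 ltW.
Qed.

(** The local time tends to infinity in probability. With [K = 2 v / e] the term [v / K] is [e / 2],
    and a late time makes [X t <= K] as unlikely. *)
Lemma L_recurrent (v e : R) : 0 < v -> 0 < e ->
  exists2 t, 0 < t & mean (fun w => (L t w < v)%R%:R) <= e.
Proof.
move=> v0 e0; have e2 : 0 < e / 2 by lra.
have K0 : 0 < v / (e / 2) by rewrite divr_gt0.
have [t t0 Xt] := X_large (v / (e / 2)) e2; exists t => //.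
apply: le_trans (prob_L_low t0 v0 K0) _.
rewrite mean_bool; last exact/measurable_le_level/measurable_X/ltW.
rewrite (_ : v / (v / (e / 2)) = e / 2); first by lra.
by field; rewrite !lt0r_neq0.
Qed.

Lemma L_pos_null t : 0 < t -> P [set w | L t w <= 0] = 0%E.
Proof.
move=> t0; have t0' := ltW t0.
have mL : measurable [set w | L t w <= 0] by exact/measurable_le_level/measurable_L.
have mX a : measurable [set w | X t w <= a] by exact/measurable_le_level/measurable_X.
have bound (K : R) : 0 < K -> fine (P [set w | L t w <= 0]) <= fine (P [set w | X t w <= K]).
  move=> K0; apply/ler_addgt0Pr => e e0.
  (* At level [e * K] the error [v / K] is [e], which can be sent to 0 while [K] is fixed; [K] goes
     to 0 afterwards. *)
  have v0 : 0 < e * K by rewrite mulr_gt0.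
  have := prob_L_low t0 v0 K0; rewrite mulfK ?lt0r_neq0 // -[fine (P [set w | X t w <= K])]mean_bool //.
  apply: le_trans; rewrite -mean_bool //.
  apply: le_mean.
  - exact: intg_bool.
  - by apply: intg_bool; exact/measurable_lt_level/measurable_L.
  - move=> w; case: (leP (L t w) 0) => // L0.
    by rewrite (le_lt_trans L0).
have cX : fine (P [set w | X t w <= n.+1%:R^-1]) @[n --> \oo] --> 0.
  have -> : 0 = fine (P (\bigcap_n [set w | X t w <= n.+1%:R^-1])).
    rewrite (_ : \bigcap_n _ = [set w | X t w <= 0]) ?X_null //.
    apply/seteqP; split => [w h|w /= h n _ /=]; last by apply: le_trans h _; rewrite invr_ge0.
    apply/ler_addgt0Pr => e e0; have [k /=] := ltr_add_invr e0.
    by rewrite !add0r => /ltW; apply: le_trans; exact: h.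
  apply: fine_cvg; rewrite fineK ?fin_num_measure //; last first.
    by apply: bigcap_measurable => // n _.
  apply: nonincreasing_cvg_mu => //.
  - by rewrite ltey_eq fin_num_measure.
  - by apply: bigcap_measurable => // n _.
  - move=> n m nm; apply/subsetPset => w /= /le_trans; apply.
    by rewrite lef_pV2 ?posrE // ler_nat.
have : fine (P [set w | L t w <= 0]) <= 0.
  rewrite -[leRHS](cvg_lim _ cX) //; apply: limr_ge; first by apply/cvg_ex; exists 0.
  by apply: nearW => n; apply: bound; rewrite invr_gt0.
move=> P0; rewrite -[LHS]fineK ?fin_num_measure //; congr EFin.
by apply/eqP; rewrite eq_le P0 fine_ge0 // measure_ge0.
Qed.



Section barrier.
Variables (f : R -> R) (eta : R).
Hypothesis eta0 : 0 < eta.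
Hypothesis fhomo : {homo f : x y / x <= y}.
Hypothesis fpos : forall v, 0 < v -> 0 < f v.

Definition barrier_time w : \bar R :=
  ereal_inf [set t%:E | t in hitting f (X^~ w) (L^~ w) eta].

Local Notation S := barrier_time.

Let feta v : eta <= v -> 0 < f v.
Proof. by move=> ev; apply: fpos; exact: lt_le_trans ev. Qed.

Lemma barrier_time_hit w u : hitting f (X^~ w) (L^~ w) eta u -> (S w <= u%:E)%E.
Proof. by move=> Hu; apply: ereal_inf_lbound; exists u. Qed.

Lemma barrier_time_fin w : (S w < +oo)%E ->
  exists2 u, hitting f (X^~ w) (L^~ w) eta u & S w = u%:E.
Proof.
set H := hitting _ _ _ _ => SH.
have H0 : H !=set0.
  apply/set0P/negP => /eqP H0; move: SH.
  by rewrite /barrier_time -/H H0 image_set0 ereal_inf0 ltxx.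
exists (inf H); last first.
  by rewrite /barrier_time -/H ereal_inf_EFin //; exists 0 => t [/ltW].
by apply: inf_hitting (pair_path XL w) eta0 feta H0 _ => v v' _; exact: fhomo.
Qed.

Lemma barrier_time_le w t : (S w <= t%:E)%E <->
  exists2 u, hitting f (X^~ w) (L^~ w) eta u & u <= t.
Proof.
split=> [St|[u Hu ut]].
  have [u Hu Su] := barrier_time_fin (le_lt_trans St (ltry _)).
  by exists u => //; rewrite -lee_fin -Su.
by apply: le_trans (barrier_time_hit Hu) _; rewrite lee_fin.
Qed.

Lemma barrier_stopping : stopping_time F S.
Proof.
split=> [w|t t0].
  by apply: le_ereal_inf_tmp => _ [t [t0 _] <-]; rewrite lee_fin ltW.
have FE : <<s F t>> = F t by exact: (sigma_algebra_id (pair_sigma XL t0)).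
(* [F t] becomes the sigma-algebra of an auxiliary measurable space, in which measurable means known
   at time [t]. *)
pose TF := g_sigma_algebraType (F t).
have mXL (Y : R -> T -> R) u : adapted F Y -> 0 <= u <= t ->
    measurable_fun setT (Y u : TF -> R).
  move=> aY /andP[u0 ut] _ Z mZ; rewrite setTI.
  have : <<s F t>> (Y u @^-1` Z) by rewrite FE; apply: (pair_homo XL u0 ut); exact: aY.
  by [].
have mX q : measurable_fun setT (X (clip t q) : TF -> R).
  by apply: mXL; [exact: (pair_adapted XL)|exact: clip_itv].
have mL q : measurable_fun setT (L (clip t q) : TF -> R).
  by apply: mXL; [exact: (pair_ladapted XL)|exact: clip_itv].
have mf q : measurable_fun setT (fun w : TF => f (L (clip t q) w)).
  apply: (measurableT_comp _ (mL q)); exact: nondecreasing_measurable.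
rewrite -FE; have -> : [set w | (S w <= t%:E)%E] =
  \bigcup_(q in [set: rat]) ([set w | eta <= L (clip t q) w] `&`
    \bigcap_(k in [set: nat]) \bigcup_(s in [set: rat])
      ([set w | L (clip t s) w = L (clip t q) w] `&`
       [set w | f (L (clip t q) w) - k.+1%:R^-1 < X (clip t s) w])).
  apply/seteqP; split=> w.
    move=> /barrier_time_le /(hitting_le_rat (pair_path XL w) eta0 feta t0)[q [lq qP]].
    exists q => //; split => // k _; have [s [ls fs]] := qP k.
    by exists s.
  move=> [q _ [lq qP]]; apply/barrier_time_le/(hitting_le_rat (pair_path XL w) eta0 feta t0).
  by exists q; split => // k; have [s _ [ls fs]] := qP k I; exists s.
have mtrue : measurable [set true] by [].
pose A q : set TF := [set w | eta <= L (clip t q) w].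
pose A1 q s : set TF := [set w | L (clip t s) w = L (clip t q) w].
pose A2 q k s : set TF := [set w | f (L (clip t q) w) - k.+1%:R^-1 < X (clip t s) w].
suff : measurable (\bigcup_(q in [set: rat]) (A q `&`
    \bigcap_(k in [set: nat]) \bigcup_(s in [set: rat]) (A1 q s `&` A2 q k s))) by [].
apply: bigcupT_measurable_rat => q; apply: measurableI; first exact: measurable_level.
apply: bigcapT_measurable => k; apply: bigcupT_measurable_rat => s.
apply: measurableI.
  have := measurable_fun_eqr (mL s) (mL q) measurableT mtrue.
  rewrite setTI; congr measurable.
  by apply/seteqP; split => w /= /eqP.
have mfk : measurable_fun setT (fun w : TF => f (L (clip t q) w) - k.+1%:R^-1).
  by apply: measurable_funB => //; exact: mf.
have := measurable_fun_ltr mfk (mX s) measurableT mtrue.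
by rewrite setTI; congr measurable; apply/seteqP; split => w /=.
Qed.

Lemma stopped_below N w : 0 < N -> eta <= stopped L S N w ->
  stopped X S N w <= f (stopped L S N w).
Proof.
move=> N0 LN; apply: (below_barrier (pair_path XL w) eta0 feta LN) => u Hu.
rewrite -lee_fin -[X in (X <= _)%E]/((stop_clock N S w)%:E) (stop_clockE N barrier_stopping).
by rewrite ge_min (barrier_time_hit Hu) orbT.
Qed.

Lemma stopped_hit N w : (S w <= N%:E)%E -> [/\ eta <= stopped L S N w,
  stopped L S N w = at_time L S w & stopped X S N w = f (at_time L S w)].
Proof.
move=> SN; have [u [u0 [lu xu]] Su] := barrier_time_fin (le_lt_trans SN (ltry _)).
have uN : u <= N by rewrite -lee_fin -Su.
have -> : stopped L S N w = L u w.
  by rewrite /stopped Su -EFin_min min_r.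
by rewrite /at_time Su /= /stopped Su -EFin_min min_r.
Qed.

(** The difference of the optional stopping identities at [v] and [v']. The right-hand side is the
    integral of the survival function of the stopped local time over [[v, v']], so this is the
    hazard identity in integrated form. *)
Lemma mean_between N (v v' : R) : 0 < N -> 0 < v -> v <= v' ->
  mean (fun w => stopped X S N w * (v <= stopped L S N w < v')%R%:R) =
  mean (fun w => Num.min (stopped L S N w) v') - mean (fun w => Num.min (stopped L S N w) v).
Proof.
move=> N0 v0 vv'; have v'0 := lt_le_trans v0 vv'.
have iX := intg_stopped XL N0 barrier_stopping.
have iL := intg_lstopped XL N0 barrier_stopping.
have mge a := measurable_level a (intg_measurable iL).
have ige a : intg (fun w => stopped X S N w * (a <= stopped L S N w)%R%:R).
  have -> : (fun w => stopped X S N w * (a <= stopped L S N w)%R%:R) =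
    (fun w => stopped X S N w * \1_[set w | (a <= stopped L S N w)%R] w).
    by apply/funext => w; rewrite -bool_indic.
  exact: intgM_indic.
rewrite -meanB; [|exact: intg_min..].
transitivity (mean (fun w => stopped X S N w * (v <= stopped L S N w)%R%:R) -
    mean (fun w => stopped X S N w * (v' <= stopped L S N w)%R%:R)).
  rewrite -meanB //; apply: eq_Rintegral => w _; rewrite -mulrBr; congr (_ * _).
  have [v'L|Lv'] := leP v' (stopped L S N w); last by rewrite andbT subr0.
  by rewrite andbF (le_trans vv' v'L) subrr.
rewrite !(optional_stopping XL N0 barrier_stopping) //.
rewrite -meanB; [|exact: intg_max..]; apply: eq_Rintegral => w _.
by rewrite /Num.min /Num.max; do 4 case: ifPn; rewrite -?leNgt; lra.
Qed.

(** * Almost sure finiteness of the barrier time *)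

Section finiteness.
Variable C : R.
Hypothesis C0 : 0 < C.
Hypothesis f_linear : forall a, exists2 b, a <= b & f (2 * b) <= C * b.

Let ratio_itv : 0 <= C / (1 + C) < 1.
Proof.
have C1 : 0 < 1 + C by rewrite addr_gt0.
by rewrite divr_ge0 ?ltW //= ltr_pdivrMr // mul1r ltrDr.
Qed.

Let a N (v : R) := mean (fun w => (v <= stopped L S N w)%R%:R).

Let mL N v : 0 < N -> measurable [set w | v <= stopped L S N w].
Proof. by move=> N0; apply/measurable_level/intg_measurable/(intg_lstopped XL N0 barrier_stopping). Qed.

(** Between the levels [v] and [2 v], the mean of [X] is at least [v * a N (2 * v)], the survivors
    having gained [v] of local time. It is at most [f (2 * v)] times the loss [a N v - a N (2 * v)],
    as [X] stays below the barrier. Solving for [a N (2 * v)] gives the ratio. *)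
Let a_contract N v : 0 < N -> eta <= v -> f (2 * v) <= C * v ->
  a N (2 * v) <= C / (1 + C) * a N v.
Proof.
move=> N0 ev fv; have v0 := lt_le_trans eta0 ev.
have vv : v <= 2 * v by lra.
have iX := intg_stopped XL N0 barrier_stopping.
have iL := intg_lstopped XL N0 barrier_stopping.
have iB u : intg (fun w => (u <= stopped L S N w)%R%:R) by apply: intg_bool; exact: mL.
have E := mean_between N0 v0 vv.
have lo : v * a N (2 * v) <= mean (fun w => Num.min (stopped L S N w) (2 * v)) -
    mean (fun w => Num.min (stopped L S N w) v).
  rewrite -meanB; [|exact: intg_min..]; rewrite -meanZ //.
  apply: le_mean; [exact: intgZ|by apply: intgB; exact: intg_min|] => w.
  have [h|h] := leP (2 * v) (stopped L S N w).
    by rewrite mulr1 !min_r; lra.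
  by rewrite mulr0 subr_ge0 ge_min lexx.
have hi : mean (fun w => stopped X S N w * (v <= stopped L S N w < 2 * v)%R%:R) <=
    C * v * (a N v - a N (2 * v)).
  rewrite -meanB // -meanZ; last exact: intgB.
  apply: le_mean.
  - apply: intg_dom (intg_norm iX) _.
      have -> : (fun w => stopped X S N w * (v <= stopped L S N w < 2 * v)%R%:R) =
        (fun w => stopped X S N w * ((v <= stopped L S N w)%R%:R - (2 * v <= stopped L S N w)%R%:R)).
        apply/funext => w; congr (_ * _).
        have [h|h] := leP (2 * v) (stopped L S N w); last by rewrite andbT subr0.
        by rewrite andbF (le_trans vv h) subrr.
      apply: measurable_funM; first exact: intg_measurable iX.
      by apply: (intg_measurable (P := P)); exact: intgB.
    by move=> w; rewrite normrM ler_piMr //; case: (_ <= _ < _); rewrite ?normr1 ?normr0.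
  - by apply: intgZ; exact: intgB.
  - move=> w; have [vL|Lv] := leP v (stopped L S N w); last first.
      by rewrite /= mulr0 (leNgt (2 * v)) (lt_le_trans Lv vv) /= subr0 mulr0.
    have [h|h] := leP (2 * v) (stopped L S N w); first by rewrite /= subrr !mulr0.
    rewrite /= subr0 !mulr1; apply: le_trans (stopped_below N0 (le_trans ev vL)) _.
    by apply: le_trans fv; apply: fhomo; exact: ltW.
have : v * a N (2 * v) <= v * (C * (a N v - a N (2 * v))).
  by rewrite mulrA (mulrC v C); apply: le_trans hi; rewrite E.
rewrite ler_pM2l // => h; rewrite mulrAC ler_pdivlMr ?addr_gt0 //.
by move: h; lra.
Qed.

Let a_le1 N v : 0 < N -> a N v <= 1.
Proof.
move=> N0; rewrite -[leRHS](mean_cst P); apply: le_mean.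
- by apply: intg_bool; exact: mL.
- exact: intg_cst.
- by move=> w; rewrite lern1 leq_b1.
Qed.

Let a_decr N u v : 0 < N -> u <= v -> a N v <= a N u.
Proof.
move=> N0 uv; apply: le_mean; [by apply: intg_bool; exact: mL..|] => w.
by case: (leP v) => // vL; rewrite (le_trans uv vL).
Qed.

(** Iterates the contraction along levels where the barrier is at most linear; the level found does
    not depend on [N]. *)
Let a_small n : exists2 v, 0 < v & forall N, 0 < N -> a N v <= (C / (1 + C)) ^+ n.
Proof.
elim: n => [|n [v v0 av]]; first by exists 1 => // N N0; exact: a_le1.
have [b vb fb] := f_linear (Num.max v eta).
move: vb; rewrite ge_max => /andP[vb eb].
exists (2 * b) => [|N N0]; first by rewrite mulr_gt0 // (lt_le_trans v0).
apply: le_trans (a_contract N0 eb fb) _; rewrite exprS ler_wpM2l //.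
  by have /andP[] := ratio_itv.
by apply: le_trans (av N N0); apply: a_decr => //; lra.
Qed.

Lemma measurable_barrier_le t : 0 <= t -> measurable [set w | (S w <= t%:E)%E].
Proof. by move=> t0; apply: (pair_measurable XL t0); exact: barrier_stopping.2. Qed.

Lemma measurable_barrier_infty : measurable [set w | S w == +oo%E].
Proof.
rewrite (_ : [set _ | _] = ~` \bigcup_n [set w | (S w <= n%:R%:E)%E]).
  by apply: measurableC; apply: bigcupT_measurable => n; exact: measurable_barrier_le.
apply/seteqP; split => w /=; first by move=> /eqP Sw [n _ /=]; rewrite Sw leye_eq.
move=> h; apply/negPn/negP; rewrite -ltey => /barrier_time_fin[u Hu Su]; apply: h.
by exists (Num.trunc u).+1 => //=; rewrite Su lee_fin ltW // truncnS_gt.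
Qed.

(** Where the barrier is never hit, stopping changes nothing: either the stopped local time is at
    least [v] at time [t], which [a_small] bounds uniformly in [t], or [L t < v], which is unlikely
    for a suitable [t]. *)
Lemma barrier_time_null : P [set w | S w == +oo%E] = 0%E.
Proof.
have mS := measurable_barrier_infty.
suff : mean (fun w => (S w == +oo%E)%:R) <= 0.
  rewrite mean_bool // => P0; rewrite -[LHS]fineK ?fin_num_measure //; congr EFin.
  by apply/eqP; rewrite eq_le P0 fine_ge0 // measure_ge0.
have bound n : mean (fun w => (S w == +oo%E)%:R) <= (C / (1 + C)) ^+ n.
  apply/ler_addgt0Pr => e e0; have [v v0 av] := a_small n.
  have [t t0 Lt] := L_recurrent v0 e0.
  apply: le_trans _ (lerD (av t t0) Lt).
  have mlt : measurable [set w | L t w < v] by exact/measurable_lt_level/measurable_L/ltW.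
  rewrite -meanD; [|by apply: intg_bool; exact: mL|exact: intg_bool].
  apply: le_mean; [exact: intg_bool|by apply: intgD; apply: intg_bool => //; exact: mL|].
  move=> w; have [Sw|_] := eqVneq (S w) +oo%E; last by rewrite addr_ge0.
  rewrite /stopped Sw miney /=; case: (leP v (L t w)) => _ /=; rewrite ?lerDl ?lerDr //.
have cX : (C / (1 + C)) ^+ n @[n --> \oo] --> 0.
  by have /andP[r0 r1] := ratio_itv; apply: cvg_expr; rewrite ger0_norm.
rewrite -[leRHS](cvg_lim _ cX) //; apply: limr_ge; first by apply/cvg_ex; exists 0.
exact: nearW.
Qed.

End finiteness.

(** * Hazard inequality for the local time at the barrier time *)

Section finite_barrier.
Hypothesis S_null : P [set w | S w == +oo%E] = 0%E.

Local Notation LS := (at_time L S).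

Lemma at_barrier_ge0 w : 0 <= LS w. Proof. exact: (L_ge0 XL). Qed.

Let near_hit w : S w != +oo%E -> \forall n \near \oo, (S w <= n.+1%:R%:E)%E.
Proof.
rewrite -ltey => /barrier_time_fin[u _ ->]; exists (Num.trunc u) => // n /= nu.
by rewrite lee_fin (le_trans (ltW (truncnS_gt u))) // ler_nat.
Qed.

Let nS : P.-negligible [set w | S w == +oo%E].
Proof. by apply/negligibleP => //; exact: measurable_barrier_infty. Qed.

Lemma measurable_at_barrier : measurable_fun setT LS.
Proof.
have mS n := measurable_barrier_le (ler0n R n.+1).
apply: (@measurable_fun_cvg _ _ _ setT
    (fun n w => stopped L S n.+1%:R w * \1_[set w | (S w <= n.+1%:R%:E)%E] w)).
  move=> n; apply: measurable_funM; last exact: measurable_indic.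
  exact: (intg_measurable (intg_lstopped XL (ltr0Sn R n) barrier_stopping)).
move=> w _; have [Sw|] := eqVneq (S w) +oo%E.
  (* [fine +oo] is 0, so [at_time] reads [L] at time 0 here, where it vanishes. *)
  rewrite [X in _ --> X](_ : _ = 0); last first.
    by rewrite /at_time Sw (path_l0 (pair_path XL w)).
  apply: cvg_near_cst; apply: nearW => n.
  by rewrite -bool_indic Sw leye_eq mulr0.
move=> /near_hit Sw; apply: cvg_near_cst; apply: filterS Sw => n Sn.
by rewrite -bool_indic Sn mulr1; have [] := stopped_hit Sn.
Qed.

Let mLS v : measurable [set w | v <= LS w].
Proof. exact/measurable_level/measurable_at_barrier. Qed.

Lemma intg_min_at_barrier v : 0 <= v -> intg (fun w => Num.min (LS w) v).
Proof.
move=> v0; apply: (@intg_bounded _ _ _ P _ v).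
  by apply: measurable_minr; [exact: measurable_at_barrier|exact: measurable_cst].
by move=> w; rewrite ger0_norm ?ge_min ?lexx ?orbT // le_min at_barrier_ge0.
Qed.

Lemma at_barrier_start v : v <= eta -> mean (fun w => (v <= LS w)%R%:R) = 1.
Proof.
move=> ve; rewrite -[RHS](mean_cst P); apply/esym.
have [] // := @ae_mean _ _ _ P (fun=> 1) (fun w => (v <= LS w)%R%:R).
- exact: intg_cst.
- by apply: (intg_measurable (P := P)); exact: intg_bool.
apply: negligibleS nS => w /=; apply: contraTT; rewrite -ltey negbK => /barrier_time_fin.
by move=> [u [_ [lu _]] Su]; rewrite /at_time Su /= (le_trans ve lu).
Qed.

(** At the hit [X] equals [f (L)], hence is at least [x] once the level is at least [v]. Paths not
    yet stopped at time [n] contribute a nonnegative amount to [mean_between], which is dropped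
    before [n] goes to infinity. *)
Lemma barrier_hazard_above (v v' x : R) : 0 < v -> v <= v' -> 0 <= x -> x <= f v ->
  x * (mean (fun w => (v <= LS w)%R%:R) - mean (fun w => (v' <= LS w)%R%:R)) <=
  mean (fun w => Num.min (LS w) v') - mean (fun w => Num.min (LS w) v).
Proof.
move=> v0 vv' x0 xf; have v'0 := lt_le_trans v0 vv'.
have iB u : intg (fun w => (u <= LS w)%R%:R) by exact: intg_bool.
pose Q n w : R := (v <= LS w)%R%:R - (v' <= LS w)%R%:R.
have QE w : (v <= LS w)%R%:R - (v' <= LS w)%R%:R = (v <= LS w < v')%R%:R :> R.
  have [h|h] := leP v' (LS w); last by rewrite andbT subr0.
  by rewrite andbF (le_trans vv' h) subrr.
have mS n := measurable_barrier_le (ler0n R n.+1).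
have iQ n : intg (fun w => ((v <= LS w)%R%:R - (v' <= LS w)%R%:R) *
    \1_[set w | (S w <= n.+1%:R%:E)%E] w).
  by apply: intgM_indic => //; exact: intgB.
have hn n : x * mean (fun w => ((v <= LS w)%R%:R - (v' <= LS w)%R%:R) *
    \1_[set w | (S w <= n.+1%:R%:E)%E] w) <=
    mean (fun w => Num.min (stopped L S n.+1%:R w) v' - Num.min (stopped L S n.+1%:R w) v).
  have iL := intg_lstopped XL (ltr0Sn R n) barrier_stopping.
  have iX := intg_stopped XL (ltr0Sn R n) barrier_stopping.
  rewrite meanB; [|exact: intg_min..].
  rewrite -(mean_between (ltr0Sn R n) v0 vv') -meanZ //.
  apply: le_mean; first exact: intgZ.
    apply: intg_dom (intg_norm iX) _.
      apply: measurable_funM; first exact: intg_measurable iX.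
      have mge a := measurable_level a (intg_measurable iL).
      rewrite (_ : (fun w => _) = fun w => (v <= stopped L S n.+1%:R w)%R%:R -
        (v' <= stopped L S n.+1%:R w)%R%:R).
        by apply: (intg_measurable (P := P)); apply: intgB; exact: intg_bool.
      apply/funext => w; have [h|h] := leP v' (stopped L S n.+1%:R w).
        by rewrite andbF (le_trans vv' h) subrr.
      by rewrite andbT subr0.
    by move=> w; rewrite normrM ler_piMr //; case: (_ <= _ < _); rewrite ?normr1 ?normr0.
  move=> w; rewrite -bool_indic QE.
  have [Sn|Sn] := boolP (S w <= n.+1%:R%:E)%E; last first.
    by rewrite !mulr0 mulr_ge0 // (X_ge0 XL).
  have [_ -> ->] := stopped_hit Sn; rewrite mulr1.
  have [/andP[h _]|_] := boolP (v <= LS w < v'); last by rewrite !mulr0.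
  by rewrite !mulr1 (le_trans xf) // fhomo.
have [||_ c1] := @dominated_mean_ae _ _ _ P
  (fun n w => ((v <= LS w)%R%:R - (v' <= LS w)%R%:R) * \1_[set w | (S w <= n.+1%:R%:E)%E] w)
  (fun w => (v <= LS w)%R%:R - (v' <= LS w)%R%:R)
  (fun=> 1) (fun n => intg_measurable (iQ n)) (intg_measurable (intgB (iB v) (iB v'))) _
  (intg_cst P 1) _.
- apply: negligibleS nS => w /=; apply: contra_notT => /near_hit Sw.
  apply: cvg_near_cst; apply: filterS Sw => n Sn.
  by rewrite -bool_indic Sn mulr1.
- move=> n w; rewrite QE -bool_indic normrM.
  by case: (_ <= _ < _); case: (S w <= _)%E; rewrite ?normr1 ?normr0 ?mulr1 ?mulr0.
have [||||_ c2] := @dominated_mean_ae _ _ _ P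
  (fun n w => Num.min (stopped L S n.+1%:R w) v' - Num.min (stopped L S n.+1%:R w) v)
  (fun w => Num.min (LS w) v' - Num.min (LS w) v) (fun=> v') _ _ _ (intg_cst P v') _.
- move=> n; apply: (intg_measurable (P := P)).
  by apply: intgB; apply: intg_min; exact: (intg_lstopped XL (ltr0Sn R n) barrier_stopping).
- apply: (intg_measurable (P := P)).
  by apply: intgB; apply: intg_min_at_barrier; exact: ltW.
- apply: negligibleS nS => w /=; apply: contra_notT => /near_hit Sw.
  apply: cvg_near_cst; apply: filterS Sw => n Sn.
  by have [_ -> _] := stopped_hit Sn.
- move=> n w; have := L_ge0 XL (stop_clock n.+1%:R S w) w.
  rewrite -[L _ _]/(stopped L S n.+1%:R w) => L0.
  by rewrite ler_norml /Num.min; do 2 case: ifPn; rewrite -?leNgt; lra.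
rewrite -meanB //; rewrite -meanB; [|by apply: intg_min_at_barrier; exact: ltW..].
by apply: (ler_cvg_to (cvgMl_tmp (a := x) c1) c2); exact: nearW.
Qed.

(* Below [eta] nothing happens, since [L] has reached [eta] before the hit. *)
Lemma barrier_hazard (v v' x : R) : 0 <= v -> v <= v' -> 0 <= x ->
  x <= f (Num.max v eta) ->
  x * (mean (fun w => (v <= LS w)%R%:R) - mean (fun w => (v' <= LS w)%R%:R)) <=
  mean (fun w => Num.min (LS w) v') - mean (fun w => Num.min (LS w) v).
Proof.
move=> v0 vv' x0; have [ve|ev] := leP v eta; last first.
  by move=> xf; apply: barrier_hazard_above => //; exact: lt_trans ev.
have v'0 := le_trans v0 vv'.
have imin u : 0 <= u -> intg (fun w => Num.min (LS w) u) by exact: intg_min_at_barrier.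
have mono u u' : 0 <= u -> u <= u' ->
    mean (fun w => Num.min (LS w) u) <= mean (fun w => Num.min (LS w) u').
  move=> u0 uu'; apply: le_mean; [exact: imin|by apply: imin; exact: le_trans uu'|].
  by move=> w; rewrite le_min !ge_min lexx /= uu' orbT.
move=> xf; rewrite (at_barrier_start ve).
have [v'e|ev'] := leP v' eta.
  by rewrite (at_barrier_start v'e) subrr mulr0 subr_ge0 mono.
have := barrier_hazard_above eta0 (ltW ev') x0 xf.
rewrite (at_barrier_start (lexx eta)) => /le_trans; apply.
by rewrite lerB // mono.
Qed.

End finite_barrier.
End barrier.

(** * The first contact with a barrier that may vanish at level 0 *)

Section barrier_from_zero.
Variable f : R -> R.
Hypothesis fhomo : {homo f : x y / x <= y}.
Hypothesis fpos : forall v, 0 < v -> 0 < f v.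
Variable C : R.
Hypothesis C0 : 0 < C.
Hypothesis f_linear : forall a, exists2 b, a <= b & f (2 * b) <= C * b.
Hypothesis hP : measure_is_complete P.

Definition first_hit w : \bar R :=
  ereal_inf [set t%:E | t in [set t | 0 < t /\ X t w = f (L t w)]].

Let eta n : R := n.+1%:R^-1.
Let eta0 n : 0 < eta n. Proof. by rewrite invr_gt0. Qed.
Let S n := barrier_time f (eta n).
Let LS n := at_time L (S n).
Let L0 := at_time L first_hit.

Let S_null n : P [set w | S n w == +oo%E] = 0%E.
Proof. exact: (barrier_time_null (eta0 n) fhomo fpos C0 f_linear). Qed.

(** [eta n] is a level in the first union and a time in the second: off this set every barrier time
    is finite and [L] is positive immediately after time 0. *)
Let bad : set T := \bigcup_n [set w | S n w == +oo%E] `|` \bigcup_n [set w | L (eta n) w <= 0].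

Let bad_negligible : P.-negligible bad.
Proof.
apply: negligibleU; apply: negligible_bigcup => n.
  apply/negligibleP; last exact: S_null.
  exact: (measurable_barrier_infty (eta0 n) fhomo fpos).
apply/negligibleP; last exact: L_pos_null.
exact/measurable_le_level/measurable_L/ltW.
Qed.

(** Each [S n] is itself a contact, so it is at least the infimum of all contacts. A contact at a
    time close to the infimum is positive, has positive local time, and is therefore admissible for
    [S n] as soon as [eta n] is below that local time. The infimum need not be a contact. *)
Let good_limit w : ~ bad w -> (forall n, L0 w <= LS n w) /\ (LS^~ w @ \oo --> L0 w).
Proof.
move=> ngood; have xl := pair_path XL w.
have Sfin n : (S n w < +oo)%E.
  by rewrite ltey; apply/negP => Sn; apply: ngood; left; exists n.
have Lpos t : 0 < t -> 0 < L t w.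
  move=> t0; have [n /=] := ltr_add_invr t0; rewrite add0r => nt.
  apply: lt_le_trans (path_homo xl (ltW nt)).
  by rewrite ltNge; apply/negP => h; apply: ngood; right; exists n.
set A := [set t | 0 < t /\ X t w = f (L t w)].
have HS n : exists2 u, hitting f (X^~ w) (L^~ w) (eta n) u & S n w = u%:E.
  exact: (barrier_time_fin (eta0 n) fhomo fpos (Sfin n)).
pose u n := fine (S n w).
have HA n : A (u n) /\ eta n <= L (u n) w.
  by have [v [v0 [ev xv]] Sv] := HS n; rewrite /u Sv.
have lbA : has_lbound A by exists 0 => t [/ltW].
have hA : has_inf A by split => //; exists (u 0); have [] := HA 0.
have L0E : L0 w = L (inf A) w.
  by rewrite /L0 /at_time /first_hit ereal_inf_EFin //; exact: hA.1.
have Au n : inf A <= u n by apply: (ge_inf lbA); have [] := HA n.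
have LSE n : LS n w = L (u n) w by [].
split=> [n|]; first by rewrite L0E LSE; exact: path_homo xl _ _ (Au n).
rewrite L0E; have cu : u @ \oo --> inf A.
  apply/cvgrPdist_lt => e e0.
  have [t [t0 xt] te] := inf_adherent e0 hA.
  have [k /=] := ltr_add_invr (Lpos t t0); rewrite add0r => kt.
  exists k => // n /= kn.
  have Ht : hitting f (X^~ w) (L^~ w) (eta n) t.
    split => //; split => //; apply: le_trans (ltW kt).
    by rewrite lef_pV2 ?posrE // ler_nat.
  have ut : u n <= t.
    have := barrier_time_hit Ht; rewrite -/(S n w).
    by have [v _ Sv] := HS n; rewrite /u Sv lee_fin.
  by rewrite ltr_norml; have := Au n; lra.
have cl : continuous (fun t => L t w) := path_lcont xl.
exact: (@cvg_comp _ _ _ u (fun t => L t w) _ _ _ cu (cl (inf A))).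
Qed.

Let mLS n : measurable_fun setT (LS n).
Proof. exact: (measurable_at_barrier (eta0 n) fhomo fpos). Qed.

Lemma measurable_first_hit : measurable_fun setT L0.
Proof.
have mgood : measurable (~` bad) by apply: measurableC; exact: hP.
have mL : measurable_fun setT (fun w => L0 w * \1_(~` bad) w).
  apply: (@measurable_fun_cvg _ _ _ setT (fun n w => LS n w * \1_(~` bad) w)).
    by move=> n; apply: measurable_funM; [exact: mLS|exact: measurable_indic].
  move=> w _; have [wb|wb] := pselect (bad w).
    have -> : \1_(~` bad) w = 0 :> R by rewrite indicE memNset.
    by rewrite mulr0; apply: cvg_near_cst; apply: nearW => n; rewrite mulr0.
  by apply: cvgMr_tmp; have [] := good_limit wb.
apply/measurable_EFinP.
apply: (ae_measurable_fun hP (f := EFin \o (fun w => L0 w * \1_(~` bad) w))).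
  apply: negligibleS bad_negligible => w /= h; apply: contrapT => nb; apply: h => _.
  by rewrite indicE mem_set // mulr1.
exact/measurable_EFinP.
Qed.

Let mbool (Y : T -> R) v : measurable_fun setT Y -> measurable_fun setT (fun w => (v <= Y w)%R%:R : R).
Proof. by move=> mY; apply: (intg_measurable (P := P)); apply: intg_bool; exact: measurable_level. Qed.

(** The indicator of [v <= y] passes to the limit in spite of its jump because [LS n] approaches
    [L0] from above. *)
Let cvg_tail v : (fun n => mean (fun w => (v <= LS n w)%R%:R)) @ \oo -->
  mean (fun w => (v <= L0 w)%R%:R).
Proof.
have [] // := @dominated_mean_ae _ _ _ P (fun n w => (v <= LS n w)%R%:R)
  (fun w => (v <= L0 w)%R%:R) (fun=> 1).
- by move=> n; exact: mbool.
- exact/mbool/measurable_first_hit.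
- apply: negligibleS bad_negligible => w /= h; apply: contrapT => /good_limit[L0LS cL].
  apply: h; apply: cvg_near_cst; have [vL|Lv] := leP v (L0 w).
    by apply: nearW => n; rewrite (le_trans vL (L0LS n)).
  have : \forall n \near \oo, LS n w < v by exact: (cvgr_lt _ cL).
  by apply: filterS => n h; rewrite leNgt h.
- exact: intg_cst.
- by move=> n w; rewrite ger0_norm // lern1 leq_b1.
Qed.

Let cvg_min_mean v : 0 <= v -> (fun n => mean (fun w => Num.min (LS n w) v)) @ \oo -->
  mean (fun w => Num.min (L0 w) v).
Proof.
move=> v0; have [] // := @dominated_mean_ae _ _ _ P (fun n w => Num.min (LS n w) v)
  (fun w => Num.min (L0 w) v) (fun=> v).
- by move=> n; apply: measurable_minr => //; exact: measurable_cst.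
- by apply: measurable_minr; [exact: measurable_first_hit|exact: measurable_cst].
- apply: negligibleS bad_negligible => w /= h; apply: contrapT => /good_limit[_ cL].
  by apply: h; exact: cvg_minc.
- exact: intg_cst.
- move=> n w; rewrite ger0_norm ?ge_min ?lexx ?orbT // le_min v0 andbT.
  exact: at_barrier_ge0.
Qed.

Lemma first_hit_hazard (v v' x : R) : 0 <= v -> v <= v' -> 0 <= x ->
  (forall u, 0 < u -> v <= u -> x <= f u) ->
  x * (mean (fun w => (v <= L0 w)%R%:R) - mean (fun w => (v' <= L0 w)%R%:R)) <=
  mean (fun w => Num.min (L0 w) v') - mean (fun w => Num.min (L0 w) v).
Proof.
move=> v0 vv' x0 xf; have v'0 := le_trans v0 vv'.
have c1 : (fun n => x * (mean (fun w => (v <= LS n w)%R%:R) -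
      mean (fun w => (v' <= LS n w)%R%:R))) @ \oo -->
    x * (mean (fun w => (v <= L0 w)%R%:R) - mean (fun w => (v' <= L0 w)%R%:R)).
  by apply: cvgMl_tmp; apply: cvgB; exact: cvg_tail.
have c2 : (fun n => mean (fun w => Num.min (LS n w) v') -
      mean (fun w => Num.min (LS n w) v)) @ \oo -->
    mean (fun w => Num.min (L0 w) v') - mean (fun w => Num.min (L0 w) v).
  by apply: cvgB; exact: cvg_min_mean.
apply: (ler_cvg_to c1 c2).
apply: nearW => n; apply: (barrier_hazard (eta0 n) fhomo fpos (S_null n)) => //.
by apply: xf; rewrite ?lt_max ?eta0 ?orbT // le_max lexx.
Qed.

Lemma first_hit_tail (v c : R) :
  (forall n, c <= mean (fun w => (v <= at_time L (barrier_time f n.+1%:R^-1) w)%R%:R)) ->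
  c <= mean (fun w => (v <= L0 w)%R%:R).
Proof.
move=> h; have c1 := @cvg_tail v.
rewrite -(cvg_lim _ c1) //; apply: limr_ge; last exact: nearW.
by apply/cvg_ex; eexists; exact: c1.
Qed.

Lemma first_hit_ge0 w : 0 <= L0 w. Proof. exact: (L_ge0 XL). Qed.

End barrier_from_zero.
End barrier_time.

(** * Tails and the dual Hardy-Littlewood function *)

Section tail_function.
Context {R : realType}.
Variable m : probability (measurableTypeR R) R.
Hypothesis hm1 : (\int[m]_(x in `[0%R, +oo[) x%:E < +oo)%E.

Local Notation mean X := (Rintegral m setT X).
Local Notation intg X := (m.-integrable setT (EFin \o X)).

Lemma measurable_itvb (a : R) : measurable [set z : measurableTypeR R | a <= z].
Proof.
rewrite (_ : [set _ | _] = `[a, +oo[%classic); first exact: measurable_itv.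
by apply/seteqP; split => z /=; rewrite in_itv /= andbT.
Qed.

Lemma tailE a : tail m a = mean (fun z => (a <= z)%R%:R).
Proof.
rewrite (@mean_bool _ _ _ m (fun z => a <= z)); last exact: measurable_itvb.
by congr (fine (m _)); apply/seteqP; split => z /=; rewrite in_itv /= andbT.
Qed.

Lemma intg_above a : intg (fun z => (a <= z)%R%:R).
Proof. apply: intg_bool; exact: measurable_itvb. Qed.

Lemma tail_ge0 a : 0 <= tail m a. Proof. by rewrite /tail fine_ge0. Qed.

Lemma tail_homo : {homo tail m : a b /~ a <= b}.
Proof.
move=> a b ab; rewrite !tailE; apply: le_mean; [exact: intg_above..|] => z.
by case: (leP a) => // bz; rewrite (le_trans ab bz).
Qed.

Lemma tail_le1 a : tail m a <= 1.
Proof.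
rewrite tailE -[leRHS](mean_cst m); apply: le_mean.
- exact: intg_above.
- exact: intg_cst.
- by move=> z; rewrite lern1 leq_b1.
Qed.

Lemma tail_left_continuous (u : nat -> R) a : u @ \oo --> a -> (forall n, u n <= a) ->
  (fun n => tail m (u n)) @ \oo --> tail m a.
Proof.
move=> ua ule; rewrite tailE; under eq_fun do rewrite tailE.
have [] // := @dominated_mean _ _ _ m (fun n z => (u n <= z)%R%:R)
  (fun z => (a <= z)%R%:R) (fun=> 1).
- by move=> n; exact: intg_measurable (intg_above _).
- move=> z; apply: cvg_near_cst; have [az|za] := leP a z.
    by apply: nearW => n; rewrite (le_trans (ule n) az).
  have : \forall n \near \oo, z < u n by exact: (cvgr_gt _ ua).
  by apply: filterS => n h; rewrite leNgt h.
- exact: intg_cst.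
- by move=> n z; rewrite ger0_norm // lern1 leq_b1.
Qed.

Lemma tail_leftE a : tail_left m a = tail m a.
Proof.
rewrite /tail_left; apply: cvg_lim => //; apply/cvgrPdist_le => e e0.
have un : (fun n : nat => a - n.+1%:R^-1) @ \oo --> a.
  rewrite -[X in _ --> X]subr0; apply: cvgB; first exact: cvg_cst.
  exact: cvg_harmonic.
have ule (n : nat) : a - n.+1%:R^-1 <= a by rewrite gerBl invr_ge0.
have /cvgrPdist_le/(_ e e0)[n _ /(_ n (leqnn n)) /= hn] := tail_left_continuous un ule.
near=> t; rewrite distrC ger0_norm ?subr_ge0; last by apply: tail_homo; near: t; exact: nbhs_left_le.
move: hn; rewrite distrC ger0_norm ?subr_ge0; last exact: tail_homo.
apply: le_trans; rewrite lerD2r; apply: tail_homo.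
by near: t; apply: nbhs_left_ge; rewrite gtrBl invr_gt0.
Unshelve. all: by end_near. Qed.

Lemma tail_right_bounds a b : a < b -> tail m b <= tail_right m a <= tail m a.
Proof.
move=> ab; have c : cvg (tail m t @[t --> a^'+]).
  apply: nonincreasing_at_right_is_cvgr.
    by apply: nearW => t u v _ _; exact: tail_homo.
  by apply: nearW => t; exists 1 => _ [u _ <-]; exact: tail_le1.
apply/andP; split.
  apply: limr_ge => //; near=> t; apply: tail_homo; near: t; exact: nbhs_right_le.
apply: limr_le => //; near=> t; apply: tail_homo; near: t; exact: nbhs_right_ge.
Unshelve. all: by end_near. Qed.

(* [Psi] is the left limit of the dual Hardy-Littlewood function: an atom of [m]
   at [a] does not count. *)
Definition HL_weight a z : R := z / tail m z * (0 <= z < a)%R%:R.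
Definition Psi a : R := mean (HL_weight a).

Lemma weight_le a z : 0 <= a -> 0 < tail m a -> 0 <= HL_weight a z <= a / tail m a.
Proof.
move=> a0 ta; rewrite /HL_weight; have [/andP[z0 za]|h] := boolP (0 <= z < a).
  rewrite mulr1; have tz : 0 < tail m z by apply: lt_le_trans ta _; apply: tail_homo; exact: ltW.
  rewrite divr_ge0 ?tail_ge0 //=; apply: ler_pM => //; first by rewrite invr_ge0 tail_ge0.
    exact: ltW.
  by rewrite lef_pV2 ?posrE //; apply: tail_homo; exact: ltW.
by rewrite mulr0 lexx /= divr_ge0 // tail_ge0.
Qed.

Lemma measurable_between (a b : R) :
  measurable [set z : measurableTypeR R | a <= z < b].
Proof.
rewrite (_ : [set _ | _] = `[a, b[%classic); first exact: measurable_itv.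
by apply/seteqP; split => z /=; rewrite in_itv.
Qed.

Lemma intg_between (a b : R) : intg (fun z => (a <= z < b)%R%:R).
Proof. apply: intg_bool; exact: measurable_between. Qed.

Lemma mean_between_tail (a b : R) : a <= b ->
  mean (fun z => (a <= z < b)%R%:R) = tail m a - tail m b.
Proof.
move=> ab; rewrite !tailE -meanB; [|exact: intg_above..].
apply: eq_Rintegral => z _; have [bz|zb] := leP b z.
  by rewrite andbF (le_trans ab bz) subrr.
by rewrite andbT subr0.
Qed.

Lemma intg_weight a : 0 <= a -> 0 < tail m a -> intg (HL_weight a).
Proof.
move=> a0 ta; apply: (@intg_bounded _ _ _ m _ (a / tail m a)); last first.
  by move=> z; have /andP[w0 wa] := weight_le z a0 ta; rewrite ger0_norm.
have -> : HL_weight a = fun z => z * (tail m (Num.min z a))^-1 * (0 <= z < a)%R%:R.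
  apply/funext => z; rewrite /HL_weight; have [/andP[z0 za]|_] := boolP (0 <= z < a).
    by rewrite min_l // ltW.
  by rewrite !mulr0.
apply: measurable_funM; last exact: intg_measurable (intg_between 0 a).
apply: measurable_funM => //.
apply: nondecreasing_measurable => // u v uv.
have pos w : 0 < tail m (Num.min w a).
  by apply: lt_le_trans ta _; apply: tail_homo; rewrite ge_min lexx orbT.
rewrite lef_pV2 ?posrE //; apply: tail_homo.
by rewrite le_min !ge_min lexx uv /= orbT.
Qed.

Lemma Psi_ge0 a : 0 <= a -> 0 < tail m a -> 0 <= Psi a.
Proof. by move=> a0 ta; apply: mean_ge0 => z; have /andP[] := weight_le z a0 ta. Qed.

Lemma Psi_le a : 0 <= a -> 0 < tail m a -> Psi a <= a / tail m a.
Proof.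
move=> a0 ta; rewrite -[leRHS](mean_cst m); apply: le_mean.
- exact: intg_weight.
- exact: intg_cst.
- by move=> z; have /andP[] := weight_le z a0 ta.
Qed.

Lemma mean_weight_between a b : 0 <= a -> a <= b -> 0 < tail m b ->
  intg (fun z => z / tail m z * (a <= z < b)%R%:R) /\
  mean (fun z => z / tail m z * (a <= z < b)%R%:R) = Psi b - Psi a.
Proof.
move=> a0 ab tb; have b0 := le_trans a0 ab.
have ta : 0 < tail m a by apply: lt_le_trans tb _; exact: tail_homo.
have E : (fun z => z / tail m z * (a <= z < b)%R%:R) =
    fun z => HL_weight b z - HL_weight a z.
  apply/funext => z; rewrite /HL_weight -mulrBr; congr (_ * _).
  have [az|za] := leP a z; last first.
    by rewrite (lt_le_trans za ab) /= !andbT subrr.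
  by rewrite andbF subr0 (le_trans a0 az).
rewrite E; split; first by apply: intgB; exact: intg_weight.
by rewrite meanB //; exact: intg_weight.
Qed.

Lemma Psi_homo a b : 0 <= a -> a <= b -> 0 < tail m b -> Psi a <= Psi b.
Proof.
move=> a0 ab tb; have [_ E] := mean_weight_between a0 ab tb.
rewrite -subr_ge0 -E; apply: mean_ge0 => z.
have [/andP[az zb]|_] := boolP (a <= z < b); last by rewrite mulr0.
by rewrite mulr1 divr_ge0 ?tail_ge0 // (le_trans a0).
Qed.

Lemma find_cell (t : nat -> R) n z : t 0 <= z < t n ->
  exists2 i, (i < n)%N & t i <= z < t i.+1.
Proof.
elim: n => [|n IH] /andP[tz zt]; first by have := le_lt_trans tz zt; rewrite ltxx.
have [zn|nz] := ltP z (t n); last by exists n => //; rewrite nz.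
by have [|i ni it] := IH; [rewrite tz|exists i => //; exact: ltnW].
Qed.

(** * Comparison of a survival function with the tail along [Psi] *)

Section survival.
Variables (s : R -> R) (eta : R).
Hypothesis eta0 : 0 < eta.
Hypothesis s01 : forall l, 0 <= s l <= 1.
Hypothesis s_start : forall l, l <= eta -> s l = 1.
Hypothesis s_hazard : forall x v v', 0 < x -> 0 < tail m x -> Psi x <= v -> v <= v' ->
  x * (s v - s v') <= (v' - v) * s v.

Variables (a b : R).
Hypothesis a0 : 0 < a.
Hypothesis ab : a < b.
Hypothesis tb : 0 < tail m b.

Let t n i : R := a + (b - a) * i%:R / n.+1%:R.
(** On cell [i] the hazard inequality lets [s] lose at most the first fraction, while the tail loses
    exactly the second one; [e n i] is the discrepancy. *)
Let e n i : R := (Psi (t n i.+1) - Psi (t n i)) / t n i -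
  (tail m (t n i) - tail m (t n i.+1)) / tail m (t n i).

Let tS n i : t n i.+1 = t n i + (b - a) / n.+1%:R.
Proof. by rewrite /t -natr1 mulrDr mulr1 mulrDl addrA. Qed.

Let h0 n : 0 < (b - a) / n.+1%:R.
Proof. by rewrite divr_gt0 // subr_gt0. Qed.

Let t0 n : t n 0 = a. Proof. by rewrite /t mulr0 mul0r addr0. Qed.

Let tn n : t n n.+1 = b. Proof. by rewrite /t mulfK // addrC subrK. Qed.

Let t_lt n i : t n i < t n i.+1. Proof. by rewrite tS ltrDl. Qed.

Let t_ge n i : a <= t n i.
Proof. by elim: i => [|i /le_trans]; [rewrite t0|apply; exact: ltW]. Qed.

Let t_gt0 n i : 0 < t n i. Proof. exact: lt_le_trans (t_ge n i). Qed.

Let t_le n i : (i <= n.+1)%N -> t n i <= b.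
Proof.
move=> ni; rewrite -(tn n) /t lerD2l ler_pM2r ?invr_gt0 //.
by rewrite ler_pM2l ?subr_gt0 // ler_nat.
Qed.

Let tail_pos n i : (i <= n.+1)%N -> 0 < tail m (t n i).
Proof. by move=> /t_le ti; apply: lt_le_trans tb _; exact: tail_homo. Qed.

(** The hazard inequality reads [s1 >= s0 * (T' / T - e n i)]; after division by [T'] the error is
    at most [e n i / tail m b], since [s0 <= 1] and [T' >= tail m b]. *)
Let survival_step n i : (i <= n)%N -> 0 <= e n i ->
  s (Psi (t n i)) / tail m (t n i) - e n i / tail m b <=
  s (Psi (t n i.+1)) / tail m (t n i.+1).
Proof.
move=> ni e0; have T0 : 0 < tail m (t n i) by apply: tail_pos; exact: leqW.
have T1 : 0 < tail m (t n i.+1) by exact: tail_pos.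
have PP : Psi (t n i) <= Psi (t n i.+1) by apply: Psi_homo => //; exact: ltW.
have hz := s_hazard (t_gt0 n i) T0 (lexx _) PP.
have bT : tail m b <= tail m (t n i.+1) by apply/tail_homo/t_le.
have /andP[s0p s0l] := s01 (Psi (t n i)).
move: (t_gt0 n i) T0 T1 bT hz s0p s0l e0; rewrite /e.
move: (s (Psi (t n i))) (s (Psi (t n i.+1))) => s0 s1.
move: (Psi (t n i)) (Psi (t n i.+1)) => p p'.
move: (tail m (t n i)) (tail m (t n i.+1)) => T T'; move: (t n i) => x.
move=> x0 T0 T1 bT hz s0p s0l e0.
have s1_ge : s0 * (T' / T) - s0 * ((p' - p) / x - (T - T') / T) <= s1.
  have -> : s0 * (T' / T) - s0 * ((p' - p) / x - (T - T') / T) = s0 - (p' - p) * s0 / x.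
    by field; rewrite !lt0r_neq0.
  by rewrite lerBlDr -lerBlDl ler_pdivlMr // [leLHS]mulrC.
rewrite ler_pdivlMr // mulrBl; apply: le_trans s1_ge.
rewrite (mulrAC s0) -mulrA lerB //.
move: e0; set e1 := (p' - p) / x - _ => e0.
apply: (@le_trans _ _ e1); first by rewrite ler_piMl.
by rewrite mulrAC ler_pdivlMr // ler_wpM2l.
Qed.

(** The density of the discrepancy [e n i] with respect to [m]: it compares [z / tail m z], the
    integrand of [Psi], with its value at the left end of the cell. *)
Let cell n i (z : R) : R :=
  (z / tail m z / t n i - (tail m (t n i))^-1) * (t n i <= z < t n i.+1)%R%:R.

Let g n z : R := \sum_(i < n.+1) cell n i z.

Let cell_ge0 n i z : (i <= n)%N ->
  0 <= cell n i z <= b / a / tail m b.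
Proof.
move=> ni; rewrite /cell; have K0 : 0 <= b / a / tail m b.
  by rewrite divr_ge0 ?tail_ge0 // divr_ge0 ?(ltW a0) // ltW // (lt_trans a0).
have [/andP[tz zt]|_] := boolP (t n i <= z < t n i.+1); last by rewrite mulr0 lexx.
rewrite mulr1; have z0 := lt_le_trans (t_gt0 n i) tz.
have zb : z <= b by apply: le_trans (ltW zt) (t_le _).
have Tz : 0 < tail m z by apply: lt_le_trans tb _; exact: tail_homo.
have Tt : 0 < tail m (t n i) by apply: tail_pos; exact: leqW.
have -> : z / tail m z / t n i = z / t n i / tail m z by rewrite mulrAC.
apply/andP; split.
  rewrite subr_ge0; apply: (@le_trans _ _ (tail m z)^-1).
    by rewrite lef_pV2 ?posrE //; exact: tail_homo.
  by rewrite ler_peMl ?invr_ge0 ?tail_ge0 // ler_pdivlMr // mul1r.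
apply: (@le_trans _ _ (z / t n i / tail m z)); first by rewrite gerBl invr_ge0 ltW.
apply: ler_pM; rewrite ?invr_ge0 ?tail_ge0 ?divr_ge0 ?(ltW z0) ?(ltW (t_gt0 _ _)) //.
  apply: ler_pM; rewrite ?invr_ge0 ?(ltW z0) ?(ltW (t_gt0 _ _)) //.
  by rewrite lef_pV2 ?posrE.
by rewrite lef_pV2 ?posrE //; exact: tail_homo.
Qed.

Let cell_mean n i : (i <= n)%N ->
  intg (cell n i) /\ mean (cell n i) = e n i.
Proof.
move=> ni; have T1 : 0 < tail m (t n i.+1) by exact: tail_pos.
have [iw Ew] := mean_weight_between (ltW (t_gt0 n i)) (ltW (t_lt n i)) T1.
have Ei := mean_between_tail (ltW (t_lt n i)); have ii := intg_between (t n i) (t n i.+1).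
have E : cell n i =
   fun z => (t n i)^-1 * (z / tail m z * (t n i <= z < t n i.+1)%R%:R) -
     (tail m (t n i))^-1 * (t n i <= z < t n i.+1)%R%:R.
  by apply/funext => z; rewrite /cell mulrBl; congr (_ - _); rewrite [RHS]mulrC mulrAC.
rewrite E; split; first by apply: intgB; exact: intgZ.
by rewrite meanB; [|exact: intgZ..]; rewrite !meanZ // Ew Ei /e ![_^-1 * _]mulrC.
Qed.

Let e_ge0 n i : (i <= n)%N -> 0 <= e n i.
Proof.
move=> ni; have [_ <-] := cell_mean ni; apply: mean_ge0 => z.
by have /andP[] := cell_ge0 z ni.
Qed.

Let g_cell n z : a <= z < b -> exists i, [/\ (i <= n)%N, t n i <= z < t n i.+1 &
  g n z = z / tail m z / t n i - (tail m (t n i))^-1].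
Proof.
rewrite -(t0 n) -(tn n) => /find_cell[i ni iz]; exists i; split => //.
rewrite /g (bigD1 (Ordinal ni)) //= {1}/cell iz mulr1 big1 ?addr0 // => -[k kn] /=.
rewrite -val_eqE /= => ki; rewrite /cell (_ : t n k <= z < _ = false) ?mulr0 //.
apply/negbTE/negP => /andP[kz zk]; case/andP: iz => iz zi.
have tmono u v : (u <= v)%N -> t n u <= t n v.
  by move=> /subnK <-; elim: (v - u)%N => // w IH; rewrite addSn (le_trans IH) // ltW.
move: ki; rewrite neq_ltn => /orP[/tmono h|/tmono h].
  by have := lt_le_trans zk h; rewrite ltNge iz.
by have := lt_le_trans zi h; rewrite ltNge kz.
Qed.

Let g_out n z : ~~ (a <= z < b) -> g n z = 0.
Proof.
move=> h; rewrite /g big1 // => -[i ni] _ /=.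
rewrite /cell (_ : t n i <= z < _ = false) ?mulr0 //.
apply/negbTE; apply: contra h => /andP[iz zi].
by rewrite (le_trans (t_ge n i) iz) (lt_le_trans zi) // t_le.
Qed.

(** The left end of the cell containing [z] tends to [z] from below, and the tail is continuous from
    the left, so the density vanishes in the limit even where [m] has an atom. *)
Let g_cvg z : (fun n => g n z) @ \oo --> 0.
Proof.
have [zab|h] := boolP (a <= z < b); last first.
  by apply: cvg_near_cst; apply: nearW => n; exact: g_out.
have [i iP] := choice (fun n => g_cell n zab).
pose u n := t n (i n); have u0 n : 0 < u n by exact: t_gt0.
have uz n : u n <= z by have [_ /andP[]] := iP n.
have cu : u @ \oo --> z.
  apply: (@squeeze_cvgr _ _ _ _ (fun n => z - (b - a) * n.+1%:R^-1) (fun=> z)).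
  - apply: nearW => n; rewrite uz andbT lerBlDr -tS.
    by have [_ /andP[_ /ltW]] := iP n.
  - rewrite -[X in _ --> X]subr0 -(mulr0 (b - a)); apply: cvgB; first exact: cvg_cst.
    by apply: cvgMl_tmp; exact: cvg_harmonic.
  - exact: cvg_cst.
have [az zb] := andP zab; have z0 := lt_le_trans a0 az.
have Tz : 0 < tail m z by apply: lt_le_trans tb _; apply: tail_homo; exact: ltW.
have -> : (fun n => g n z) = (fun n => z / tail m z * (u n)^-1 - (tail m (u n))^-1).
  by apply/funext => n; have [_ _ ->] := iP n.
rewrite [X in _ --> X](_ : _ = z / tail m z * z^-1 - (tail m z)^-1); last first.
  by rewrite mulrAC divff ?mul1r ?subrr // lt0r_neq0.
apply: cvgB; last by apply: cvgV; [exact: lt0r_neq0|exact: tail_left_continuous].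
by apply: cvgMl_tmp; apply: cvgV => //; exact: lt0r_neq0.
Qed.

Let mean_g : (fun n => \sum_(i < n.+1) e n i) @ \oo --> 0.
Proof.
rewrite -[X in _ --> X](mean_cst m).
have -> : (fun n => \sum_(i < n.+1) e n i) = fun n => mean (g n).
  apply/funext => n; rewrite /g mean_sum.
    by apply: eq_bigr => -[i ni] _ /=; have [_ ->] := cell_mean (ni : (i <= n)%N).
  by move=> i ni; have [] := cell_mean (ni : (i <= n)%N).
have [] // := @dominated_mean _ _ _ m (fun n => g n) (fun=> 0) (fun=> b / a / tail m b).
- move=> n; apply: (intg_measurable (P := m)); apply: intg_sum => i ni.
  by have [] := cell_mean (ni : (i <= n)%N).
- exact: intg_cst.
- move=> n z; have [zab|h] := boolP (a <= z < b); last first.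
    by rewrite g_out // normr0 divr_ge0 ?tail_ge0 // divr_ge0 ?(ltW a0) // ltW // (lt_trans a0).
  have [i [ni iz ->]] := g_cell n zab.
  by have := cell_ge0 z ni; rewrite /cell iz mulr1 => /andP[? ?]; rewrite ger0_norm.
Qed.

Let survival_sum n i : (i <= n.+1)%N ->
  s (Psi a) / tail m a - (\sum_(k < i) e n k) / tail m b <= s (Psi (t n i)) / tail m (t n i).
Proof.
elim: i => [_|i IH ni]; first by rewrite big_ord0 mul0r subr0 t0.
have ni' : (i <= n)%N by [].
apply: le_trans _ (survival_step ni' (e_ge0 ni')); rewrite big_ord_recr /=.
by have := IH (ltnW ni); rewrite mulrDl; lra.
Qed.

Lemma survival_ratio : s (Psi a) / tail m a <= s (Psi b) / tail m b.
Proof.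
have c : (fun n => s (Psi a) / tail m a - (\sum_(k < n.+1) e n k) / tail m b) @ \oo -->
    s (Psi a) / tail m a - 0 / tail m b.
  by apply: cvgB; [exact: cvg_cst|apply: cvgMr_tmp; exact: mean_g].
rewrite mul0r subr0 in c; rewrite -(cvg_lim _ c) //.
apply: limr_le; first by apply/cvg_ex; eexists; exact: c.
by apply: nearW => n; rewrite -{2 3}(tn n); exact: survival_sum.
Qed.

End survival.

(* The ratio of [s o Psi] to the tail is nondecreasing: on a fine partition, the
   hazard inequality multiplies [s] by at least [1 - dPsi / x], whereas the
   tail is multiplied by [1 - dm / tail]. *)
Lemma tail_le_survival (s : R -> R) eta : 0 < eta -> (forall l, 0 <= s l <= 1) ->
  (forall l, l <= eta -> s l = 1) ->
  (forall x v v', 0 < x -> 0 < tail m x -> Psi x <= v -> v <= v' ->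
     x * (s v - s v') <= (v' - v) * s v) ->
  forall x, 0 < x -> 0 < tail m x -> tail m x <= s (Psi x).
Proof.
(* This starting point lies below [x] and satisfies [Psi a <= a / tail m a <= eta], so that
   [s (Psi a) = 1]. *)
move=> eta0 s01 s1 hz x x0 tx; pose a := Num.min (x / 2) (eta * tail m x).
have a0 : 0 < a by rewrite lt_min divr_gt0 //= mulr_gt0.
have ax : a < x by rewrite gt_min; apply/orP; left; lra.
have ta : 0 < tail m a by apply: lt_le_trans tx _; apply: tail_homo; exact: ltW.
have Pa : Psi a <= eta.
  apply: le_trans (Psi_le (ltW a0) ta) _; rewrite ler_pdivrMr //.
  apply: (@le_trans _ _ (eta * tail m x)); first by rewrite ge_min lexx orbT.
  by rewrite ler_pM2l //; apply: tail_homo; exact: ltW.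
have := survival_ratio s01 hz a0 ax tx; rewrite (s1 _ Pa) ler_pdivlMr //.
by apply: le_trans; rewrite ler_peMl ?(ltW tx) // div1r invf_ge1 // tail_le1.
Qed.

Lemma markov_tail : exists2 M, 0 < M & forall x, 0 <= x -> x * tail m x <= M.
Proof.
pose Z z : R := z * \1_(`[0, +oo[%classic : set R) z.
have Z0 z : 0 <= Z z.
  rewrite /Z indicE; have [|_] := boolP (_ \in _); last by rewrite mulr0.
  by rewrite inE /= in_itv /= andbT mulr1.
have iZ : intg Z.
  apply/integrableP; split.
    apply/measurable_EFinP; apply: measurable_funM; first exact: measurable_id.
    by apply: measurable_indic; exact: measurable_itv.
  under eq_integral do rewrite /= ger0_norm //.
  by move: hm1; rewrite (mean_set m (fun z => z)).
exists (mean Z + 1) => [|x x0]; first by rewrite ltr_wpDl ?mean_ge0.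
rewrite tailE -meanZ; last exact: intg_above.
apply: le_trans (_ : mean Z <= _); last by rewrite lerDl.
apply: le_mean; [exact/intgZ/intg_above|exact: iZ|] => z.
have [xz|_] := leP x z; last by rewrite mulr0.
by rewrite mulr1 /Z indicE mem_set ?mulr1 //= in_itv /= (le_trans x0 xz).
Qed.

(** The strict gap lets the left limit at [x] count the atom at [y], which [dual_HL m y] includes; a
    positive tail at [x] excludes the infinite branch at [y]. *)
Lemma dual_HL_le y x : 0 <= y -> y < x -> 0 < tail m x ->
  (dual_HL m y <= (Psi x)%:E)%E.
Proof.
move=> y0 yx tx; have x0 : 0 <= x by exact/ltW/(le_lt_trans y0).
rewrite /dual_HL; have /andP[tr _] := tail_right_bounds yx.
rewrite gt_eqF ?(lt_le_trans tx) //; case: ifP => _.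
  by rewrite lee_fin; exact: Psi_ge0.
rewrite (mean_set m (fun z => z / tail m z)).
have E z : z / tail m z * \1_(`[0, y]%classic : set R) z =
    HL_weight x z * \1_(`[0, y]%classic : set R) z.
  rewrite /HL_weight indicE; have [|_] := boolP (z \in _); last by rewrite !mulr0.
  by rewrite inE /= in_itv /= => /andP[-> zy]; rewrite (le_lt_trans zy yx) !mulr1.
have iW : intg (fun z => HL_weight x z * \1_(`[0, y]%classic : set R) z).
  by apply: intgM_indic; [exact: measurable_itv|exact: intg_weight].
under eq_integral do rewrite E.
rewrite EFin_mean // lee_fin; apply: le_mean => //; first exact: intg_weight.
move=> z; have /andP[w0 _] := weight_le z x0 tx.
by rewrite ler_piMr // indic_le1.
Qed.

Lemma Psi_le_dual_HL x : 0 <= x -> 0 < tail m x -> tail m x < 1 ->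
  ((Psi x)%:E <= dual_HL m x)%E.
Proof.
move=> x0 tx tx1; rewrite /dual_HL; case: ifP => _; first by rewrite leey.
rewrite tail_leftE lt_eqF //.
have -> : (Psi x)%:E = (\int[m]_(z in `[0%R, x[) (z / tail m z)%:E)%E.
  rewrite (mean_set m (fun z => z / tail m z)) -EFin_mean; last exact: intg_weight.
  apply: eq_integral => z _; congr (_%:E); rewrite /HL_weight indicE; congr (_ * _).
  by rewrite mem_setE.
have mw : measurable_fun (`[0, x]%classic : set (measurableTypeR R)) (fun z : R => (z / tail m z)%:E).
  apply/measurable_EFinP.
  apply: (@eq_measurable_fun _ _ (measurableTypeR R) (measurableTypeR R) _
    (fun z : R => z * (tail m (Num.min z x))^-1)).
    by move=> z; rewrite inE /= in_itv /= => /andP[_ zx]; rewrite min_l.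
  apply: measurable_funTS; apply: measurable_funM => //.
  apply: nondecreasing_measurable => // u v uv.
  have pos w : 0 < tail m (Num.min w x).
    by apply: lt_le_trans tx _; apply: tail_homo; rewrite ge_min lexx orbT.
  rewrite lef_pV2 ?posrE //; apply: tail_homo.
  by rewrite le_min !ge_min lexx uv /= orbT.
apply: ge0_subset_integral => //=.
  move=> z; rewrite /= in_itv /= => /andP[z0 zx].
  by rewrite lee_fin divr_ge0 // tail_ge0.
by move=> z; rewrite /= !in_itv /= => /andP[-> /ltW].
Qed.

Lemma dual_HL_inv_ge0 l : (0 <= dual_HL_inv m l)%E.
Proof. by apply: le_ereal_inf_tmp => _ [x [x0 _] <-]; rewrite lee_fin. Qed.

Lemma dual_HL_inv_homo l l' : l <= l' -> (dual_HL_inv m l <= dual_HL_inv m l')%E.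
Proof.
move=> ll'; apply: ereal_inf_le_tmp => _ [x [x0 lx] <-]; exists x => //; split => //.
by apply: le_lt_trans lx; rewrite lee_fin.
Qed.

Lemma dual_HL_inv_ge x l : 0 < tail m x -> Psi x <= l -> (x%:E <= dual_HL_inv m l)%E.
Proof.
move=> tx Px; apply: le_ereal_inf_tmp => _ [y [y0 ly] <-]; rewrite lee_fin leNgt.
apply/negP => yx; move: ly; rewrite ltNge => /negP; apply.
by apply: le_trans (dual_HL_le y0 yx tx) _; rewrite lee_fin.
Qed.

(* Otherwise the tail of [m] would decay slower than [1 / x], against [hm1]. *)
Lemma dual_HL_inv_linear a : exists2 l, a <= l & (dual_HL_inv m l <= (8 * l)%:E)%E.
Proof.
apply: contrapT => h.
have {}h l : a <= l -> ((8 * l)%:E < dual_HL_inv m l)%E.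
  by move=> al; rewrite ltNge; apply/negP => hl; apply: h; exists l.
have [M M0 markov] := markov_tail.
(* Beyond [8 * a] the contrary assumption applies to the level [x / 8]; beyond [M + 1] Markov's
   bound forces the tail below 1. *)
pose X0 := Num.max (8 * a) (M + 1).
have X0M : M + 1 <= X0 by rewrite le_max lexx orbT.
have X0a : 8 * a <= X0 by rewrite le_max lexx.
have facts x : X0 <= x -> 0 < tail m x /\ Psi x <= x / 8.
  move=> Xx; have x0 : 0 < x by lra.
  have HLx : (dual_HL m x <= (x / 8)%:E)%E.
    rewrite leNgt; apply/negP => hx.
    have ax : a <= x / 8 by lra.
    have := h _ ax; rewrite ltNge => /negP; apply; apply: ereal_inf_lbound.
    by exists x; [split => //; exact: ltW|congr EFin; field].
  have tx : 0 < tail m x.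
    rewrite lt_neqAle tail_ge0 andbT eq_sym; apply/eqP => t0.
    move: HLx; rewrite /dual_HL (_ : tail_right m x == 0) ?leye_eq //.
    have xx1 : x < x + 1 by rewrite ltrDl.
    have /andP[h1 h2] := tail_right_bounds xx1.
    by rewrite eq_le; apply/andP; split; [rewrite -t0|exact: le_trans (tail_ge0 _) h1].
  have tx1 : tail m x < 1.
    rewrite ltNge; apply/negP => t1; have := markov x (ltW x0).
    have : x <= x * tail m x by rewrite ler_peMr // ltW.
    by lra.
  split=> //; rewrite -lee_fin; apply: le_trans HLx; exact: Psi_le_dual_HL (ltW x0) tx tx1.
(* Over [[x, 2 x]] the increase of [Psi] is at least [x] times the relative loss of the tail and at
   most [2 x / 8], so the tail loses at most a quarter; this is where the constant 8 comes from. *)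
have decay x : X0 <= x -> 3 / 4 * tail m x <= tail m (2 * x).
  move=> Xx; have x0 : 0 < x by lra.
  have x2 : x <= 2 * x by lra.
  have [tx _] := facts _ Xx; have [tx2 P2] := facts _ (le_trans Xx x2).
  have [iw Ew] := mean_weight_between (ltW x0) x2 tx2.
  have lo : x / tail m x * (tail m x - tail m (2 * x)) <= Psi (2 * x) - Psi x.
    rewrite -Ew -mean_between_tail // -meanZ; last exact: intg_between.
    apply: le_mean => //; first exact/intgZ/intg_between.
    move=> z; have [/andP[xz z2]|_] := boolP (x <= z < 2 * x); last by rewrite !mulr0.
    rewrite !mulr1; apply: ler_pM => //; [exact: ltW|by rewrite invr_ge0 tail_ge0|].
    have tz : 0 < tail m z by apply: lt_le_trans tx2 _; apply: tail_homo; exact: ltW.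
    by rewrite lef_pV2 ?posrE //; exact: tail_homo.
  have Px := Psi_ge0 (ltW x0) tx.
  have : x / tail m x * (tail m x - tail m (2 * x)) <= x * (1 / 4) by lra.
  rewrite -mulrA ler_pM2l // mulrC ler_pdivrMr //; lra.
(* Each doubling of [y] multiplies [y * tail m y] by at least [2 * (3 / 4)], so it is unbounded,
   against Markov's bound. *)
have iter k : X0 <= 2 ^+ k * X0 /\ (3 / 2) ^+ k * (X0 * tail m X0) <= 2 ^+ k * X0 * tail m (2 ^+ k * X0).
  elim: k => [|k [IH1 IH2]]; first by rewrite !expr0 !mul1r.
  have X00 : 0 < X0 by lra.
  rewrite (_ : 2 ^+ k.+1 * X0 = 2 * (2 ^+ k * X0)); last by rewrite exprS -mulrA.
  rewrite (_ : (3 / 2) ^+ k.+1 * _ = 3 / 2 * ((3 / 2) ^+ k * (X0 * tail m X0))); last first.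
    by rewrite exprS -mulrA.
  have := decay _ IH1; move: (2 ^+ k * X0) IH1 IH2 => y IH1 IH2.
  have y0 : 0 < y by lra.
  move=> dec; have h1 : y * (3 / 4 * tail m y) <= y * tail m (2 * y) by rewrite ler_pM2l.
  split; lra.
have grow k : 1 + k%:R / 2 <= (3 / 2 : R) ^+ k.
  elim: k => [|k IH]; first by rewrite mul0r addr0 expr0.
  rewrite exprS -natr1; have := ler0n R k; lra.
have [tX _] := facts X0 (lexx _).
have X00 : 0 < X0 by lra.
have c0 : 0 < X0 * tail m X0 by rewrite mulr_gt0.
pose k := Num.trunc (2 * (M / (X0 * tail m X0))).
have Mk : M < (1 + k.+1%:R / 2) * (X0 * tail m X0).
  rewrite -ltr_pdivrMr //; have := truncnS_gt (2 * (M / (X0 * tail m X0))).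
  rewrite -/k; lra.
have [Xk hk] := iter k.+1.
have := markov (2 ^+ k.+1 * X0) (le_trans (ltW X00) Xk).
have : (1 + k.+1%:R / 2) * (X0 * tail m X0) <= (3 / 2) ^+ k.+1 * (X0 * tail m X0).
  by rewrite ler_pM2r.
by move: Mk hk; lra.
Qed.

Definition HL_barrier l : R := fine (dual_HL_inv m l).

Lemma HL_barrierE l : (HL_barrier l)%:E = dual_HL_inv m l.
Proof.
rewrite /HL_barrier fineK // ge0_fin_numE ?dual_HL_inv_ge0 //.
have [l' ll' hl'] := dual_HL_inv_linear l.
exact: le_lt_trans (dual_HL_inv_homo ll') (le_lt_trans hl' (ltry _)).
Qed.

Lemma HL_barrier_homo : {homo HL_barrier : x y / x <= y}.
Proof. by move=> x y xy; rewrite -lee_fin !HL_barrierE; exact: dual_HL_inv_homo. Qed.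

Lemma HL_barrier_ge x l : 0 < tail m x -> Psi x <= l -> x <= HL_barrier l.
Proof. by move=> tx Px; rewrite -lee_fin HL_barrierE; exact: dual_HL_inv_ge. Qed.

Lemma HL_barrier_gt0 x0 : 0 < x0 -> 0 < tail m x0 -> forall l, 0 < l -> 0 < HL_barrier l.
Proof.
move=> x00 tx0 l l0; pose x := Num.min x0 (l * tail m x0).
have xp : 0 < x by rewrite lt_min x00 mulr_gt0.
have xx0 : x <= x0 by rewrite ge_min lexx.
have tx : tail m x0 <= tail m x by exact: tail_homo.
apply: (lt_le_trans xp); apply: HL_barrier_ge; first exact: lt_le_trans tx.
apply: le_trans (Psi_le (ltW xp) (lt_le_trans tx0 tx)) _.
rewrite ler_pdivrMr ?(lt_le_trans tx0) //.
apply: (@le_trans _ _ (l * tail m x0)); first by rewrite ge_min lexx orbT.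
by rewrite ler_pM2l.
Qed.

(** The form of linear growth that finiteness of the barrier time asks for, with 16 obtained as
    [8 * l] at [l = 2 * b]. *)
Lemma HL_barrier_linear a : exists2 b, a <= b & HL_barrier (2 * b) <= 16 * b.
Proof.
have [l al hl] := dual_HL_inv_linear (2 * a); exists (l / 2); first by lra.
have -> : 2 * (l / 2) = l by field.
by rewrite -lee_fin HL_barrierE; apply: le_trans hl _; rewrite lee_fin; lra.
Qed.

End tail_function.

(** * Excesses and slices of the tail *)

Section first_hit_excess.
Context {d : measure_display} {T : measurableType d} {R : realType}.
Variable P : probability T R.
Variables (F : R -> set (set T)) (X L : R -> T -> R).

Local Notation mean X := (Rintegral P setT X).
Local Notation intg X := (P.-integrable setT (EFin \o X)).

Hypothesis XL : reflected_pair P F X L.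
Hypothesis X_null : forall t, 0 < t -> P [set w | X t w <= 0] = 0%E.
Hypothesis X_large : forall K e : R, 0 < e -> exists2 t, 0 < t &
  fine (P [set w | X t w <= K]) <= e.
Hypothesis hP : measure_is_complete P.

Variable m : probability (measurableTypeR R) R.
Hypothesis hm1 : (\int[m]_(x in `[0%R, +oo[) x%:E < +oo)%E.
Variable x0 : R.
Hypothesis x0_gt0 : 0 < x0.
Hypothesis tail_x0 : 0 < tail m x0.

Let f := HL_barrier m.
Let fhomo : {homo f : x y / x <= y}. Proof. exact: (HL_barrier_homo hm1). Qed.
Let fpos v : 0 < v -> 0 < f v. Proof. exact: (HL_barrier_gt0 hm1 x0_gt0 tail_x0). Qed.
Let C0 : 0 < 16 :> R. Proof. by []. Qed.
Let f_linear a : exists2 b, a <= b & f (2 * b) <= 16 * b.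
Proof. exact: (HL_barrier_linear hm1). Qed.

Let L0 := at_time L (first_hit X L f).
Let s v := mean (fun w => (v <= L0 w)%R%:R).

Let mL0 : measurable_fun setT L0.
Proof. exact: (measurable_first_hit XL X_null X_large fhomo fpos C0 f_linear hP). Qed.

Let L0_ge0 w : 0 <= L0 w. Proof. exact: (first_hit_ge0 XL). Qed.

Let min_gap (Y : T -> R) (v v' : R) : measurable_fun setT Y -> (forall w, 0 <= Y w) ->
  0 <= v -> v <= v' ->
  mean (fun w => Num.min (Y w) v') - mean (fun w => Num.min (Y w) v) <=
  (v' - v) * mean (fun w => (v <= Y w)%R%:R).
Proof.
move=> mY Y0 v0 vv'; have v'0 := le_trans v0 vv'.
have imin u : 0 <= u -> intg (fun w => Num.min (Y w) u).
  move=> u0; apply: (@intg_bounded _ _ _ P _ u).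
    by apply: measurable_minr => //; exact: measurable_cst.
  by move=> w; rewrite ger0_norm ?ge_min ?lexx ?orbT // le_min Y0.
have ib : intg (fun w => (v <= Y w)%R%:R) by apply: intg_bool; exact: measurable_level.
rewrite -meanB; [|exact: imin..]; rewrite -meanZ //.
apply: le_mean; [by apply: intgB; exact: imin|exact: intgZ|] => w.
have [vY|Yv] := leP v (Y w).
  rewrite mulr1; apply: lerB; last by [].
  by rewrite ge_min lexx orbT.
by rewrite mulr0 min_l ?subrr // ltW // (lt_le_trans Yv).
Qed.

(** The comparison needs an initial interval of levels on which survival is 1. It is therefore made
    for the barrier time from each level [n.+1%:R^-1], and only its conclusion, free of that level,
    passes to the limit. *)
Lemma tail_le_first_hit x : 0 < x -> 0 < tail m x -> tail m x <= s (Psi m x).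
Proof.
move=> xp tx; apply: (first_hit_tail XL X_null X_large fhomo fpos C0 f_linear hP) => n.
have e0 : 0 < n.+1%:R^-1 :> R by rewrite invr_gt0.
have S_null := barrier_time_null XL X_large e0 fhomo fpos C0 f_linear.
have mLS := measurable_at_barrier XL e0 fhomo fpos.
have iB v : intg (fun w => (v <= at_time L (barrier_time X L f n.+1%:R^-1) w)%R%:R).
  by apply: intg_bool; exact: measurable_level.
pose sn v := mean (fun w => (v <= at_time L (barrier_time X L f n.+1%:R^-1) w)%R%:R).
apply: (@tail_le_survival _ m sn _ e0 _ _ _ _ xp tx) => [v|v|y v v' y0 ty Pv vv'].
- rewrite mean_ge0 //= -[leRHS](mean_cst P); apply: le_mean => //.
    exact: intg_cst.
  by move=> w; rewrite lern1 leq_b1.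
- exact: (at_barrier_start XL e0 fhomo fpos S_null).
- have v0 : 0 <= v by apply: le_trans Pv; apply: Psi_ge0 => //; exact: ltW.
  apply: le_trans (min_gap mLS _ v0 vv'); last by move=> w; exact: (at_barrier_ge0 XL).
  apply: (barrier_hazard XL e0 fhomo fpos S_null v0 vv' (ltW y0)).
  by apply: (HL_barrier_ge hm1 ty); rewrite le_max Pv.
Qed.

Lemma measurable_excess (Y : T -> R) c : measurable_fun setT Y ->
  measurable_fun setT (fun w => maxe ((Y w)%:E - c%:E) 0)%E.
Proof.
move=> mY; rewrite (_ : (fun _ => _) = EFin \o (fun w => Num.max (Y w - c) 0)).
  apply/measurable_EFinP; apply: measurable_maxr; last exact: measurable_cst.
  by apply: measurable_funB => //; exact: measurable_cst.
by apply/funext => w /=; rewrite EFin_max EFinB.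
Qed.

Let excess_ge v c : 0 <= c -> c <= v ->
  ((mean (fun w => Num.min (L0 w) v) - mean (fun w => Num.min (L0 w) c))%:E <=
   expected_excess P L0 c%:E)%E.
Proof.
move=> c0 cv; have v0 := le_trans c0 cv.
have imin u : 0 <= u -> intg (fun w => Num.min (L0 w) u).
  move=> u0; apply: (@intg_bounded _ _ _ P _ u).
    by apply: measurable_minr => //; exact: measurable_cst.
  by move=> w; rewrite ger0_norm ?ge_min ?lexx ?orbT // le_min L0_ge0.
rewrite -meanB; [|exact: imin..]; rewrite -EFin_mean; last by apply: intgB; exact: imin.
apply: ge0_le_integral => //.
- move=> w _; rewrite lee_fin subr_ge0 le_min !ge_min lexx /=.
  by rewrite cv orbT.
- by apply/measurable_EFinP; apply: (intg_measurable (P := P)); apply: intgB; exact: imin.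
- exact: measurable_excess.
- move=> w _; rewrite -EFinB -EFin_max lee_fin.
  by rewrite /Num.min /Num.max; do 3 case: ifPn; rewrite -?leNgt; lra.
Qed.

Let s_infty : (fun n : nat => s n%:R) @ \oo --> 0.
Proof.
rewrite -[X in _ --> X](mean_cst P).
have [] // := @dominated_mean _ _ _ P (fun n w => (n%:R <= L0 w)%R%:R) (fun=> 0) (fun=> 1).
- by move=> n; apply: (intg_measurable (P := P)); apply: intg_bool; exact: measurable_level.
- move=> w; apply: cvg_near_cst; exists (Num.trunc (L0 w)).+1 => // n /= nL.
  by rewrite leNgt (lt_le_trans (truncnS_gt _)) // ler_nat.
- exact: intg_cst.
- by move=> n w; rewrite ger0_norm // lern1 leq_b1.
Qed.

(* Abel summation of the hazard inequality along the levels
   [max c (Psi (j * delta))]. *)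
Lemma first_hit_slices delta c q J : 0 < delta -> 0 <= c -> 0 <= q -> q <= s c ->
  ((delta * \sum_(j < J) Num.min q (tail m (j.+1%:R * delta)))%:E <=
   expected_excess P L0 c%:E)%E.
Proof.
move=> d0 c0 q0 qs.
pose l j := Num.max c (Psi m (j%:R * delta)).
have lc j : c <= l j by rewrite le_max lexx.
have jd0 j : 0 <= j%:R * delta by rewrite mulr_ge0 // ltW.
have jd j k : (j <= k)%N -> j%:R * delta <= k%:R * delta by move=> jk; rewrite ler_pM2r // ler_nat.
(* The barrier is at height at least [j * delta] above level [l j]; the hazard inequalities on
   consecutive level intervals are added up, and the boundary term at [v] is kept. *)
have Abel k : 0 < tail m (k%:R * delta) -> forall v, l k <= v ->
    delta * (\sum_(j < k) s (l j.+1)) - k%:R * delta * s v <=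
    mean (fun w => Num.min (L0 w) v) - mean (fun w => Num.min (L0 w) c).
  have imin u : 0 <= u -> intg (fun w => Num.min (L0 w) u).
    move=> u0; apply: (@intg_bounded _ _ _ P _ u).
      by apply: measurable_minr => //; exact: measurable_cst.
    by move=> w; rewrite ger0_norm ?ge_min ?lexx ?orbT // le_min L0_ge0.
  elim: k => [_ v lv|k IH tk v lv].
    have cv := le_trans (lc 0) lv.
    rewrite big_ord0 mulr0 !mul0r subr0 subr_ge0; apply: le_mean.
    - exact: imin.
    - by apply: imin; exact: le_trans cv.
    - by move=> w; rewrite le_min !ge_min lexx /= cv orbT.
  have tk' : 0 < tail m (k%:R * delta) by apply: lt_le_trans tk _; apply: tail_homo; exact: jd.
  have lk : l k <= l k.+1.
    by rewrite ge_max lc /= le_max Psi_homo ?orbT //; exact: jd.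
  have := IH tk' _ lk; rewrite big_ord_recr /=.
  have hz : k.+1%:R * delta * (s (l k.+1) - s v) <=
      mean (fun w => Num.min (L0 w) v) - mean (fun w => Num.min (L0 w) (l k.+1)).
    apply: (first_hit_hazard XL X_null X_large fhomo fpos C0 f_linear hP) => //.
      exact: le_trans (lc _).
    move=> u _ lu; apply: (HL_barrier_ge hm1 tk); apply: le_trans lu.
    by rewrite le_max lexx orbT.
  move: hz; rewrite -natr1; lra.
have core k : 0 < tail m (k%:R * delta) ->
    ((delta * \sum_(j < k) Num.min q (tail m (j.+1%:R * delta)))%:E <=
    expected_excess P L0 c%:E)%E.
  move=> tk; apply: (@le_trans _ _ (delta * (\sum_(j < k) s (l j.+1)))%:E).
    (* If [l j.+1] is [c], survival there is at least [q]; otherwise it is a value of [Psi] and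
       survival is at least the tail. *)
    rewrite lee_fin ler_pM2l //; apply: ler_sum => j _; rewrite ge_min.
    have tj : 0 < tail m (j.+1%:R * delta) by apply: lt_le_trans tk _; apply: tail_homo; exact: jd.
    rewrite /l; case: (leP c (Psi m (j.+1%:R * delta))) => _; last by rewrite qs.
    by rewrite tail_le_first_hit ?orbT // mulr_gt0.
  (* The boundary term is at most [e] once [v] is a large integer; adding 1 to [k * delta] keeps the
     divisor positive when [k = 0]. *)
  apply/lee_addgt0Pr => e e0.
  have K0 : 0 < k%:R * delta + 1 by rewrite ltr_wpDl.
  have eK : 0 < e / (k%:R * delta + 1) by rewrite divr_gt0.
  have /cvgrPdist_le/(_ _ eK)[n _ /= sn] := s_infty.
  pose n' := maxn n (Num.trunc (l k)).+1.
  have ln : l k <= n'%:R.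
    by rewrite ltW // (lt_le_trans (truncnS_gt _)) // ler_nat leq_maxr.
  have := Abel k tk _ ln; have := sn n' (leq_maxl _ _).
  rewrite sub0r normrN => sn' hA.
  have h1 : k%:R * delta * s n'%:R <= e.
    apply: (@le_trans _ _ ((k%:R * delta + 1) * (e / (k%:R * delta + 1)))).
      apply: ler_pM => //; first exact: mean_ge0.
        by rewrite lerDl.
      exact: le_trans (ler_norm _) sn'.
    by rewrite mulrCA divff ?mulr1 // lt0r_neq0.
  apply: le_trans (_ : (((mean (fun w => Num.min (L0 w) n'%:R) -
    mean (fun w => Num.min (L0 w) c)))%:E + e%:E <= _)%E).
    by rewrite -EFinD lee_fin; lra.
  by rewrite leeD2r // excess_ge // (le_trans (lc k)).
elim: J => [|k IH].
  by rewrite big_ord0 mulr0; apply: integral_ge0 => w _; rewrite le_max lexx orbT.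
(* Slices beyond the support of [m] contribute nothing, which reduces the sum to slices of positive
   tail. *)
have [tk|tk] := ltP 0 (tail m (k.+1%:R * delta)); first exact: core.
rewrite big_ord_recr /= (_ : Num.min q (tail m (k.+1%:R * delta)) = 0) ?addr0 //.
have -> : tail m (k.+1%:R * delta) = 0 by apply/eqP; rewrite eq_le tk tail_ge0.
by rewrite min_r.
Qed.

End first_hit_excess.

(** * Mean over an event, bounded by slices of the tail *)

Section slices.
Context {d : measure_display} {T : measurableType d} {R : realType}.
Variable P : probability T R.

Local Notation mean X := (Rintegral P setT X).
Local Notation intg X := (P.-integrable setT (EFin \o X)).

Lemma min_slices (delta y : R) J : 0 < delta -> 0 <= y ->
  Num.min y (J%:R * delta) <=
  delta + delta * \sum_(j < J) (j.+1%:R * delta <= y)%R%:R.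
Proof.
move=> d0 y0; elim: J => [|J IH].
  by rewrite mul0r big_ord0 mulr0 addr0 ge_min (ltW d0) orbT.
rewrite big_ord_recr /=; have [Jy|yJ] := leP (J.+1%:R * delta) y.
  rewrite (eq_bigr (fun=> 1)) ?sumr_const ?card_ord => [|i _].
    by rewrite -natr1 mulrC lerDr ltW.
  rewrite (le_trans _ Jy) // ler_pM2r // ler_nat; exact: leqW.
rewrite [false%:R]/(0 : R) addr0; have [Jy|yJ'] := leP (J%:R * delta) y.
  rewrite (eq_bigr (fun=> 1)) ?sumr_const ?card_ord => [|i _].
    by move: yJ; rewrite -natr1 mulrDl mul1r addrC mulrC => /ltW.
  by rewrite (le_trans _ Jy) // ler_pM2r // ler_nat.
by move: IH; rewrite min_l // ltW.
Qed.

(** [Y] is cut into slices of thickness [delta]. The part of slice [j] carried by [Q] is charged to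
    the smaller of the probability of [Q] and that of [Y] reaching the slice; the remainder below
    the first step costs at most [delta]. *)
Lemma mean_slices (Y : T -> R) (Q : T -> bool) (G : R -> R) (q delta b : R) :
  measurable_fun setT Y -> measurable [set w | Q w] -> (forall w, 0 <= Y w) ->
  intg (fun w => Y w * (Q w)%:R) -> mean (fun w => (Q w)%:R) <= q ->
  (forall x, 0 < x -> mean (fun w => (x <= Y w)%R%:R) <= G x) -> 0 < delta ->
  (forall J, delta * \sum_(j < J) Num.min q (G (j.+1%:R * delta)) <= b) ->
  mean (fun w => Y w * (Q w)%:R) <= delta + b.
Proof.
move=> mY mQ Y0 iYQ Qq YG d0 sb.
have iQ := intg_bool P mQ.
pose U J w := Num.min (Y w) (J%:R * delta) * (Q w)%:R.
have mU J : measurable_fun setT (U J).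
  apply: measurable_funM; last exact: intg_measurable iQ.
  by apply: measurable_minr => //; exact: measurable_cst.
have Jd0 J : 0 <= J%:R * delta by rewrite mulr_ge0 // ltW.
have UY J w : `|U J w| <= Y w * (Q w)%:R.
  have m0 : 0 <= Num.min (Y w) (J%:R * delta) by rewrite le_min Y0 Jd0.
  by rewrite ger0_norm /U ?mulr_ge0 // ler_wpM2r // ge_min lexx.
have iU J : intg (U J) by exact: intg_dom (mU J) iYQ (UY J).
have [_ cU] : intg (fun w => Y w * (Q w)%:R) /\
    (fun J => mean (U J)) @ \oo --> mean (fun w => Y w * (Q w)%:R).
  apply: (@dominated_mean _ _ _ P U _ _ mU _ iYQ UY) => w.
  apply: cvg_near_cst; exists (Num.trunc (Y w / delta)).+1 => // J /= hJ.
  rewrite /U min_l // -ler_pdivrMr // ltW // (lt_le_trans (truncnS_gt _)) //.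
  by rewrite ler_nat.
rewrite -(cvg_lim _ cU) //; apply: limr_le; first by apply/cvg_ex; eexists; exact: cU.
apply: nearW => J.
pose V j w : R := (j.+1%:R * delta <= Y w)%R%:R * (Q w)%:R.
have iV j : intg (V j).
  apply: (intg_dom _ iQ).
    apply: measurable_funM; last exact: intg_measurable iQ.
    by apply: (intg_measurable (P := P)); apply: intg_bool; exact: measurable_level.
  by move=> w; rewrite ger0_norm ?mulr_ge0 // ler_piMl // lern1 leq_b1.
apply: (@le_trans _ _ (mean (fun w => delta * (Q w)%:R + delta * \sum_(j < J) V j w))).
  apply: le_mean => //.
    apply: intgD; first exact: intgZ.
    by apply: intgZ; exact: intg_sum.
  move=> w; rewrite /U /V -mulr_suml mulrA -mulrDl ler_wpM2r //.
  exact: min_slices.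
rewrite meanD; [|exact: intgZ|by apply: intgZ; exact: intg_sum].
rewrite meanZ // meanZ; last exact: intg_sum.
apply: lerD.
  have Q1 : mean (fun w => (Q w)%:R) <= 1.
    rewrite -[leRHS](mean_cst P); apply: le_mean => //; first exact: intg_cst.
    by move=> w; rewrite lern1 leq_b1.
  by rewrite ler_piMr // ltW.
apply: le_trans (sb J); rewrite ler_pM2l // mean_sum //; apply: ler_sum => j _.
rewrite le_min; apply/andP; split.
  apply: le_trans Qq; apply: le_mean => // w.
  by rewrite ler_piMl // lern1 leq_b1.
have x0 : 0 < j.+1%:R * delta by rewrite mulr_gt0.
apply: le_trans (YG _ x0); apply: le_mean => //.
  by apply: intg_bool; exact: measurable_level.
by move=> w; rewrite ler_piMr // lern1 leq_b1.
Qed.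

End slices.

(** * Excess of the local time at a uniformly integrable stopping time *)

Section stopped_excess.
Context {d : measure_display} {T : measurableType d} {R : realType}.
Variable P : probability T R.
Variables (F : R -> set (set T)) (X L : R -> T -> R).

Local Notation mean X := (Rintegral P setT X).
Local Notation intg X := (P.-integrable setT (EFin \o X)).

Hypothesis XL : reflected_pair P F X L.
Hypothesis hP : measure_is_complete P.
Variable S : T -> \bar R.
Hypothesis FS : stopping_time F S.
Hypothesis S_fin : P.-negligible [set w | S w == +oo%E].
Hypothesis X_ui : forall e, 0 < e -> exists K, forall n : nat,
  mean (fun w => Num.max (stopped X S n.+1%:R w - K) 0) <= e.

Let fin w : R := (S w != +oo%E)%:R.
Let fin01 w : 0 <= fin w <= 1. Proof. by rewrite ler0n lern1 leq_b1. Qed.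
(** With the factor [fin], the values stopped at integer horizons, multiplied by the same factor,
    are eventually constant for every [w], infinite [S] included. *)
Definition X_at w : R := at_time X S w * fin w.
Definition L_at w : R := at_time L S w * fin w.

Let mfin : measurable [set w | S w != +oo%E].
Proof.
rewrite (_ : [set _ | _] = ~` [set w | S w == +oo%E]); first exact/measurableC/hP.
by apply/seteqP; split => w /= /negP.
Qed.

Let ifin : intg fin. Proof. exact: intg_bool. Qed.

Let near_fin w : S w != +oo%E -> \forall n \near \oo, (S w <= n.+1%:R%:E)%E.
Proof.
have := FS.1 w; case: (S w) => [r _ _| |] //.
exists (Num.trunc r) => // n /= rn; rewrite lee_fin.
by rewrite (le_trans (ltW (truncnS_gt r))) // ler_nat.
Qed.

Lemma stopped_at (Y : R -> T -> R) t w : (S w <= t%:E)%E -> stopped Y S t w = at_time Y S w.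
Proof. by move=> St; rewrite /stopped /at_time min_r. Qed.

Let imul (Y : T -> R) : intg Y -> intg (fun w => Y w * fin w).
Proof.
move=> iY; apply: intg_dom (intg_norm iY) _.
  by apply: measurable_funM; [exact: intg_measurable iY|exact: intg_measurable ifin].
by move=> w; have /andP[f0 f1] := fin01 w; rewrite normrM ler_piMr // ger0_norm.
Qed.

Let iX n : intg (stopped X S n.+1%:R).
Proof. exact: (intg_stopped XL (ltr0Sn R n) FS). Qed.

Let iL n : intg (stopped L S n.+1%:R).
Proof. exact: (intg_lstopped XL (ltr0Sn R n) FS). Qed.

Let near_at (Y : R -> T -> R) w : \forall n \near \oo,
  stopped Y S n.+1%:R w * fin w = at_time Y S w * fin w.
Proof.
rewrite /fin; have [_|Sw] := eqVneq (S w) +oo%E.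
  by apply: nearW => n; rewrite !mulr0.
by apply: filterS (near_fin Sw) => n Sn; rewrite stopped_at.
Qed.

Lemma measurable_X_at : measurable_fun setT X_at.
Proof.
apply: (@measurable_fun_cvg _ _ _ setT (fun n w => stopped X S n.+1%:R w * fin w)).
  by move=> n; exact: intg_measurable (imul (iX n)).
by move=> w _; apply: cvg_near_cst; exact: near_at.
Qed.

Lemma measurable_L_at : measurable_fun setT L_at.
Proof.
apply: (@measurable_fun_cvg _ _ _ setT (fun n w => stopped L S n.+1%:R w * fin w)).
  by move=> n; exact: intg_measurable (imul (iL n)).
by move=> w _; apply: cvg_near_cst; exact: near_at.
Qed.

Lemma at_time_ae (Y : R -> T -> R) :
  P.-negligible [set w | at_time Y S w * fin w != at_time Y S w].
Proof.
by apply: negligibleS S_fin => w /=; apply: contraNT => Sw; rewrite /fin Sw mulr1.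
Qed.

Lemma measurable_at_time_L : measurable_fun setT (at_time L S).
Proof.
apply/measurable_EFinP; apply: (ae_measurable_fun hP (f := EFin \o L_at)).
  apply: negligibleS (at_time_ae L) => w /= h; apply/eqP => E; apply: h => _.
  by rewrite -E.
by apply/measurable_EFinP; exact: measurable_L_at.
Qed.

(** Optional stopping is an equality at each [min S n]. In the limit the side of [X] converges by
    uniform integrability, whereas the side of [L] is only controlled by Fatou, which yields an
    inequality together with integrability of the excess. *)
Lemma stopped_excess_le v : 0 < v ->
  intg (fun w => X_at w * (v <= L_at w)%R%:R) /\
  (expected_excess P (at_time L S) v%:E <=
   (mean (fun w => X_at w * (v <= L_at w)%R%:R))%:E)%E.
Proof.
move=> v0.
pose Y0 n w := stopped X S n.+1%:R w * (v <= stopped L S n.+1%:R w)%R%:R.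
have iY0 n : intg (Y0 n).
  apply: intg_dom (intg_norm (iX n)) _.
    apply: measurable_funM; first exact: intg_measurable (iX n).
    apply: (intg_measurable (P := P)); apply: intg_bool; apply: measurable_level.
    exact: intg_measurable (iL n).
  by move=> w; rewrite normrM ler_piMr // ger0_norm // lern1 leq_b1.
pose Y n w := Y0 n w * fin w.
have iY n : intg (Y n) by exact: imul.
have Y_ge0 n w : 0 <= Y n w.
  by have /andP[f0 _] := fin01 w; rewrite !mulr_ge0 // (X_ge0 XL).
have cY w : Y^~ w @ \oo --> X_at w * (v <= L_at w)%R%:R.
  rewrite /Y /Y0 /X_at /L_at; have [fin0|fin1] := eqVneq (fin w) 0.
    by rewrite fin0 !mulr0 mul0r; apply: cvg_near_cst; apply: nearW => n; rewrite mulr0.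
  have Sw : S w != +oo%E by apply: contraNN fin1 => /eqP Sw; rewrite /fin Sw eqxx.
  apply: cvg_near_cst; apply: filterS (near_fin Sw) => n Sn.
  by rewrite !stopped_at // /fin Sw !mulr1.
have uiY e : 0 < e -> exists K, forall n, mean (fun w => Num.max (Y n w - K) 0) <= e.
  move=> /X_ui[K KE]; exists K => n; apply: le_trans (KE n).
  apply: le_mean; [exact: intg_max|exact: intg_max|] => w.
  have X0 := X_ge0 XL (stop_clock n.+1%:R S w) w.
  rewrite -[X _ _]/(stopped X S n.+1%:R w) in X0.
  have /andP[f0 f1] := fin01 w.
  rewrite ge_max !le_max lexx orbT andbT lerB //.
  rewrite /Y /Y0 -mulrA ler_piMr // mulr_ile1 // lern1; exact: leq_b1.
have [iYoo mYoo] := vitali_mean iY Y_ge0 cY uiY.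
split=> //; set MY := mean _ in mYoo *.
pose Z n w := Num.max (stopped L S n.+1%:R w - v) 0 * fin w.
have iZ n : intg (Z n) by apply/imul/intg_max.
have cZ w : Z^~ w @ \oo --> Num.max (L_at w - v) 0.
  rewrite /Z /L_at; have [fin0|fin1] := eqVneq (fin w) 0.
    rewrite fin0 mulr0 max_r; last by rewrite sub0r oppr_le0 ltW.
    by apply: cvg_near_cst; apply: nearW => n; rewrite mulr0.
  have Sw : S w != +oo%E by apply: contraNN fin1 => /eqP Sw; rewrite /fin Sw eqxx.
  apply: cvg_near_cst; apply: filterS (near_fin Sw) => n Sn.
  by rewrite !stopped_at // /fin Sw !mulr1.
have Z_ge0 n w : 0 <= Z n w.
  by have /andP[f0 _] := fin01 w; rewrite mulr_ge0 // le_max lexx orbT.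
have ZY n : mean (Z n) <= mean (Y n).
  have -> : mean (Y n) = mean (Y0 n).
    have [] // := ae_mean (iY n) (intg_measurable (iY0 n)) _.
    apply: negligibleS S_fin => w /=; apply: contraNT => Sw.
    by rewrite /Y /fin Sw mulr1.
  rewrite /Y0 (optional_stopping XL (ltr0Sn R n) FS v0).
  apply: le_mean => //; first exact: intg_max.
  move=> w; have /andP[f0 f1] := fin01 w.
  by rewrite ler_piMr // le_max lexx orbT.
have bound e : 0 < e -> intg (fun w => Num.max (L_at w - v) 0) /\
    mean (fun w => Num.max (L_at w - v) 0) <= MY + e.
  move=> e0; have /cvgrPdist_le/(_ _ e0)[n0 _ hn0] := mYoo.
  (* The shift by [n0] keeps only the terms whose bound is within [e] of the limit [MY]. *)
  apply: (@fatou_mean _ _ _ P (fun n => Z (n + n0)%N)) => [n|n w|w|n] //.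
    by rewrite (cvg_shiftn n0 (Z^~ w)).
  apply: le_trans (ZY _) _; have := hn0 (n + n0)%N (leq_addl _ _).
  by rewrite /= ler_norml; lra.
have [iM _] := bound 1 ltr01.
have -> : expected_excess P (at_time L S) v%:E = (mean (fun w => Num.max (L_at w - v) 0))%:E.
  rewrite -EFin_mean //; apply: ae_eq_integral => //.
  - by apply: measurable_excess; exact: measurable_at_time_L.
  - by apply/measurable_EFinP; exact: intg_measurable iM.
  - apply: negligibleS (at_time_ae L) => w /= h; apply/eqP => E; apply: h => _.
    by rewrite /L_at E EFin_max EFinB.
rewrite lee_fin; apply/ler_addgt0Pr => e e0; by have [] := bound _ e0.
Qed.

End stopped_excess.

(** * From Brownian motion to a reflected pair *)

Section gaussian.
Context {R : realType}.
Implicit Types (s K x : R).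

Lemma le_expR x : x <= expR x.
Proof. by apply: le_trans (expR_ge1Dx x); rewrite lerDr. Qed.

Lemma measurable_norm_ge x : measurable [set y : R | x <= `|y|].
Proof.
have := @measurable_level _ (measurableTypeR R) R (fun y : R => `|y|) x.
by apply; exact: normr_measurable.
Qed.

(** With [z = y ^+ 2 / (4 * s ^+ 2)], the density is proportional to [expR (- z)] squared. One
    factor is at most [z^-1], hence of order [j.+1%:R ^- 2] on the tail; the other is, up to a
    constant, the normal density of variance [2 * s ^+ 2], of total mass 1. Quadratic decay suffices
    for a first moment. *)
Lemma normal_tail s : 0 < s -> exists2 K, 0 <= K & forall j : nat,
  fine (normal_prob 0 s [set y : R | j.+1%:R <= `|y|]) <= K / j.+1%:R ^+ 2.
Proof.
move=> s0; pose s' := Num.sqrt 2 * s.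
have s'0 : 0 < s' by rewrite mulr_gt0 // sqrtr_gt0.
have s'2 : s' ^+ 2 = 2 * s ^+ 2 by rewrite exprMn sqr_sqrtr.
pose K := 4 * s ^+ 2 * normal_peak s / normal_peak s'.
have K0 : 0 <= K.
  by rewrite divr_ge0 ?normal_peak_ge0 // mulr_ge0 ?normal_peak_ge0 // mulr_ge0 // sqr_ge0.
exists K => // j; set A := [set y : R | _].
have mA : measurable A by exact: measurable_norm_ge.
have c0 : 0 <= K / j.+1%:R ^+ 2 by rewrite divr_ge0 // sqr_ge0.
have mpdf t : measurable_fun A (fun y => (normal_pdf 0 t y)%:E).
  by apply: measurable_funTS; apply/measurable_EFinP; exact: measurable_normal_pdf.
have pdf_le y : A y -> normal_pdf 0 s y <= K / j.+1%:R ^+ 2 * normal_pdf 0 s' y.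
  move=> jy; rewrite !normal_pdfE ?gt_eqF // /normal_fun !subr0 s'2.
  have j0 : 0 < j.+1%:R :> R by [].
  have p0 := normal_peak_gt0 (lt0r_neq0 s0); have p'0 := normal_peak_gt0 (lt0r_neq0 s'0).
  have sn0 := lt0r_neq0 s0; have jn0 := lt0r_neq0 j0.
  pose z := y ^+ 2 / (4 * s ^+ 2).
  have -> : - y ^+ 2 / (s ^+ 2 *+ 2) = - z + - z.
    by rewrite /z -mulr_natr; field; rewrite ?sn0.
  have -> : - y ^+ 2 / (2 * s ^+ 2 *+ 2) = - z.
    by rewrite /z -mulr_natr; field; rewrite ?sn0.
  rewrite expRD.
  have -> : K / j.+1%:R ^+ 2 * (normal_peak s' * expR (- z)) =
      normal_peak s * (4 * s ^+ 2 / j.+1%:R ^+ 2 * expR (- z)).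
    move: (j.+1%:R : R) jn0 => x xn0.
    by rewrite /K; field; rewrite (lt0r_neq0 p'0) xn0.
  rewrite ler_pM2l // ler_pM2r ?expR_gt0 //.
  have y2 : j.+1%:R ^+ 2 <= y ^+ 2.
    by rewrite -[leRHS]real_normK ?num_real // lerXn2r // nnegrE.
  have y20 : 0 < y ^+ 2 by apply: lt_le_trans y2; exact: exprn_gt0.
  have s4 : 0 < 4 * s ^+ 2 by rewrite mulr_gt0 // exprn_gt0.
  have z0 : 0 < z by exact: divr_gt0.
  apply: (@le_trans _ _ z^-1).
    by rewrite expRN lef_pV2 ?posrE ?expR_gt0 // le_expR.
  by rewrite /z invf_div ler_pM2l // lef_pV2 ?posrE // exprn_gt0.
have : (normal_prob 0 s A <= (K / j.+1%:R ^+ 2)%:E)%E.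
  apply: (@le_trans _ _ (\int[lebesgue_measure]_(y in A)
      ((K / j.+1%:R ^+ 2)%:E * (normal_pdf 0 s' y)%:E))%E).
    apply: ge0_le_integral => //.
    - by move=> y _; rewrite lee_fin normal_pdf_ge0.
    - exact: mpdf.
    - by apply: measurable_funeM; exact: mpdf.
  rewrite ge0_integralZl_EFin //; [|by move=> y _; rewrite lee_fin normal_pdf_ge0|exact: mpdf].
  rewrite -[leRHS]mule1 lee_pmul //; last exact: (@probability_le1 _ _ _ (normal_prob 0 s')).
  by apply: integral_ge0 => y _; rewrite lee_fin normal_pdf_ge0.
by move=> h; rewrite -lee_fin fineK // fin_num_measure.
Qed.

Lemma normal_small s K : 0 < s -> 0 <= K ->
  fine (normal_prob 0 s [set y : R | `|y| <= K]) <= 2 * K / s.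
Proof.
move=> s0 K0; have AE : [set y : R | `|y| <= K] = `[- K, K]%classic.
  by apply/seteqP; split => y /=; rewrite in_itv /= ler_norml.
rewrite AE; have : (normal_prob 0 s `[(- K)%R, K]%classic <= (2 * K / s)%:E)%E.
  apply: (@le_trans _ _ (\int[lebesgue_measure]_(y in `[(- K)%R, K]) (s^-1)%:E)%E).
    apply: ge0_le_integral => //.
    - by move=> y _; rewrite lee_fin normal_pdf_ge0.
    - by apply: measurable_funTS; apply/measurable_EFinP; exact: measurable_normal_pdf.
    - move=> y _; rewrite lee_fin (le_trans (normal_pdf_ub _ _ _)) ?gt_eqF //.
      rewrite /normal_peak lef_pV2 ?posrE ?sqrtr_gt0 //; last first.
        by rewrite mulrn_wgt0 // mulr_gt0 ?pi_gt0 // exprn_gt0.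
      rewrite -[leLHS]ger0_norm ?(ltW s0) // -sqrtr_sqr ler_sqrt.
        rewrite -mulrnAr ler_peMr ?sqr_ge0 //.
        by have := pi_ge2 R; lra.
      by rewrite mulrn_wge0 // mulr_ge0 ?sqr_ge0 // ltW // pi_gt0.
  rewrite integral_cst //= lebesgue_measure_itv /= lte_fin; case: ifP => _.
    by rewrite -EFinB -EFinM lee_fin opprK; lra.
  by rewrite mule0 lee_fin divr_ge0 ?mulr_ge0 // ltW.
by move=> h; rewrite -lee_fin fineK // fin_num_measure.
Qed.

Lemma normal_null s : normal_prob 0 s [set 0 : R] = 0%E.
Proof. by rewrite /normal_prob integral_set1. Qed.

Lemma sum_inv_squares J : \sum_(j < J) (j.+1%:R ^+ 2)^-1 <= 2 - J%:R^-1 :> R.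
Proof.
(* At [J = 0] the convention that the inverse of 0 is 0 makes the bound 2; the telescoping induction
   starts from [J = 1]. *)
elim: J => [|[|J] IH]; first by rewrite big_ord0 invr0 subr0.
  by rewrite big_ord_recr big_ord0 /= expr1n invr1; lra.
rewrite big_ord_recr /=; move: IH; rewrite -(natr1 J.+1).
have : 0 < J.+1%:R :> R by [].
move: (J.+1%:R : R) (\sum_(_ < _) _) => x S x0 IH.
suff : ((x + 1) ^+ 2)^-1 <= x^-1 - (x + 1)^-1 by move: IH; lra.
have -> : x^-1 - (x + 1)^-1 = (x * (x + 1))^-1 by field; rewrite !gt_eqF //; lra.
rewrite lef_pV2 ?posrE ?exprn_gt0 ?mulr_gt0 //; [|lra..].
by rewrite expr2 ler_pM2r; lra.
Qed.

Context {d : measure_display} {T : measurableType d}.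
Variable P : probability T R.

(** Unit slices bound the mean of [min |Y| J] by 1 plus a sum of tail probabilities, uniformly in
    [J], and Fatou removes the truncation. *)
Lemma gaussian_intg s (Y : T -> R) : 0 < s -> measurable_fun setT Y ->
  (forall A : set R, measurable A -> P (Y @^-1` A) = normal_prob 0 s A) ->
  P.-integrable setT (EFin \o (fun w => `|Y w|)).
Proof.
move=> s0 mY PY; have [K K0 tK] := normal_tail s0.
have mnY : measurable_fun setT (fun w => `|Y w|) by exact: measurableT_comp.
have imin J : P.-integrable setT (EFin \o (fun w => Num.min `|Y w| J%:R)).
  apply: (@intg_bounded _ _ _ P _ J%:R).
    by apply: measurable_minr => //; exact: measurable_cst.
  by move=> w; rewrite ger0_norm ?ge_min ?lexx ?orbT // le_min normr_ge0 /=.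
have [] // := @fatou_mean _ _ _ P (fun J w => Num.min `|Y w| J%:R) (fun w => `|Y w|)
  (1 + 2 * K) imin _ _ _.
- move=> w; apply: cvg_near_cst; exists (Num.trunc `|Y w|).+1 => // J /= hJ.
  by rewrite min_l // ltW // (lt_le_trans (truncnS_gt _)) // ler_nat.
move=> J.
pose B (j : nat) w : R := (j.+1%:R <= `|Y w|)%R%:R.
have iB j : P.-integrable setT (EFin \o B j).
  by apply: intg_bool; exact: measurable_level.
have iS : P.-integrable setT (EFin \o (fun w => \sum_(j < J) B j w)) by exact: intg_sum.
apply: (@le_trans _ _ (Rintegral P setT (fun w => 1 + \sum_(j < J) B j w))).
  apply: le_mean => //; first exact: intgD (intg_cst P 1) iS.
  move=> w; have := min_slices J ltr01 (normr_ge0 (Y w)); rewrite mulr1 mul1r.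
  by under [X in _ <= _ + X -> _]eq_bigr do rewrite mulr1.
rewrite (meanD (intg_cst P 1) iS) mean_cst lerD2l mean_sum //.
apply: (@le_trans _ _ (\sum_(j < J) (K * (j.+1%:R ^+ 2)^-1))).
  apply: ler_sum => j _; rewrite mean_bool; last exact: measurable_level.
  rewrite -[X in P X]/(Y @^-1` [set y | j.+1%:R <= `|y|]) PY; last exact: measurable_norm_ge.
  exact: tK.
rewrite -mulr_sumr mulrC ler_wpM2r //.
by apply: le_trans (sum_inv_squares J) _; rewrite gerBl invr_ge0.
Qed.

End gaussian.

(** * Path properties read off the occupation density *)

Section occupation_density.
Context {R : realType}.
Variables b l : R -> R.
Hypothesis b0 : b 0 = 0.
Hypothesis cb : {within `[0, +oo[, continuous b}.
Hypothesis cl : {within `[0, +oo[, continuous l}.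
Hypothesis occupation : forall t : R, 0 <= t ->
  fine (lebesgue_measure [set s : R | 0 <= s <= t /\ `|b s| < e]) / (2 * e)
    @[e --> (0 : R)^'+] --> l t.

Lemma continuous_max0 (g : R -> R) : {within `[0, +oo[, continuous g} ->
  continuous (fun t : R => g (Num.max t 0)).
Proof.
move=> /subspace_continuousP cg t.
have t0 : `[0, +oo[%classic (Num.max t 0 : R) by rewrite /= in_itv /= andbT le_max lexx orbT.
have := cg _ t0; apply: cvg_trans => A /= [e e0 Ae].
have /cvgrPdist_lt/(_ e e0) := @continuous_maxc R 0 t; apply: filterS => u uA.
by apply: Ae => //=; rewrite in_itv /= andbT le_max lexx orbT.
Qed.

Let A t e := [set s : R | 0 <= s <= t /\ `|b s| < e].

Let mA t e : measurable (A t e).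
Proof.
have -> : A t e = `[0, t]%classic `&` (fun s : R => `|b (Num.max s 0)|) @^-1` `]-oo, e[.
  apply/seteqP; split => s /=; rewrite !in_itv /=.
    by move=> [st bs]; rewrite max_l //; case/andP: st.
  by move=> [st]; rewrite max_l //; case/andP: st.
apply: measurableI; first exact: measurable_itv.
have mb : measurable_fun setT (fun s : R => `|b (Num.max s 0)|).
  apply: continuous_measurable_fun => s; apply: cvg_norm; exact: continuous_max0.
by rewrite -[_ @^-1` _]setTI; apply: mb.
Qed.

Let A_le t e : 0 <= t -> (lebesgue_measure (A t e) <= t%:E)%E.
Proof.
move=> t0; apply: (@le_trans _ _ (lebesgue_measure `[0, t]%classic)).
  apply: le_measure; rewrite ?inE; [exact: mA|exact: measurable_itv|].
  by move=> s [st _]; rewrite /= in_itv.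
rewrite lebesgue_measure_itv /= lte_fin; case: ifP => _; last by rewrite lee_fin.
by rewrite sube0.
Qed.

Let A_fin t e : 0 <= t -> lebesgue_measure (A t e) \is a fin_num.
Proof.
move=> t0; rewrite ge0_fin_numE //; exact: le_lt_trans (A_le e t0) (ltry _).
Qed.

Lemma occupation_homo s t : 0 <= s -> s <= t -> l s <= l t.
Proof.
move=> s0 st; have t0 := le_trans s0 st.
apply: (ler_cvg_to (occupation s0) (occupation t0)).
near=> e; have e0 : 0 < e by [].
rewrite ler_pM2r ?invr_gt0 ?mulr_gt0 //; apply: fine_le; [exact: A_fin..|].
apply: le_measure; rewrite ?inE; [exact: mA..|].
by move=> u [/andP[u0 us] bu]; split => //; rewrite u0 (le_trans us).
Unshelve. all: by end_near. Qed.

Lemma occupation_0 : l 0 = 0.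
Proof.
rewrite -(cvg_lim _ (occupation (lexx 0))) //; apply: cvg_lim => //.
apply: cvg_near_cst; near=> e.
have : lebesgue_measure (A 0 e) = 0%E.
  by apply/eqP; rewrite eq_le measure_ge0 andbT; exact: A_le.
by rewrite /A => ->; rewrite mul0r.
Unshelve. all: by end_near. Qed.

(** On [[s, t]] the modulus of [b] has a positive minimum; for [e] below it, no occupation of the
    [e]-neighbourhood of 0 occurs after [s], and the two densities coincide before the limit. *)
Lemma occupation_flat s t : 0 <= s -> s <= t -> (forall u, s <= u <= t -> 0 < `|b u|) ->
  l s = l t.
Proof.
move=> s0 st bpos; have t0 := le_trans s0 st.
have [c] : exists2 c, c \in `[s, t] &
    forall u, u \in `[s, t] -> `|b (Num.max c 0)| <= `|b (Num.max u 0)|.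
  apply: EVT_min => //; apply: continuous_subspaceT => u.
  by apply: cvg_norm; exact: continuous_max0.
rewrite in_itv /= => /andP[sc ct] cmin; have c0 := le_trans s0 sc.
have bc : 0 < `|b c| by apply: bpos; rewrite sc.
apply: (cvg_unique _ (occupation s0)) => //.
apply: cvg_trans (occupation t0); apply: near_eq_cvg; near=> e.
congr (fine (lebesgue_measure _) / _); apply/seteqP; split => u /=; last first.
  by move=> [/andP[u0 us] bu]; rewrite u0 (le_trans us).
move=> [/andP[u0 ut] bu]; rewrite u0 bu; split => //=.
rewrite leNgt; apply/negP => su; move: bu; apply/negP; rewrite -leNgt.
apply: (@le_trans _ _ `|b c|); first by near: e; exact: nbhs_right_le.
have := cmin u; rewrite !max_l //; apply.
by rewrite in_itv /= ut ltW.
Unshelve. all: by end_near. Qed.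

Lemma occupation_path :
  reflected_path (fun t : R => `|b (Num.max t 0)|) (fun t : R => l (Num.max t 0)).
Proof.
split.
- by move=> t; apply: cvg_norm; exact: continuous_max0.
- exact: continuous_max0.
- by move=> t.
- by rewrite maxxx b0 normr0.
- by move=> t t0; rewrite max_r // occupation_0.
- move=> s t st; apply: occupation_homo; first by rewrite le_max lexx orbT.
  by rewrite ge_max !le_max st lexx !orbT.
- move=> s t st bpos; have [s0|s0] := leP s 0.
    have := bpos s; rewrite lexx st max_r // b0 normr0 ltxx => /(_ isT).
    by [].
  have t0 := lt_le_trans s0 st; rewrite !max_l; [|exact: ltW..].
  apply: occupation_flat => //; first exact: ltW.
  move=> u /andP[su ut]; have := bpos u; rewrite su ut max_l; first exact.
  by apply: ltW; exact: lt_le_trans su.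
Qed.

End occupation_density.

(** * Removal of the exceptional null set *)

Section regularization.
Context {d : measure_display} {T : measurableType d} {R : realType}.
Variable P : probability T R.
Hypothesis hP : measure_is_complete P.
Variables B L : R -> T -> R.
Hypothesis hB : brownian_motion P B.
Hypothesis hL : local_time_at_0 P B L.

Local Notation mean X := (Rintegral P setT X).
Local Notation intg X := (P.-integrable setT (EFin \o X)).
Local Notation F := (completed_filtration P B).

Definition regular_path : set T := [set w | [/\ B 0 w = 0,
  {within `[0, +oo[, continuous (fun t : R => B t w)},
  {within `[0, +oo[, continuous (fun t : R => L t w)} &
  forall t : R, 0 <= t ->
    fine (lebesgue_measure [set s : R | 0 <= s <= t /\ `|B s w| < e]) / (2 * e)
      @[e --> (0 : R)^'+] --> L t w]].

(* Off a null set the paths are replaced by 0, and negative times by time 0. *)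
Definition regular_X t w : R := `|B (Num.max t 0) w| * \1_regular_path w.
Definition regular_L t w : R := L (Num.max t 0) w * \1_regular_path w.

Local Notation X := regular_X.
Local Notation Lr := regular_L.
Local Notation G := regular_path.

Lemma regular_negligible : P.-negligible (~` G).
Proof.
have n1 := bm_start hB; have n2 := bm_continuous hB.
have n3 := lt_continuous hL; have n4 := lt_occupation hL.
apply: negligibleS (negligibleU (negligibleU n1 n2) (negligibleU n3 n4)) => w nG.
apply: contrapT => h; apply: nG; split.
- by apply: contrapT => h1; apply: h; left; left.
- by apply: contrapT => h1; apply: h; left; right.
- by apply: contrapT => h1; apply: h; right; left.
- by apply: contrapT => h1; apply: h; right; right.
Qed.

Lemma regular_ae_eq (Y Z : T -> R) : (forall w, G w -> Y w = Z w) ->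
  P.-negligible [set w | Y w != Z w].
Proof.
move=> YZ; apply: negligibleS regular_negligible => w /= YZw Gw.
by move: YZw; rewrite YZ // eqxx.
Qed.

Lemma regular_XE t w : 0 <= t -> G w -> X t w = `|B t w|.
Proof. by move=> t0 Gw; rewrite /regular_X max_l // indicE mem_set // mulr1. Qed.

Lemma regular_LE t w : 0 <= t -> G w -> Lr t w = L t w.
Proof. by move=> t0 Gw; rewrite /regular_L max_l // indicE mem_set // mulr1. Qed.

Lemma regular_reflected w : reflected_path (X^~ w) (Lr^~ w).
Proof.
have [Gw|nGw] := pselect (G w).
  have -> : X^~ w = fun t : R => `|B (Num.max t 0) w|.
    by apply/funext => t; rewrite /regular_X indicE mem_set // mulr1.
  have -> : Lr^~ w = fun t : R => L (Num.max t 0) w.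
    by apply/funext => t; rewrite /regular_L indicE mem_set // mulr1.
  by case: Gw; exact: occupation_path.
have X0 t : X t w = 0 by rewrite /regular_X indicE memNset // mulr0.
have L0 t : Lr t w = 0 by rewrite /regular_L indicE memNset // mulr0.
have XE : X^~ w = fun=> 0 by apply/funext.
have LE : Lr^~ w = fun=> 0 by apply/funext.
rewrite XE LE; split => //.
- by move=> t; exact: cvg_cst.
- by move=> t; exact: cvg_cst.
Qed.

Lemma natural_filtration_sub t : 0 <= t -> natural_filtration B t `<=` measurable.
Proof.
move=> t0; apply: smallest_sub; first exact: sigma_algebra_measurable.
move=> A [s /=]; rewrite in_itv /= => /andP[s0 st] [Y mY <-].
exact: (bm_measurable hB s0 measurableT mY).
Qed.

Lemma F_sub_measurable t : 0 <= t -> F t `<=` measurable.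
Proof.
move=> t0; apply: smallest_sub; first exact: sigma_algebra_measurable.
by move=> A [/(natural_filtration_sub t0)//|]; exact: hP.
Qed.

Lemma F_sub s t : 0 <= s -> s <= t -> F s `<=` F t.
Proof.
move=> s0 st; apply: smallest_sub; first exact: smallest_sigma_algebra.
move=> A [As|nA]; apply: sub_sigma_algebra; [left|by right].
move: A As; apply: smallest_sub; first exact: smallest_sigma_algebra.
move=> A [u /=]; rewrite in_itv /= => /andP[u0 us] [Y mY <-].
apply: sub_sigma_algebra; exists u; last by exists Y.
by rewrite /= in_itv /= u0 (le_trans us).
Qed.

Lemma F_negligible t A : P.-negligible A -> F t A.
Proof. by move=> nA; apply: sub_sigma_algebra; right. Qed.

Lemma F_sigma t : sigma_algebra setT (F t).
Proof. exact: smallest_sigma_algebra. Qed.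

(** The exceptional set belongs to every [F t], time 0 included, thanks to the completion. *)
Lemma F_regular t : F t G.
Proof.
have [_ FC _] := F_sigma t; have := FC _ (F_negligible regular_negligible).
by rewrite setTD setCK.
Qed.

Lemma B_adapted : adapted F B.
Proof.
move=> t Y t0 mY; apply: sub_sigma_algebra; left; apply: sub_sigma_algebra.
exists t; first by rewrite /= in_itv /= t0 lexx.
by exists Y => //; rewrite setTI.
Qed.

Let adapted_mul (Z : R -> T -> R) (g : R -> R) : adapted F Z -> measurable_fun setT g ->
  adapted F (fun t w => g (Z (Num.max t 0) w) * \1_G w).
Proof.
move=> aZ mg t Y t0 mY.
have FE : <<s F t>> = F t by exact: (sigma_algebra_id (F_sigma t)).
pose TF := g_sigma_algebraType (F t).
have mZ : measurable_fun setT (Z t : TF -> R).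
  move=> _ Y' mY'; rewrite setTI.
  have : <<s F t>> (Z t @^-1` Y') by rewrite FE; exact: aZ.
  by [].
have mG : measurable (G : set TF).
  have : <<s F t>> G by rewrite FE; exact: F_regular.
  by [].
have m : measurable_fun setT (fun w : TF => g (Z t w) * \1_(G : set TF) w).
  by apply: measurable_funM; [exact: measurableT_comp|exact: measurable_indic].
have := m measurableT Y mY; rewrite setTI max_l //.
by move=> h; rewrite -FE.
Qed.

Lemma regular_X_adapted : adapted F X.
Proof. by apply: (adapted_mul B_adapted (g := fun x => `|x|)); exact: normr_measurable. Qed.

Lemma regular_L_adapted : adapted F Lr.
Proof. by apply: (adapted_mul (lt_adapted hL) (g := id)); exact: measurable_id. Qed.

(** Stated for the increment because [B 0] vanishes only almost surely. *)
Lemma increment_law t : 0 < t -> forall A : set R, measurable A ->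
  P ((fun w => B t w - B 0 w) @^-1` A) = normal_prob 0 (Num.sqrt t) A.
Proof. by move=> t0 A mA; have := bm_gaussian hB (lexx 0) t0 mA; rewrite subr0. Qed.

Lemma measurable_increment t : 0 <= t -> measurable_fun setT (fun w => B t w - B 0 w).
Proof. by move=> t0; apply: measurable_funB; apply: (bm_measurable hB). Qed.

Lemma measurable_regular_X t : 0 <= t -> measurable_fun setT (X t).
Proof.
move=> t0 _ Y mY; rewrite setTI; apply: (F_sub_measurable t0).
exact: regular_X_adapted.
Qed.

Lemma measurable_regular_L t : 0 <= t -> measurable_fun setT (Lr t).
Proof.
move=> t0 _ Y mY; rewrite setTI; apply: (F_sub_measurable t0).
exact: regular_L_adapted.
Qed.

Lemma regular_X_intg t : 0 <= t -> intg (X t).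
Proof.
rewrite le_eqVlt => /predU1P[<-|t0].
  have [] // := ae_mean (intg_cst P 0) (measurable_regular_X (lexx 0)) _.
  by apply: regular_ae_eq => w Gw; rewrite regular_XE //; case: Gw => ->; rewrite normr0.
have s0 : 0 < Num.sqrt t by rewrite sqrtr_gt0.
have iY := gaussian_intg s0 (measurable_increment (ltW t0)) (increment_law t0).
have [] // := ae_mean iY (measurable_regular_X (ltW t0)) _.
apply: regular_ae_eq => w Gw; rewrite regular_XE ?ltW //.
by case: Gw => -> _ _ _; rewrite subr0.
Qed.

Let M t w : R := `|B t w| - L t w.

Let M_intg t : 0 <= t -> intg (M t).
Proof. by have [_ + _] := lt_normalized hL; exact. Qed.

(** The local time is the difference of the Gaussian modulus [|B t|] and the integrable martingale
    [|B t| - L t]. *)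
Lemma regular_L_intg t : 0 <= t -> intg (Lr t).
Proof.
move=> t0; have iY := intgB (regular_X_intg t0) (M_intg t0).
have [] // := ae_mean iY (measurable_regular_L t0) _.
apply: regular_ae_eq => w Gw; rewrite regular_XE // regular_LE // /M.
by rewrite opprB addrC subrK.
Qed.

Lemma regular_mart s t A : 0 <= s -> s <= t -> F s A ->
  mean (fun w => (X t w - Lr t w) * \1_A w) = mean (fun w => (X s w - Lr s w) * \1_A w).
Proof.
move=> s0 st FA; have mA := F_sub_measurable s0 FA.
have E u : 0 <= u -> mean (fun w => (X u w - Lr u w) * \1_A w) = mean (fun w => M u w * \1_A w).
  move=> u0; have iM := intgM_indic mA (M_intg u0).
  have iX := intgM_indic mA (intgB (regular_X_intg u0) (regular_L_intg u0)).
  have [] // := ae_mean iX (intg_measurable iM) _.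
  by apply: regular_ae_eq => w Gw; rewrite regular_XE // regular_LE.
rewrite !E //; last exact: le_trans st.
have [_ _ /(_ s t A s0 st FA)] := lt_normalized hL.
by rewrite (mean_set P (M t)) (mean_set P (M s)) => h; rewrite /Rintegral h.
Qed.

Lemma regular_pair : reflected_pair P F X Lr.
Proof.
split.
- by move=> t _; exact: F_sigma.
- exact: F_sub.
- exact: F_sub_measurable.
- exact: regular_X_adapted.
- exact: regular_L_adapted.
- exact: regular_reflected.
- exact: regular_X_intg.
- exact: regular_L_intg.
- exact: regular_mart.
Qed.

Let prob_X_le t K : 0 < t ->
  fine (P [set w | X t w <= K]) = fine (normal_prob 0 (Num.sqrt t) [set y : R | `|y| <= K]).
Proof.
move=> t0; have t0' := ltW t0.
have mK : measurable [set y : R | `|y| <= K].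
  have mn : measurable_fun setT (fun y : measurableTypeR R => - `|y| : R).
    by apply: measurableT_comp => //; exact: normr_measurable.
  have := measurable_level (- K) mn; congr (measurable _).
  by apply/seteqP; split => y /=; rewrite lerN2.
rewrite -(increment_law t0 mK).
have mX : measurable [set w | X t w <= K] by exact/measurable_le_level/measurable_regular_X.
have mY : measurable [set w | `|B t w - B 0 w| <= K].
  apply: measurable_le_level; apply: measurableT_comp; first exact: normr_measurable.
  exact: measurable_increment.
rewrite -(mean_bool P mX) -[X in _ = fine (P X)]/[set w | `|B t w - B 0 w| <= K] -(mean_bool P mY).
have [] // := ae_mean (intg_bool P mX) (intg_measurable (intg_bool P mY)) _.
apply: regular_ae_eq => w Gw; rewrite regular_XE //.
by case: Gw => -> _ _ _; rewrite subr0.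
Qed.

Lemma regular_X_null t : 0 < t -> P [set w | X t w <= 0] = 0%E.
Proof.
move=> t0; have mX : measurable [set w | X t w <= 0].
  exact/measurable_le_level/measurable_regular_X/ltW.
rewrite -[LHS]fineK ?fin_num_measure // prob_X_le //.
have -> : [set y : R | `|y| <= 0] = [set 0].
  by apply/seteqP; split => y /=; rewrite normr_le0 => /eqP.
by rewrite normal_null.
Qed.

Lemma regular_X_large (K e : R) : 0 < e ->
  exists2 t, 0 < t & fine (P [set w | X t w <= K]) <= e.
Proof.
move=> e0; pose K' := Num.max K 0; have K0 : 0 <= K' by rewrite le_max lexx orbT.
(* Time [s ^+ 2] has standard deviation [s], and then [normal_small] bounds the probability by
   [2 * K' / s <= e]. *)
pose s := 2 * K' / e + 1.
have s0 : 0 < s by rewrite ltr_wpDl // divr_ge0 ?mulr_ge0 // ltW.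
have s20 : 0 < s ^+ 2 by rewrite exprn_gt0.
exists (s ^+ 2) => //.
apply: (@le_trans _ _ (fine (P [set w | X (s ^+ 2) w <= K']))).
  have mX k : measurable [set w | X (s ^+ 2) w <= k].
    exact/measurable_le_level/measurable_regular_X/ltW.
  rewrite -!mean_bool //; apply: le_mean; [exact: intg_bool..|] => w.
  by case: (leP _ K) => // XK; rewrite le_max XK.
rewrite prob_X_le // sqrtr_sqr (ger0_norm (ltW s0)).
apply: le_trans (normal_small s0 K0) _.
rewrite ler_pdivrMr // /s mulrDr mulr1 mulrCA divff ?lt0r_neq0 // mulr1.
by rewrite lerDl ltW.
Qed.

End regularization.

(** * Comparison at the quantiles *)

Section quantile.
Context {R : realType}.
Variable m : probability (measurableTypeR R) R.

Lemma tail_infty : (fun n : nat => tail m n%:R) @ \oo --> 0.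
Proof.
rewrite -[X in _ --> X](mean_cst m); under eq_fun do rewrite tailE.
have [] // := @dominated_mean _ _ _ m (fun n z => (n%:R <= z)%R%:R) (fun=> 0) (fun=> 1).
- by move=> n; exact: intg_measurable (intg_above m _).
- move=> z; apply: cvg_near_cst; exists (Num.trunc z).+1 => // n /= nz.
  by rewrite leNgt (lt_le_trans (truncnS_gt _)) // ler_nat.
- exact: intg_cst.
- by move=> n z; rewrite ger0_norm // lern1 leq_b1.
Qed.

(** The supremum is attained since the tail, built on closed half-lines, is continuous from the
    left; it is finite since the tail vanishes at infinity. *)
Lemma tail_inv_attained p : 0 < p -> p <= tail m 0 -> exists c,
  [/\ tail_inv m p = c%:E, 0 <= c, p <= tail m c & forall v, c < v -> tail m v < p].
Proof.
move=> p0 p1; pose A := [set x | 0 <= x /\ p <= tail m x].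
have A0 : A 0 by [].
have [N tN] : exists N : nat, tail m N%:R < p.
  have : \forall n \near \oo, tail m n%:R < p by exact: (cvgr_lt _ tail_infty).
  by case=> n _ /(_ n (leqnn n)); exists n.
have ubA : has_ubound A.
  exists N%:R => x [_ px]; rewrite leNgt; apply/negP => Nx.
  by have := le_trans px (tail_homo m (ltW Nx)); rewrite leNgt tN.
have c0 : 0 <= sup A by exact: ub_le_sup.
exists (sup A); split=> //.
- by rewrite /tail_inv ereal_sup_EFin //; exists 0.
- have un : (fun n : nat => sup A - n.+1%:R^-1) @ \oo --> sup A.
    rewrite -[X in _ --> X]subr0; apply: cvgB; first exact: cvg_cst.
    exact: cvg_harmonic.
  have ule n : sup A - n.+1%:R^-1 <= sup A by rewrite gerBl invr_ge0.
  have cu := @tail_left_continuous _ m _ _ un ule; rewrite -(cvg_lim _ cu) //.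
  apply: limr_ge; first by apply/cvg_ex; eexists; exact: cu.
  apply: nearW => n; have e0 : 0 < n.+1%:R^-1 :> R by rewrite invr_gt0.
  have [] := @sup_adherent _ A n.+1%:R^-1 e0; first by split=> //; exists 0.
  by move=> x [_ px] ux; apply: le_trans px (tail_homo m (ltW ux)).
- move=> v cv; rewrite ltNge; apply/negP => pv.
  by have /(ub_le_sup ubA) : A v; [split=> //; apply: le_trans (ltW cv)|rewrite leNgt cv].
Qed.

Lemma tail_inv_le0 p : p <= 0 -> tail_inv m p = +oo%E.
Proof.
move=> p0; apply/eqyP => A A0; apply: ereal_sup_ubound; exists A => //=.
by split; [exact: ltW|exact: le_trans (tail_ge0 _ _)].
Qed.

End quantile.

Lemma le_pstar {R : realType} (m : probability (measurableTypeR R) R) p :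
  p <= tail m 0 -> p <= pstar m p.
Proof.
move=> p1; rewrite /pstar; have [p0|p0] := leP p 0; first by rewrite tail_inv_le0.
by have [c [-> _ ? _]] := tail_inv_attained p0 p1.
Qed.

Section random_variable.
Context {d : measure_display} {T : measurableType d} {R : realType}.
Variable P : probability T R.

Local Notation mean X := (Rintegral P setT X).
Local Notation intg X := (P.-integrable setT (EFin \o X)).

Lemma law_probability (Y : T -> R) : measurable_fun setT Y ->
  exists mu : probability (measurableTypeR R) R,
    (mu : set (measurableTypeR R) -> \bar R) = pushforward P Y.
Proof.
move=> mY; pose Y' : {mfun T >-> measurableTypeR R} := HB.pack (Y : T -> measurableTypeR R)
  (isMeasurableFun.Build _ _ _ (measurableTypeR R) (Y : T -> measurableTypeR R) mY).
by exists (distribution P Y').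
Qed.

Lemma tail_law (Y : T -> R) x : measurable_fun setT Y ->
  tail (pushforward P Y) x = mean (fun w => (x <= Y w)%R%:R).
Proof.
move=> mY; rewrite (mean_bool P (measurable_level x mY)) /tail /pushforward.
by congr (fine (P _)); apply/seteqP; split => w /=; rewrite in_itv /= andbT.
Qed.

Lemma law_inv_attained (Y : T -> R) p : measurable_fun setT Y -> (forall w, 0 <= Y w) ->
  0 < p -> p <= 1 -> exists c,
  [/\ tail_inv (pushforward P Y) p = c%:E, 0 <= c, p <= mean (fun w => (c <= Y w)%R%:R) &
      forall v, c < v -> mean (fun w => (v <= Y w)%R%:R) < p].
Proof.
move=> mY Y0 p0 p1; have [mu muE] := law_probability mY.
have [|c] := @tail_inv_attained _ mu p p0.
  rewrite muE tail_law // (_ : (fun _ => _) = fun=> 1) ?mean_cst //.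
  by apply/funext => w; rewrite Y0.
rewrite muE tail_law // => -[cE c0 pc cv]; exists c; split=> // v /cv.
by rewrite tail_law.
Qed.

Lemma expected_excess_infty (Y : T -> R) : expected_excess P Y +oo%E = 0%E.
Proof.
rewrite /expected_excess; under eq_integral do rewrite /= max_r ?leNye //.
exact: integral0.
Qed.

Lemma expected_excess_ge0 (Y : T -> R) c : (0 <= expected_excess P Y c)%E.
Proof. by apply: integral_ge0 => w _; rewrite le_max lexx orbT. Qed.

(** Permits moving slightly above a quantile at the cost of [e]. *)
Lemma expected_excess_shift (Y : T -> R) c e : measurable_fun setT Y -> 0 <= e ->
  (expected_excess P Y c%:E <= expected_excess P Y (c + e)%:E + e%:E)%E.
Proof.
move=> mY e0; have <- : (\int[P]_w e%:E = e%:E)%E.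
  by rewrite integral_cst // -[RHS]mule1 -(@probability_setT _ _ _ P).
rewrite -ge0_integralD //; first last.
- exact: measurable_excess.
- by move=> w _; rewrite le_max lexx orbT.
apply: ge0_le_integral => //.
- by move=> w _; rewrite le_max lexx orbT.
- exact: measurable_excess.
- by apply: emeasurable_funD => //; exact: measurable_excess.
- move=> w _; rewrite -!EFinB -!EFin_max -EFinD lee_fin /Num.max.
  by do 2 case: ifPn; rewrite -?leNgt; lra.
Qed.

End random_variable.

(** * Both excesses measured against the same slices *)

Section comparison.
Context {d : measure_display} {T : measurableType d} {R : realType}.
Variable P : probability T R.
Variables (F : R -> set (set T)) (X L : R -> T -> R).

Local Notation mean X := (Rintegral P setT X).
Local Notation intg X := (P.-integrable setT (EFin \o X)).

Hypothesis XL : reflected_pair P F X L.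
Hypothesis hP : measure_is_complete P.
Variable m : probability (measurableTypeR R) R.
Variable S : T -> \bar R.
Hypothesis FS : stopping_time F S.
Hypothesis S_fin : P.-negligible [set w | S w == +oo%E].
Hypothesis X_ui : forall e, 0 < e -> exists K, forall n : nat,
  mean (fun w => Num.max (stopped X S n.+1%:R w - K) 0) <= e.
Hypothesis S_law : forall x, 0 < x ->
  mean (fun w => (x <= X_at X S w)%R%:R) <= tail m x.

Let LS := at_time L S.

Let mLS : measurable_fun setT LS.
Proof. exact: (measurable_at_time_L XL hP FS S_fin). Qed.

Let v_q (v q : R) : mean (fun w => (v <= LS w)%R%:R) <= q ->
  mean (fun w => (v <= L_at L S w)%R%:R) <= q.
Proof.
have iA : intg (fun w => (v <= L_at L S w)%R%:R).
  by apply: intg_bool; apply: measurable_level; exact: (measurable_L_at XL hP FS S_fin).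
have [] // := @ae_mean _ _ _ P _ (fun w => (v <= LS w)%R%:R) iA _ _.
- by apply: (intg_measurable (P := P)); apply: intg_bool; exact: measurable_level.
- apply: negligibleS (at_time_ae S_fin L) => w /=; apply: contraNneq => E.
  by rewrite /L_at E.
- by move=> _ ->.
Qed.

Lemma excess_le_slices (v q : R) (b : \bar R) : 0 < v -> (0 <= b)%E ->
  mean (fun w => (v <= LS w)%R%:R) <= q ->
  (forall delta J, 0 < delta ->
    ((delta * \sum_(j < J) Num.min q (tail m (j.+1%:R * delta)))%:E <= b)%E) ->
  (expected_excess P LS v%:E <= b)%E.
Proof.
move=> v0 b0 /v_q vq; case: b b0 => [b _ slices|_ _|//]; last by rewrite leey.
have [iY LY] := stopped_excess_le XL hP FS S_fin X_ui v0.
apply: (le_trans LY); rewrite lee_fin; apply/ler_addgt0Pr => delta d0.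
rewrite addrC; apply: (mean_slices _ _ _ iY vq S_law d0).
- exact: (measurable_X_at XL hP FS S_fin).
- by apply: measurable_level; exact: (measurable_L_at XL hP FS S_fin).
- by move=> w; rewrite mulr_ge0 // (X_ge0 XL).
- by move=> J; rewrite -lee_fin; exact: slices.
Qed.

Lemma quantile_excess_le (p q : R) (b : \bar R) : 0 <= p -> p <= q -> p <= 1 -> (0 <= b)%E ->
  (forall delta J, 0 < delta ->
    ((delta * \sum_(j < J) Num.min q (tail m (j.+1%:R * delta)))%:E <= b)%E) ->
  (expected_excess P LS (tail_inv (pushforward P LS) p) <= b)%E.
Proof.
rewrite le_eqVlt => /predU1P[<- _ _ b0 _|p0 pq p1 b0 slices].
  have [mu <-] := law_probability P mLS.
  by rewrite tail_inv_le0 // expected_excess_infty.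
have [|c [-> c0 _ cp]] := law_inv_attained P mLS _ p0 p1.
  by move=> w; exact: (L_ge0 XL).
apply/lee_addgt0Pr => e e0.
apply: (le_trans (expected_excess_shift P c mLS (ltW e0))); rewrite leeD2r //.
(* At the quantile [c] itself an atom may push the survival probability above [q], and [c] may be 0;
   at [c + e] the probability is below [p] and the level is positive, as optional stopping
   requires. *)
have ce0 : 0 < c + e by rewrite ltr_wpDl.
apply: (excess_le_slices ce0 b0 _ slices).
by apply: le_trans (ltW (cp _ _)) pq; rewrite ltrDl.
Qed.

Section first_hit_quantile.
Hypothesis X_null : forall t, 0 < t -> P [set w | X t w <= 0] = 0%E.
Hypothesis X_large : forall K e : R, 0 < e -> exists2 t, 0 < t &
  fine (P [set w | X t w <= K]) <= e.
Hypothesis hm1 : (\int[m]_(x in `[0%R, +oo[) x%:E < +oo)%E.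
Variable x0 : R.
Hypothesis x0_gt0 : 0 < x0.
Hypothesis tail_x0 : 0 < tail m x0.

Let L0 := at_time L (first_hit X L (HL_barrier m)).

Lemma measurable_HL_hit : measurable_fun setT L0.
Proof.
apply: (measurable_first_hit XL X_null X_large (HL_barrier_homo hm1) _ (C := 16) _ _ hP).
- exact: (HL_barrier_gt0 hm1 x0_gt0 tail_x0).
- by [].
- exact: (HL_barrier_linear hm1).
Qed.

(** The quantiles are used from opposite sides: survival of the local time at the first hit is at
    least [q] at its quantile, and that of [LS] is below [p <= q] just above its own. The slices cut
    at [q] separate the two excesses. *)
Lemma quantile_comparison p q : 0 <= p -> p <= q -> 0 < q -> q <= 1 ->
  (expected_excess P LS (tail_inv (pushforward P LS) p) <=
   expected_excess P L0 (tail_inv (pushforward P L0) q))%E.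
Proof.
move=> p0 pq q0 q1.
have [|c [-> c0 qc _]] := law_inv_attained P measurable_HL_hit _ q0 q1.
  by move=> w; exact: (L_ge0 XL).
apply: (quantile_excess_le p0 pq (le_trans pq q1) (expected_excess_ge0 _ _ _)) => delta J d0.
exact: (first_hit_slices XL X_null X_large hP hm1 x0_gt0 tail_x0 J d0 c0 (ltW q0) qc).
Qed.

End first_hit_quantile.
End comparison.

(** * Invariance of quantiles and excesses under almost sure equality *)

Section ae_equal.
Context {d : measure_display} {T : measurableType d} {R : realType}.
Variable P : probability T R.
Hypothesis hP : measure_is_complete P.
Variables Y Z : T -> R.
Hypothesis mY : measurable_fun setT Y.
Hypothesis YZ : P.-negligible [set w | Y w != Z w].

Local Notation mean X := (Rintegral P setT X).

Lemma ae_measurable_real : measurable_fun setT Z.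
Proof.
apply/measurable_EFinP; apply: (ae_measurable_fun hP (f := EFin \o Y)).
  apply: negligibleS YZ => w /= h; apply/eqP => E; apply: h => _.
  by rewrite E.
exact/measurable_EFinP.
Qed.

Lemma ae_mean_level x : mean (fun w => (x <= Y w)%R%:R) = mean (fun w => (x <= Z w)%R%:R).
Proof.
have mZ := ae_measurable_real.
have [] // := @ae_mean _ _ _ P (fun w => (x <= Y w)%R%:R) (fun w => (x <= Z w)%R%:R).
- by apply: intg_bool; exact: measurable_level.
- by apply: (intg_measurable (P := P)); apply: intg_bool; exact: measurable_level.
- by apply: negligibleS YZ => w /=; apply: contraNneq => ->.
Qed.

Lemma ae_tail_inv p : tail_inv (pushforward P Y) p = tail_inv (pushforward P Z) p.
Proof.
rewrite /tail_inv; congr (ereal_sup (_ @` _)); apply/funext => x /=.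
by rewrite !tail_law ?ae_mean_level //; exact: ae_measurable_real.
Qed.

Lemma ae_expected_excess c : expected_excess P Y c = expected_excess P Z c.
Proof.
have m (X : T -> R) : measurable_fun setT X ->
    measurable_fun setT (fun w => maxe ((X w)%:E - c) 0)%E.
  move=> mX; apply: measurable_maxe; last exact: measurable_cst.
  by apply: emeasurable_funB => //; exact/measurable_EFinP.
apply: ae_eq_integral => //; [exact: m|exact/m/ae_measurable_real|].
by apply: negligibleS YZ => w /= h; apply/eqP => E; apply: h => _; rewrite E.
Qed.

End ae_equal.

(** * From the regularized pair back to [B] and [L] *)

Section transfer.
Context {d : measure_display} {T : measurableType d} {R : realType}.
Variable P : probability T R.
Hypothesis hP : measure_is_complete P.
Variables B L : R -> T -> R.
Hypothesis hB : brownian_motion P B.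
Hypothesis hL : local_time_at_0 P B L.

Local Notation mean X := (Rintegral P setT X).
Local Notation F := (completed_filtration P B).
Local Notation X := (regular_X B L).
Local Notation Lr := (regular_L B L).
Local Notation G := (regular_path B L).

Lemma at_time_regular_L (tau : T -> \bar R) w : (0 <= tau w)%E -> G w ->
  at_time Lr tau w = at_time L tau w.
Proof. by move=> t0 Gw; rewrite /at_time regular_LE // fine_ge0. Qed.

Lemma first_hit_regular (m : probability (measurableTypeR R) R) w :
  (\int[m]_(x in `[0%R, +oo[) x%:E < +oo)%E -> G w ->
  first_hit X Lr (HL_barrier m) w = hitting_time B L m w.
Proof.
move=> hm1 Gw; congr (ereal_inf (_ @` _)); apply/seteqP.
split => t /= [t0]; rewrite regular_XE ?regular_LE ?(ltW t0) // => h; split=> //.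
  by rewrite h HL_barrierE.
by move: h; rewrite -(HL_barrierE hm1) => -[].
Qed.

Lemma hitting_time_ge0 (m : probability (measurableTypeR R) R) w :
  (0 <= hitting_time B L m w)%E.
Proof. by apply: le_ereal_inf_tmp => _ [t [t0 _] <-]; rewrite lee_fin ltW. Qed.

Variable S : T -> \bar R.
Hypothesis FS : stopping_time F S.
Hypothesis S_fin : P.-negligible [set w | S w == +oo%E].

Lemma regular_ui : martingale P F (stopped B S) -> uniformly_integrable P (stopped B S) ->
  forall e, 0 < e -> exists K, forall n : nat,
  mean (fun w => Num.max (stopped X S n.+1%:R w - K) 0) <= e.
Proof.
(* A nonnegative threshold makes the excess at most [Z] on [K <= Z], and it is 0 elsewhere. *)
move=> [_ iB _] ui e e0; have [K KE] := ui e e0; exists (Num.max K 0) => n.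
have n0 : 0 <= n.+1%:R :> R by [].
pose Z w := `|stopped B S n.+1%:R w|.
have iZ : P.-integrable setT (EFin \o Z) by exact/intg_norm/iB.
have iX : P.-integrable setT (EFin \o stopped X S n.+1%:R).
  exact: (intg_stopped (regular_pair hP hB hL) (ltr0Sn R n) FS).
have XZ w : G w -> stopped X S n.+1%:R w = Z w.
  move=> Gw; rewrite /stopped regular_XE // fine_ge0 //.
  by rewrite le_min lee_fin n0 FS.1.
have [] // := @ae_mean _ _ _ P (fun w => Num.max (stopped X S n.+1%:R w - Num.max K 0) 0)
  (fun w => Num.max (Z w - Num.max K 0) 0).
- exact: intg_max.
- exact: intg_measurable (intg_max _ iZ).
- by apply: (regular_ae_eq hB hL) => w Gw; rewrite XZ.
have mA : measurable [set w | K <= Z w].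
  by apply: measurable_level; exact: intg_measurable iZ.
move=> _ ->; apply: le_trans (_ : mean (fun w => Z w * \1_[set w | K <= Z w] w) <= _).
  apply: le_mean; [exact: intg_max|exact: intgM_indic|] => w.
  rewrite indicE; have [KZ|ZK] := leP K (Z w).
    by rewrite mem_set // mulr1 ge_max normr_ge0 gerBl le_max lexx orbT.
  rewrite memNset; last by apply/negP; rewrite -ltNge.
  by rewrite mulr0 ge_max lexx andbT subr_le0 le_max (ltW ZK).
rewrite -lee_fin -EFin_mean; last exact: intgM_indic.
by rewrite -(mean_set P Z); exact: KE.
Qed.

Lemma regular_law (m : probability (measurableTypeR R) R) x :
  (forall A : set R, measurable A -> pushforward P (fun w => `|at_time B S w|) A = m A) ->
  mean (fun w => (x <= X_at X S w)%R%:R) = tail m x.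
Proof.
move=> law; have mX := measurable_X_at (regular_pair hP hB hL) hP FS S_fin.
have XB : P.-negligible [set w | X_at X S w != `|at_time B S w|].
  apply: negligibleS (negligibleU (regular_negligible hB hL) (at_time_ae S_fin X)) => w /=.
  move=> XBw; have [Gw|] := pselect (G w); last by left.
  right; apply: contraNN XBw => /eqP E; rewrite /X_at E.
  by rewrite /at_time regular_XE // fine_ge0 // FS.1.
rewrite (ae_mean_level hP mX XB) -(tail_law _ _ (ae_measurable_real hP mX XB)).
by rewrite /tail law.
Qed.

End transfer.

Theorem proposition9 (R : realType) (d : measure_display)
  (Omega : measurableType d) (P : probability Omega R)
  (hP : measure_is_complete P)
  (B L : R -> Omega -> R)
  (hB : brownian_motion P B)
  (hL : local_time_at_0 P B L)
  (m : probability (measurableTypeR R) R)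
  (hm : m `[0, +oo[%classic = 1%E)
  (hm1 : (\int[m]_(x in `[0%R, +oo[) x%:E < +oo)%E)
  (T : Omega -> \bar R)
  (hT : stopping_time (completed_filtration P B) T)
  (hTfin : {ae P, forall w, (T w < +oo)%E})
  (hTlaw : forall A : set R, measurable A ->
     pushforward P (fun w => `|at_time B T w|) A = m A)
  (hTmart : martingale P (completed_filtration P B) (stopped B T))
  (hTui : uniformly_integrable P (stopped B T))
  (p : R) (hp0 : 0 <= p) (hp1 : p <= 1) :
  let LT := at_time L T in
  let LTm := at_time L (hitting_time B L m) in
  let rhoT := pushforward P LT in
  let rhoTm := pushforward P LTm in
  p <= pstar m p /\
  (expected_excess P LT (tail_inv rhoT p) <=
   expected_excess P LTm (tail_inv rhoTm (pstar m p)))%E.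
Proof.
move=> LT LTm rhoT rhoTm.
have ppq : p <= pstar m p by apply: le_pstar; rewrite /tail hm.
split=> //.
have q1 : pstar m p <= 1.
  by rewrite /pstar /tail_ext; case: (tail_inv m p) => [r||] //; exact: tail_le1.
have T_fin : P.-negligible [set w | T w == +oo%E].
  by apply: negligibleS hTfin => w /= /eqP ->.
have XL := regular_pair hP hB hL; pose X := regular_X B L; pose Lr := regular_L B L.
have mLT := measurable_at_time_L XL hP hT T_fin.
have LT_ae : P.-negligible [set w | at_time Lr T w != LT w].
  by apply: (regular_ae_eq hB hL) => w Gw; rewrite at_time_regular_L // hT.1.
rewrite /rhoT -(ae_tail_inv hP mLT LT_ae) -(ae_expected_excess hP mLT LT_ae).
have X_ui := regular_ui hP hB hL hT hTmart hTui.
have T_law x (_ : 0 < x) : \int[P]_w (x <= X_at X T w)%R%:R <= tail m x.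
  by rewrite (regular_law hP hB hL hT T_fin x hTlaw).
have E0 := expected_excess_ge0 P LTm (tail_inv rhoTm (pstar m p)).
(* A positive barrier requires mass of [m] beyond some [x0 > 0]. If there is none, every slice
   vanishes, and the left-hand side is bounded by any nonnegative quantity. *)
have [[x0 [x0_gt0 tx0]]|t0] := pselect (exists x, 0 < x /\ 0 < tail m x); last first.
  apply: (quantile_excess_le XL hP hT T_fin X_ui T_law hp0 ppq hp1 E0) => delta J d0.
  rewrite big1 ?mulr0 // => j _; apply/eqP.
  rewrite eq_le le_min (le_trans hp0 ppq) tail_ge0 ge_min orbC andbT.
  rewrite leNgt; case: ltP => // tj.
  by case: t0; eexists; split; last exact: tj; rewrite mulr_gt0.
(* At a zero probability level the slices, cut at [pstar m p], are again at most 0. *)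
have [q0|q0] := leP (pstar m p) 0.
  apply: (quantile_excess_le XL hP hT T_fin X_ui T_law hp0 ppq hp1 E0) => delta J d0.
  apply: le_trans E0; rewrite lee_fin pmulr_rle0 //.
  by apply: sumr_le0 => j _; rewrite ge_min q0.
have mL0 := measurable_HL_hit XL hP (regular_X_null hP hB hL) (regular_X_large hP hB hL)
  hm1 x0_gt0 tx0.
have LTm_ae : P.-negligible [set w | at_time Lr (first_hit X Lr (HL_barrier m)) w != LTm w].
  apply: (regular_ae_eq hB hL) => w Gw; rewrite -[RHS](at_time_regular_L (hitting_time_ge0 _ _ _ _) Gw).
  by rewrite /at_time (first_hit_regular hm1 Gw).
rewrite /rhoTm -(ae_tail_inv hP mL0 LTm_ae) -(ae_expected_excess hP mL0 LTm_ae).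
exact: (quantile_comparison XL hP hT T_fin X_ui T_law (regular_X_null hP hB hL)
  (regular_X_large hP hB hL) hm1 x0_gt0 tx0 hp0 ppq q0 q1).
Qed.
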